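(* A Banach space $X$ is linearly isomorphic to $c_0(\mathbb N)$ if and only if $X$ is Lipschitz isomorphic to $c_0(\mathbb N)$ (i.e. there is a bijection $U:X\to c_0(\mathbb N)$ with $U$ and $U^{-1}$ Lipschitz).
   Context: $c_0(\mathbb N)$ is the Banach space of real null sequences with the supremum norm. *)

(* Defs.v *)
From HB Require Import structures.
From mathcomp Require Import all_boot all_order all_algebra.
From mathcomp Require Import all_classical all_reals all_analysis.
Set Implicit Arguments. Unset Strict Implicit. Unset Printing Implicit Defensive.
Import Order.TTheory GRing.Theory Num.Theory.
Import numFieldNormedType.Exports.
Local Open Scope classical_set_scope.
Local Open Scope ring_scope.

Section C0.
Variable R : realType.

Definition c0_pred : pred (nat -> R) := fun u => `[< u @ \oo --> (0 : R) >].

Lemma c0_closed : subsemimod_closed c0_pred.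
Proof.
split; first split.
- by apply/asboolP; exact: cvg_cst.
- move=> u v /asboolP cu /asboolP cv; apply/asboolP.
  by rewrite -(addr0 0); exact: cvgD.
- move=> a u /asboolP cu; apply/asboolP.
  by rewrite -(scaler0 _ a); exact: cvgZr.
Qed.

HB.instance Definition _ := GRing.isSubmodClosed.Build R (nat -> R) c0_pred c0_closed.

Record c0 := C0 { c0val :> nat -> R; c0valP : c0val \in c0_pred }.

HB.instance Definition _ := [isSub for c0val].
HB.instance Definition _ := [Choice of c0 by <:].
#[warnings="-redundant-canonical-projection"]
HB.instance Definition _ := [SubChoice_isSubLmodule of c0 by <:].

Definition c0_norm (u : c0) : R := sup (range (fun n => `|c0val u n|)).

Lemma c0_bounded (u : c0) : has_ubound (range (fun n => `|c0val u n|)).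
Proof.
have /asboolP cu := c0valP u.
have /cvg_seq_bounded [M [_ HM]] : cvgn (c0val u) by apply/cvg_ex; exists 0.
exists (M + 1) => _ [n _ <-]; by apply: HM => //=; rewrite ltrDl ltr01.
Qed.

Lemma c0_le_norm (u : c0) n : `|c0val u n| <= c0_norm u.
Proof. by apply: sup_upper_bound; [split; [exists `|c0val u 0|, 0|exact: c0_bounded]|exists n]. Qed.

Lemma c0_norm_le (u : c0) M : (forall n, `|c0val u n| <= M) -> c0_norm u <= M.
Proof. by move=> H; apply: ge_sup; [exists `|c0val u 0|, 0|move=> _ [n _ <-]]. Qed.

Lemma c0_norm_ge0 (u : c0) : 0 <= c0_norm u.
Proof. exact: le_trans (c0_le_norm u 0). Qed.

Lemma c0_ler_normD (x y : c0) : c0_norm (x + y) <= c0_norm x + c0_norm y.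
Proof.
apply: c0_norm_le => n /=.
by apply: le_trans (ler_normD _ _) _; apply: lerD; apply: c0_le_norm.
Qed.

Lemma c0_normrZ (l : R) (x : c0) : c0_norm (l *: x) = `|l| * c0_norm x.
Proof.
have [->|l0] := eqVneq l 0.
  rewrite normr0 mul0r; apply/eqP; rewrite eq_le c0_norm_ge0 andbT.
  by apply: c0_norm_le => n /=; rewrite scale0r normr0.
apply/eqP; rewrite eq_le; apply/andP; split.
  apply: c0_norm_le => n /=; rewrite normrM.
  by apply: ler_wpM2l => //; apply: c0_le_norm.
rewrite -ler_pdivlMl ?normr_gt0 //; apply: c0_norm_le => n.
rewrite ler_pdivlMl ?normr_gt0 //.
have := c0_le_norm (l *: x) n; rewrite /= normrM //.
Qed.

Lemma c0_normr0_eq0 (x : c0) : c0_norm x = 0 -> x = 0.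
Proof.
move=> H; apply: val_inj; apply/funext => n /=.
by apply/eqP; rewrite -normr_le0 -H c0_le_norm.
Qed.

HB.instance Definition _ := Lmodule_isNormed.Build R c0
  c0_ler_normD c0_normrZ c0_normr0_eq0.

End C0.

(* Main.v *)
Require Import Defs.
From HB Require Import structures.
From mathcomp Require Import all_boot all_order all_algebra.
From mathcomp Require Import all_classical all_reals all_analysis.
From mathcomp Require Import ring lra zify.
Import Order.TTheory GRing.Theory Num.Theory.
Import numFieldNormedType.Exports.
Set Implicit Arguments. Unset Strict Implicit. Unset Printing Implicit Defensive.
Local Open Scope classical_set_scope.
Local Open Scope ring_scope.

(** Let [U : X -> c0] be a Lipschitz bijection with Lipschitz inverse [V].

    On the dual of [X] use the norm [g |-> Lip (g o V)]. Since approximate midpoints in [c0] form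
    large sets, the Gorelik principle (whose topological core is a discrete Poincare-Miranda
    theorem) shows that [|g + h| >= |g| + c |h| - eps] as soon as [h] is weak-* close to [0].
    Covering the weak-* compact dual ball by finitely many neighbourhoods adapted to their centres,
    every functional becomes, up to a small error, a sum of functionals from fixed finite sets
    tending weak-* to [0], with control of the sum of the norms; this is a linear embedding [J] of
    [X] into [c0].

    As [U] extends to a Lipschitz map on [c0], there is a Lipschitz map [Phi : c0 -> X] with
    [Phi o J = id]. Averaging its difference quotients yields uniformly bounded finite rank
    operators [T n : c0 -> X] with [T n o J -> id]. Along a limit of their matrices, truncations
    [tau n] of the [T n] are such that both [tau n o J] and its adjoint approximate the identity,
    so that the differences of consecutive terms are almost disjoint blocks: [X] is complemented
    in [c0]. A gliding hump shows that [c0] is complemented in [X], and Pelczynski's decomposition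
    method concludes. *)


(** * A reflexive decision procedure for equalities in abelian groups *)

(** Lipschitz maps into [c0] may be nowhere differentiable, so [U] and [V] cannot be linearised by
    taking derivatives; and since [X] is not known to be a dual space, limits of averaged difference
    quotients would a priori lie in the bidual. Hence two indirect routes. The inequality
    [|g + h| >= |g| + c |h| - eps] says that the dual of [X] behaves like [l1] against weak-* small
    perturbations, which is what a subspace of [c0] forces on its dual; [J] is built from this
    property alone. The averages, on the other hand, are kept finite: the slopes then belong to [X],
    at the price of approximate linearity, on finitely many vectors at a time. Convergence of
    [T n o J] to the identity at each point says nothing about adjoints, and without control on both
    sides the blocks made of consecutive differences could overlap on many coordinates and have
    unbounded sums. The remedy is that each row of the limit matrix is in [l1]: cutting it far away
    costs an error that is uniform on the unit ball of [X]. *)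

Section AbelianGroupReflection.
Variable M : zmodType.

Inductive aexp := AVar of nat | AZero | AAdd of aexp & aexp | AOpp of aexp.

Fixpoint aeval (env : seq M) e : M :=
  match e with
  | AVar i => nth 0 env i
  | AZero => 0
  | AAdd a b => aeval env a + aeval env b
  | AOpp a => - aeval env a
  end.

Fixpoint acoef e (i : nat) : int :=
  match e with
  | AVar j => (i == j)%:Z
  | AZero => 0
  | AAdd a b => acoef a i + acoef b i
  | AOpp a => - acoef a i
  end.

Lemma aevalE env e : aeval env e = \sum_(i < size env) nth 0 env i *~ acoef e i.
Proof.
elim: e => [j||a IHa b IHb|a IHa] /=.
- have [js|js] := ltnP j (size env).
    rewrite (bigD1 (Ordinal js)) //= eqxx mulr1z big1 ?addr0 // => i /eqP ij.
    by rewrite (_ : (i == j :> nat) = false) //; apply/eqP => E; apply: ij; exact: val_inj.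
  rewrite nth_default // big1 // => i _.
  by rewrite (_ : (i == j :> nat) = false) //; apply/eqP => E; have := ltn_ord i; rewrite E ltnNge js.
- by rewrite big1.
- by rewrite IHa IHb -big_split; apply: eq_bigr => i _; rewrite mulrzDr.
- by rewrite IHa -sumrN; apply: eq_bigr => i _; rewrite mulrNz.
Qed.

(** The coefficients are integers that compute, so the hypothesis is decided by evaluation even over
    an abstract group. Variables beyond the environment evaluate to 0, so only the indices below
    [size env] matter. *)
Lemma abelP env e1 e2 : all (fun i => acoef e1 i == acoef e2 i) (iota 0 (size env)) ->
  aeval env e1 = aeval env e2.
Proof.
move=> /allP h; rewrite !aevalE; apply: eq_bigr => i _.
by congr (_ *~ _); apply/eqP/h; rewrite mem_iota ltn_ord.
Qed.
End AbelianGroupReflection.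

Ltac abel_eq x y := match constr:(tt) with _ => let _ := match goal with _ => unify x y end in true | _ => false end.
Ltac abel_in x l :=
  lazymatch l with
  | nil => false
  | ?y :: ?r => match abel_eq x y with true => true | false => abel_in x r end
  end.
Ltac abel_atoms l t :=
  lazymatch t with
  | (?a + ?b)%R => let l := abel_atoms l a in abel_atoms l b
  | (- ?a)%R => abel_atoms l a
  | 0%R => l
  | _ => match abel_in t l with true => l | false => constr:(t :: l) end
  end.
Ltac abel_index x l :=
  lazymatch l with
  | ?y :: ?r => match abel_eq x y with
    | true => constr:(0%N)
    | false => let n := abel_index x r in constr:(S n)
    end
  end.
Ltac abel_reify l t :=
  lazymatch t with
  | (?a + ?b)%R => let a := abel_reify l a in let b := abel_reify l b in constr:(AAdd a b)
  | (- ?a)%R => let a := abel_reify l a in constr:(AOpp a)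
  | 0%R => constr:(AZero)
  | _ => let n := abel_index t l in constr:(AVar n)
  end.
(* Atoms are compared up to conversion: they often differ in the path of canonical instances. *)
Ltac abel :=
  lazymatch goal with
  | |- @eq ?T ?a ?b =>
    let l := abel_atoms (@nil T) a in let l := abel_atoms l b in
    let ea := abel_reify l a in let eb := abel_reify l b in
    exact: (@abelP _ l ea eb isT)
  end.

(** * A discrete Poincare-Miranda theorem *)

Section CubicalMiranda.
Variable N : nat.
Notation pos := ('I_N -> nat).
Notation K := 'F_2.

Definition shift (a : 'I_N) (p : pos) : pos := fun j => (p j + (j == a))%N.

(* Cup product of the coboundaries [d s], for [s] in [l], of cubical cochains mod 2: [S] is the
   set of directions of the cube with lowest vertex [p]. *)
Fixpoint cupd (l : seq (pos -> K)) (S : {set 'I_N}) (p : pos) : K :=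
  if l is s :: l' then
    \sum_(a in S) (s (shift a p) + s p) * cupd l' (S :\ a) (shift a p)
  else (S == finset.set0)%:R.

Definition cobd (c : {set 'I_N} -> pos -> K) (S : {set 'I_N}) (p : pos) : K :=
  \sum_(a in S) (c (S :\ a) (shift a p) + c (S :\ a) p).

Lemma addF2 (x : K) : x + x = 0.
Proof. by apply: addrr_pchar2; rewrite inE /=; apply/eqP; exact: val_inj. Qed.

Lemma shiftC a b p : shift a (shift b p) = shift b (shift a p).
Proof. by apply/funext => j; rewrite /shift addnAC. Qed.

Lemma In_map_enum (I : eqType) T (f : I -> T) (l : seq I) a :
  a \in l -> List.In (f a) (map f l).
Proof.
elim: l => //= b l IH; rewrite inE => /orP[/eqP ->|/IH]; [by left|by right].
Qed.

(** Every unordered pair is counted twice, and 2 = 0 in the field with two elements. *)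
Lemma sum_sym_pairs (S : {set 'I_N}) (h : 'I_N -> 'I_N -> K) :
  (forall a b, h a b = h b a) ->
  \sum_(a in S) \sum_(b in S :\ a) h a b = 0.
Proof.
move=> hC.
have -> : \sum_(a in S) \sum_(b in S :\ a) h a b =
    \sum_(a in S) \sum_(b in S | (a < b)%N) h a b +
    \sum_(a in S) \sum_(b in S | (b < a)%N) h a b.
  rewrite -big_split /=; apply: eq_bigr => a aS.
  rewrite (bigID (fun b : 'I_N => (a < b)%N)) /=; congr (_ + _).
    apply: eq_bigl => b; rewrite !inE -val_eqE /=.
    by case: (b \in S); rewrite ?andbF //=; lia.
  apply: eq_bigl => b; rewrite !inE -val_eqE /=.
  by case: (b \in S); rewrite ?andbF //=; lia.
rewrite [X in _ + X](exchange_big_dep (fun b => b \in S)) /=; last by move=> ? ? _ /andP[].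
rewrite -[RHS](addF2 (\sum_(a in S) \sum_(b in S | (a < b)%N) h a b)); congr (_ + _).
apply: eq_bigr => a aS; apply: eq_big => b; first by rewrite aS.
by move=> _; exact: hC.
Qed.

Lemma cobd_cobd c S p : cobd (cobd c) S p = 0.
Proof.
rewrite /cobd; under eq_bigr do rewrite -big_split /=.
apply: sum_sym_pairs => a b.
have -> : S :\ b :\ a = S :\ a :\ b by apply/setP => x; rewrite !inE andbCA.
by rewrite (shiftC b a); ring.
Qed.

Definition cmul (s : pos -> K) (c : {set 'I_N} -> pos -> K) S p := s p * c S p.

(** Leibniz rule for a 0-cochain [s] and a cochain [c]: the coboundary of [s c] is [d s] times [c]
    plus [s] times [d c], and the last term vanishes because [c] is closed. As in the cubical cup
    product, [cmul] evaluates [s] at the lowest vertex. *)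
Lemma cupd_cobd s l :
  (forall S p, cobd (cupd l) S p = 0) ->
  forall S p, cupd (s :: l) S p = cobd (cmul s (cupd l)) S p.
Proof.
move=> cl S p.
have /(congr1 (fun x => s p * x)) := cl S p; rewrite mulr0 /cobd mulr_sumr => E.
rewrite -[RHS]addr0 -[X in _ = _ + X]E -big_split /=; apply: eq_bigr => a _; rewrite /cmul.
rewrite -[LHS]addr0 -[X in _ + X](addF2 (s p * cupd l (S :\ a) p)); ring.
Qed.

Lemma cobd_cupd l S p : cobd (cupd l) S p = 0.
Proof.
elim: l S p => [|s l IH] S p; first by apply: big1 => a _ /=; exact: addF2.
rewrite -[RHS](cobd_cobd (cmul s (cupd l)) S p).
by apply: eq_bigr => a _; rewrite !cupd_cobd.
Qed.

(** A cube without direction [a] lies in a hyperplane orthogonal to [a]. When [s] is constant there,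
    its coboundary is zero on all edges of the cube. This is how the boundary conditions kill the
    lateral faces. *)
Lemma cupd_const l s a (S : {set 'I_N}) p (k : K) : List.In s l -> a \notin S ->
  (forall q, q a = p a -> s q = k) -> cupd l S p = 0.
Proof.
elim: l S p => //= t l IH S p [->|sl] aS sk; apply: big1 => b bS.
  rewrite !sk ?addF2 ?mul0r // /shift; case: eqP => [ab|]; last by rewrite addn0.
  by rewrite ab bS in aS.
have ba : (shift b p) a = p a.
  by rewrite /shift; case: eqP => [ab|]; [rewrite ab bS in aS|rewrite addn0].
by rewrite IH ?mulr0 // ?in_setD1 ?(negbTE aS) ?andbF // => q; rewrite ba; exact: sk.
Qed.

(** A nonzero term of the product is a path of edges of the cube, one for each factor, on which that
    factor changes; [q] and [q'] are the ends of the edge given to [s]. *)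
Lemma cupd_neq0 l S p : cupd l S p != 0 -> forall s, List.In s l ->
  exists q q' : pos, [/\ forall j, (p j <= q j <= p j + (j \in S))%N,
    forall j, (p j <= q' j <= p j + (j \in S))%N & s q != s q'].
Proof.
elim: l S p => //= t l IH S p h s sl.
have /existsP[a /andP[aS]] : [exists a, (a \in S) &&
    ((t (shift a p) + t p) * cupd l (S :\ a) (shift a p) != 0)].
  apply: contraNT h => /existsPn h; apply/eqP/big1 => a aS.
  by move: (h a); rewrite aS /= negbK => /eqP.
rewrite mulf_eq0 negb_or => /andP[ht hl]; case: sl => [<-|sl].
  exists (shift a p), p; split => [j|j|].
  - rewrite /shift; case: eqP => [->|_]; first by rewrite aS; lia.
    by rewrite addn0; lia.
  - lia.
  - by apply: contraNneq ht => ->; rewrite addF2.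
have [q [q' [hq hq' ne]]] := IH _ _ hl _ sl.
have aux (r : pos) : (forall j, (shift a p j <= r j <= shift a p j + (j \in S :\ a))%N) ->
    forall j, (p j <= r j <= p j + (j \in S))%N.
  move=> hr j; move: (hr j); rewrite /shift in_setD1.
  have [->|ja] := eqVneq j a => /=; first by rewrite aS; lia.
  by case: (j \in S); lia.
by exists q, q'; split => //; exact: aux.
Qed.

Variable n : nat.
Hypothesis n_gt0 : (0 < n)%N.

Definition posf (p : {ffun 'I_N -> 'I_n.+1}) : pos := fun j => p j.

Definition rotc (a : 'I_N) (p : {ffun 'I_N -> 'I_n.+1}) : {ffun 'I_N -> 'I_n.+1} :=
  [ffun j => if j == a then ordS (p j) else p j].

Lemma rotc_inj a : injective (rotc a).
Proof.
move=> p q /ffunP h; apply/ffunP => j; move: (h j); rewrite !ffunE.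
by case: eqP => // _; exact: (can_inj (@ordSK n.+1)).
Qed.

(* [rotc] shifts coordinate [a] cyclically, so that reindexing by it telescopes the sum. *)
Lemma telescope_box (a : 'I_N) (w : 'I_N -> nat -> bool) (F : pos -> K) :
  \sum_(p : {ffun 'I_N -> 'I_n.+1}) (\prod_j (if j == a then (p j < n)%N else w j (p j))%:R) *
     (F (shift a (posf p)) + F (posf p)) =
  \sum_(p : {ffun 'I_N -> 'I_n.+1}) (\prod_j (if j == a then true else w j (p j))%:R) *
     ((p a == n :> nat)%:R + (p a == 0 :> nat)%:R) * F (posf p).
Proof.
have E (p : {ffun 'I_N -> 'I_n.+1}) (b : nat -> bool) :
    \prod_j (if j == a then b (p j) else w j (p j))%:R =
    (\prod_j (if j == a then true else w j (p j))%:R) * (b (p a))%:R :> K.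
  rewrite (bigD1 a) //= eqxx [X in _ = X * _](bigD1 a) //= eqxx mul1r mulrC.
  by congr (_ * _); apply: eq_bigr => j /negbTE ->.
have -> : \sum_(p : {ffun 'I_N -> 'I_n.+1}) (\prod_j (if j == a then (p j < n)%N else w j (p j))%:R) *
     (F (shift a (posf p)) + F (posf p)) =
   \sum_(p : {ffun 'I_N -> 'I_n.+1}) (\prod_j (if j == a then true else w j (p j))%:R) *
     (0 < p a)%N%:R * F (posf p) +
   \sum_(p : {ffun 'I_N -> 'I_n.+1}) (\prod_j (if j == a then true else w j (p j))%:R) *
     (p a < n)%N%:R * F (posf p).
  under eq_bigr do rewrite mulrDr.
  rewrite big_split /=; congr (_ + _); last first.
    by apply: eq_bigr => p _; rewrite (E p (fun x => x < n)%N).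
  rewrite [RHS](reindex_inj (@rotc_inj a)) /=; apply: eq_bigr => p _.
  rewrite (E p (fun x => x < n)%N) ffunE eqxx /=.
  have -> : \prod_j (if j == a then true else w j (rotc a p j))%:R =
            \prod_j (if j == a then true else w j (p j))%:R :> K.
    by apply: eq_bigr => j _; rewrite ffunE; case: eqP.
  have [pn|pn] := ltnP (p a) n; last first.
    have -> : ((p a).+1 %% n.+1)%N = 0%N.
      by rewrite (_ : (p a).+1 = n.+1) ?modnn //; have := ltn_ord (p a); lia.
    by rewrite ltnn !mulr0 !mul0r.
  rewrite modn_small //= mulr1; congr (_ * F _).
  apply/funext => j; rewrite /posf /shift ffunE; case: eqP => [->|_].
    by rewrite /= modn_small // addn1.
  by rewrite addn0.
rewrite -big_split /=; apply: eq_bigr => p _; rewrite -mulrDl -mulrDr.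
congr (_ * _ * _); have := ltn_ord (p a).
case: (ltngtP (p a) n) => pn; case: (ltngtP 0 (p a)) => p0 //= pl;
  rewrite ?addr0 ?add0r ?addF2 //; exfalso; lia.
Qed.

(* Stokes: the top-dimensional cochain is a coboundary, and by the boundary conditions only the
   face where coordinate [i] equals [n] contributes. *)
Lemma box_parity (s : 'I_N -> pos -> K) :
  (forall i q, q i = 0%N -> s i q = 0) -> (forall i q, q i = n -> s i q = 1) ->
  forall i, (i <= N)%N ->
  \sum_(p : {ffun 'I_N -> 'I_n.+1})
    (\prod_(j < N) (if (j < i)%N then p j == n :> nat else (p j < n)%N)%:R) *
    cupd [seq s j | j <- drop i (enum 'I_N)] [set j : 'I_N | (i <= j)%N]%SET (posf p) = 1.
Proof.
move=> s0 s1 i iN; rewrite -(subKn iN).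
(* Descending induction on [i]. For [i = N] the weights leave only the corner with all coordinates
   [n], where the empty cup product is 1. *)
elim: (N - i)%N (leq_subr i N) => [|k IH] kN.
  rewrite subn0 drop_oversize ?size_enum_ord //=.
  have -> : [set j : 'I_N | (N <= j)%N]%SET = finset.set0.
    by apply/setP => j; rewrite !inE leqNgt ltn_ord.
  rewrite eqxx (bigD1 [ffun=> ord_max]) //= big1 => [|j _]; last by rewrite ltn_ord ffunE /= eqxx.
  rewrite mul1r big1 ?addr0 // => p pm.
  suff /existsP[j pj] : [exists j, p j != n :> nat].
    by rewrite (bigD1 j) //= ltn_ord (negbTE pj) mulr0n !mul0r.
  apply: contraNT pm => /existsPn h; apply/eqP/ffunP => j; rewrite ffunE.
  by apply: val_inj; move: (h j); rewrite negbK => /eqP.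
have kN' : (k <= N)%N by lia.
have {}IH := IH kN'; set i0 := (N - k.+1)%N.
have i0N : (i0 < N)%N by rewrite /i0; lia.
pose i1 := Ordinal i0N; have Ek : (N - k)%N = i0.+1 by rewrite /i0; lia.
rewrite Ek in IH.
have -> : drop i0 (enum 'I_N) = i1 :: drop i0.+1 (enum 'I_N).
  rewrite (drop_nth i1) ?size_enum_ord //; congr (_ :: _).
  by apply: val_inj; rewrite /= nth_enum_ord.
set l := [seq s j | j <- drop i0.+1 (enum 'I_N)] in IH *.
set T := [set j : 'I_N | (i0 <= j)%N]%SET.
have TE : [set j : 'I_N | (i0.+1 <= j)%N]%SET = T :\ i1.
  apply/setP => j; rewrite !inE; apply/idP/andP.
    by move=> h; split; [apply/eqP => /(congr1 val) /=|]; lia.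
  by move=> [/eqP h ?]; rewrite ltn_neqAle; apply/andP; split=> //; apply/eqP => E; apply: h; exact: val_inj.
rewrite TE in IH.
under eq_bigr do rewrite map_cons (cupd_cobd _ (@cobd_cupd _)).
rewrite /cobd; under eq_bigr do rewrite mulr_sumr.
rewrite exchange_big /= -[RHS]IH (bigD1 i1) ?inE //= [X in _ + X]big1 ?addr0; last first.
  move=> a /andP[aT ai1].
  have ai : (i0 < a)%N.
    move: aT; rewrite inE leq_eqVlt => /orP[/eqP E|//].
    by case/eqP: ai1; apply: val_inj.
  have aE (p : {ffun 'I_N -> 'I_n.+1}) : \prod_(j < N) (if (j < i0)%N then p j == n :> nat else (p j < n)%N)%:R =
      \prod_j (if j == a then (p j < n)%N else (fun j x => if (j < i0)%N then x == n else (x < n)%N) j (p j))%:R :> K.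
    by apply: eq_bigr => j _; have [->|//] := eqVneq j a; rewrite ltnNge (ltnW ai).
  under eq_bigr do rewrite aE.
  rewrite (telescope_box a (fun j x => if (j < i0)%N then x == n else (x < n)%N)
    (cmul (s i1) (cupd l) (T :\ a))).
  apply: big1 => p _; rewrite /cmul.
  have al : List.In (s a) l.
    apply: In_map_enum; rewrite -(_ : nth a (drop i0.+1 (enum 'I_N)) (a - i0.+1) = a).
      by rewrite mem_nth // size_drop size_enum_ord; have := ltn_ord a; lia.
    by rewrite nth_drop subnKC //; apply: val_inj; rewrite /= nth_enum_ord.
  have [pa|pa] := eqVneq (p a : nat) n.
    rewrite (@cupd_const l (s a) a _ _ 1) ?mulr0 //; first by rewrite !inE eqxx.
    by move=> q; rewrite /posf pa; exact: s1.
  have [pa0|pa0] := eqVneq (p a : nat) 0%N.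
    rewrite (@cupd_const l (s a) a _ _ 0) ?mulr0 //; first by rewrite !inE eqxx.
    by move=> q; rewrite /posf pa0; exact: s0.
  by rewrite addr0 mulr0 mul0r.
have aE (p : {ffun 'I_N -> 'I_n.+1}) : \prod_(j < N) (if (j < i0)%N then p j == n :> nat else (p j < n)%N)%:R =
      \prod_j (if j == i1 then (p j < n)%N else (fun j x => if (j < i0)%N then x == n else (x < n)%N) j (p j))%:R :> K.
  by apply: eq_bigr => j _; have [->|//] := eqVneq j i1; rewrite /= ltnn.
under eq_bigr do rewrite aE.
rewrite (telescope_box i1 (fun j x => if (j < i0)%N then x == n else (x < n)%N)
    (cmul (s i1) (cupd l) (T :\ i1))).
apply: eq_bigr => p _; rewrite /cmul.
have [pa|pa] := eqVneq (p i1 : nat) n.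
  have -> : (p i1 == 0 :> nat) = false by rewrite pa; lia.
  rewrite s1 // mul1r addr0 mulr1; congr (_ * _).
  apply: eq_bigr => j _; have [->|/eqP ji] := eqVneq j i1; first by rewrite ltnS leqnn pa eqxx.
  have -> // : (j < i0.+1)%N = (j < i0)%N.
  rewrite ltnS leq_eqVlt (_ : (j == i0 :> nat) = false) //.
  by apply/eqP => E; apply: ji; exact: val_inj.
rewrite [in RHS](bigD1 i1) //= ltnS leqnn (negbTE pa) add0r !mul0r.
have [pa0|pa0] := eqVneq (p i1 : nat) 0%N; last by rewrite mulr0 mul0r.
by rewrite s0 // mul0r mulr0.
Qed.

(** By [box_parity] at [i = 0], the cup product of the sign labels is nonzero on some cube, on which
    every label changes. Each [G i] thus takes values of both signs within [w] of its value at the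
    lowest vertex, which is at most [w] in absolute value. *)
Lemma discrete_miranda (R : realDomainType) (G : 'I_N -> pos -> R) (w : R) :
  (forall i q, q i = 0%N -> G i q <= 0) -> (forall i q, q i = n -> 0 <= G i q) ->
  (forall p q, (forall j, p j <= q j <= (p j).+1)%N -> (forall j, q j <= n)%N ->
     forall i, `|G i q - G i p| <= w) ->
  exists p : pos, (forall j, p j <= n)%N /\ forall i, `|G i p| <= w.
Proof.
move=> G0 G1 Gw.
(* [G i] may vanish on the faces of the box, so the labels 0 and 1 are imposed there rather than
   read off its sign. *)
pose s i (q : pos) : K := ((q i != 0%N) && ((n <= q i)%N || (0 < G i q)))%:R.
have s0 i q : q i = 0%N -> s i q = 0 by rewrite /s => ->.
have s1 i q : q i = n -> s i q = 1.
  by rewrite /s => ->; rewrite leqnn /= andbT -lt0n n_gt0.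
have := box_parity s0 s1 (leq0n N); rewrite drop0.
set l := map _ _; set T := [set j | _]%SET => sum1.
have /existsP[p /andP[pn pl]] : [exists p : {ffun 'I_N -> 'I_n.+1},
    [forall j, (p j < n)%N] && (cupd l T (posf p) != 0)].
  apply: contraT => /existsPn h; move: sum1; rewrite big1 => [/eqP|p _].
    by rewrite eq_sym oner_eq0.
  move: (h p); rewrite negb_and => /orP[/forallPn[j pj]|].
    by rewrite (bigD1 j) //= (negbTE pj) !mul0r.
  by rewrite negbK => /eqP ->; rewrite mulr0.
exists (posf p); split=> [j|i]; first by rewrite /posf -ltnS.
have il : List.In (s i) l.
  by apply: In_map_enum; rewrite mem_enum.
have [q [q' [hq hq' ne]]] := cupd_neq0 pl il.
have pjn j : (posf p j < n)%N by move/forallP: pn; exact.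
have aux (r : pos) : (forall j, posf p j <= r j <= posf p j + (j \in T))%N ->
   `|G i r - G i (posf p)| <= w /\ forall j, (r j <= n)%N.
  move=> hr; have rn j : (r j <= n)%N.
    by move: (hr j) (pjn j); case: (j \in T); lia.
  by split=> //; apply: Gw => // j; have := hr j; case: (j \in T); lia.
have [hq1 qn] := aux _ hq; have [hq1' qn'] := aux _ hq'.
have key (r r' : pos) : `|G i r - G i (posf p)| <= w -> `|G i r' - G i (posf p)| <= w ->
    (forall j, (r j <= n)%N) -> (forall j, (r' j <= n)%N) -> s i r = 1 -> s i r' = 0 ->
    `|G i (posf p)| <= w.
  move=> h h' rn rn'; rewrite /s.
  case: (boolP (_ && _)) => // /andP[_ h1] _.
  case: (boolP (_ && _)) => //; rewrite negb_and negbK negb_or -ltnNge -leNgt => h2 _.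
  have g1 : 0 <= G i r.
    case/orP: h1 => [h1|/ltW //]; apply: G1; have := rn i; lia.
  have g2 : G i r' <= 0 by case/orP: h2 => [/eqP /G0 //|/andP[]].
  by move: h h'; rewrite !ler_norml; lra.
have s01 r : s i r = 0 \/ s i r = 1 by rewrite /s; case: (_ && _); [right|left].
case: (s01 q) (s01 q') ne => E1 [] E2; rewrite E1 E2 ?eqxx // => _.
  exact: (key q' q).
exact: (key q q').
Qed.
End CubicalMiranda.

(** * Norming functionals *)

Section HahnBanach.
Variables (R : realType) (X : normedModType R).

Definition sublinear (q : X -> R) :=
  [/\ forall x, q x <= `|x|, forall x y, q (x + y) <= q x + q y &
      forall (t : R) x, 0 <= t -> q (t *: x) = t * q x].

Lemma sublinear_ge q : sublinear q -> forall x, - `|x| <= q x.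
Proof.
move=> [q1 q2 q3] x; have q0 : q 0 = 0 by rewrite -(scale0r x) q3 // mul0r.
have := q2 x (- x); rewrite subrr q0; have := q1 (- x); rewrite normrN; lra.
Qed.

Lemma inf_le_elt (A : set R) (l x : R) : lbound A l -> A x -> inf A <= x.
Proof. by move=> Al Ax; apply: ge_inf => //; exists l. Qed.

Section Lower.
Variables (q : X -> R) (x : X).
Hypothesis qs : sublinear q.

(** The Hahn-Banach minorant of [q] at [x]: it is again sublinear, lies below [q], and its value at
    [- x] is at most [- q x]. A minimal [q] is therefore odd. *)
Definition qlow (y : X) : R := inf [set q (y + t *: x) - t * q x | t in [set t : R | 0 <= t]].

Lemma qlow_lb y : lbound [set q (y + t *: x) - t * q x | t in [set t : R | 0 <= t]] (- `|y|).
Proof.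
move=> _ [t /= t0 <-]; have [q1 q2 q3] := qs.
rewrite -q3 //; have := q2 (y + t *: x) (- y); rewrite addrAC subrr add0r.
by have := q1 (- y); rewrite normrN; lra.
Qed.

Lemma qlow_le y t : 0 <= t -> qlow y <= q (y + t *: x) - t * q x.
Proof. by move=> t0; apply: inf_le_elt (@qlow_lb y) _; exists t. Qed.

Lemma qlow_ge y l : (forall t, 0 <= t -> l <= q (y + t *: x) - t * q x) -> l <= qlow y.
Proof.
move=> h; apply: lb_le_inf; first by exists (q (y + 0 *: x) - 0 * q x), 0 => /=.
by move=> _ [t /= t0 <-]; exact: h.
Qed.

Lemma qlow_sublinear : sublinear qlow.
Proof.
have [q1 q2 q3] := qs; split.
- move=> y; apply: le_trans (qlow_le y (lexx 0)) _.
  by rewrite scale0r addr0 mul0r subr0.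
- move=> y z; rewrite -lerBlDr; apply: qlow_ge => t t0; rewrite lerBlDr -lerBlDl.
  apply: qlow_ge => s s0; rewrite lerBlDl.
  apply: le_trans (qlow_le _ (addr_ge0 s0 t0)) _.
  have := q2 (y + t *: x) (z + s *: x).
  rewrite (_ : y + t *: x + (z + s *: x) = y + z + (s + t) *: x); first lra.
  by rewrite scalerDl addrACA (addrC (t *: x)).
- move=> t y; rewrite le_eqVlt => /orP[/eqP <-|t0].
    rewrite mul0r scale0r; apply/eqP; rewrite eq_le; apply/andP; split.
      apply: le_trans (qlow_le 0 (lexx 0)) _.
      by rewrite scale0r addr0 mul0r subr0; have := q1 0; rewrite normr0.
    by apply: qlow_ge => s s0; rewrite add0r q3 // subrr.
  have tn0 : t != 0 by rewrite gt_eqF.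
  apply/eqP; rewrite eq_le; apply/andP; split.
    rewrite mulrC -ler_pdivrMr //; apply: qlow_ge => s s0.
    rewrite ler_pdivrMr // mulrC.
    apply: le_trans (qlow_le _ (mulr_ge0 (ltW t0) s0)) _.
    by rewrite -scalerA -scalerDr q3 ?(ltW t0) // mulrBr mulrA.
  apply: qlow_ge => s s0; rewrite mulrC -ler_pdivlMr //.
  apply: le_trans (qlow_le y (divr_ge0 s0 (ltW t0))) _.
  rewrite ler_pdivlMr // mulrBl (mulrC (q _)) -q3 ?(ltW t0) // scalerDr scalerA.
  by rewrite mulrCA divff // mulr1 (_ : s / t * q x * t = s * q x) //; field.
Qed.

Lemma qlow_le_q y : qlow y <= q y.
Proof. by apply: le_trans (qlow_le y (lexx 0)) _; rewrite scale0r addr0 mul0r subr0. Qed.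

Lemma qlowN : qlow (- x) <= - q x.
Proof.
apply: le_trans (qlow_le (- x) ler01) _.
have [_ _ q3] := qs; have q0 : q 0 = 0 by rewrite -(scale0r x) q3 // mul0r.
by rewrite scale1r addNr q0 mul1r sub0r.
Qed.

End Lower.

(* A minimal sublinear functional equals its own [qlow], hence is odd, hence linear. *)
Lemma norming_functional (x0 : X) : exists g : X -> R,
  [/\ forall (a : R) x y, g (a *: x + y) = a * g x + g y,
      forall x, `|g x| <= `|x| & g x0 = `|x0|].
Proof.
have ns : sublinear (fun x : X => `|x|).
  by split => // [x y|t x t0]; [exact: ler_normD|rewrite normrZ ger0_norm].
(* Zorn's lemma is started below [q0], which is at most [- |x0|] at [- x0]; every odd functional
   below it is norming at [x0]. *)
pose q0 := qlow (fun x : X => `|x|) x0.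
have q0s : sublinear q0 by exact: qlow_sublinear.
pose T := {q : X -> R | sublinear q /\ forall x, q x <= q0 x}.
(* The order is reversed: maximal elements are minimal functionals, and chains are bounded by their
   pointwise infimum. *)
pose Rl (a b : T) := `[< forall x, sval b x <= sval a x >].
have q0T : sublinear q0 /\ forall x, q0 x <= q0 x by split.
have [|a b c /asboolP ab /asboolP bc|A Atot|m mmax] :=
    @ZL_preorder T (exist _ q0 q0T) Rl.
- by move=> t; apply/asboolP.
- by apply/asboolP => x; exact: le_trans (bc x) (ab x).
- have [[a0 Aa0]|A0] := pselect (exists a, A a); last first.
    exists (exist _ q0 q0T) => s As; case: A0; by exists s.
  pose B x := [set sval a x | a in A].
  have Blb x : lbound (B x) (- `|x|).
    by move=> _ [a Aa <-]; case: a Aa => a [sa ?] _ /=; exact: sublinear_ge.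
  pose qi x := inf (B x).
  have qi_le x a : A a -> qi x <= sval a x.
    by move=> Aa; apply: inf_le_elt (@Blb x) _; exists a.
  have qi_ge x l : (forall a, A a -> l <= sval a x) -> l <= qi x.
    move=> h; apply: lb_le_inf; first by exists (sval a0 x), a0.
    by move=> _ [a Aa <-]; exact: h.
  have qis : sublinear qi /\ forall x, qi x <= q0 x.
    split; last by move=> x; apply: le_trans (qi_le x _ Aa0) _; case: (svalP a0).
    split.
    + move=> x; apply: le_trans (qi_le x _ Aa0) _.
      by case: (svalP a0) => -[].
    (* The infimum is subadditive because, of two members of the chain, the smaller one can serve
       for both arguments. *)
    + move=> x y; rewrite -lerBlDr; apply: (qi_ge) => a Aa; rewrite lerBlDr -lerBlDl.
      apply: (qi_ge) => b Ab; rewrite lerBlDl.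
      have [/asboolP ab|/asboolP ba] := Atot a b Aa Ab.
        apply: le_trans (qi_le _ _ Ab) _; case: (svalP b) => -[_ h _] _.
        apply: le_trans (h x y) _; rewrite lerD2r; exact: ab.
      apply: le_trans (qi_le _ _ Aa) _; case: (svalP a) => -[_ h _] _.
      apply: le_trans (h x y) _; rewrite lerD2l; exact: ba.
    + move=> t x; rewrite le_eqVlt => /orP[/eqP <-|t0].
        rewrite scale0r mul0r.
        have h0 (a : T) : sval a 0 = 0.
          by case: (svalP a) => -[_ _ h] _; rewrite -(scale0r x) h // mul0r.
        apply/eqP; rewrite eq_le; apply/andP; split.
          by rewrite -(h0 a0); exact: qi_le.
        by apply: (qi_ge) => a Aa; rewrite h0.
      have hZ (a : T) : sval a (t *: x) = t * sval a x.
        by case: (svalP a) => -[_ _ h] _; apply: h; exact: ltW.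
      apply/eqP; rewrite eq_le; apply/andP; split.
        rewrite mulrC -ler_pdivrMr //; apply: (qi_ge) => a Aa.
        by rewrite ler_pdivrMr // mulrC -hZ; exact: qi_le.
      apply: (qi_ge) => a Aa; rewrite hZ ler_pM2l //; exact: qi_le.
  by exists (exist _ qi qis) => s As; apply/asboolP => x /=; exact: qi_le.
case: m mmax => g [gs gq0] mmax; exists g.
have [g1 g2 g3] := gs.
have gN x : g (- x) = - g x.
  have ls : sublinear (qlow g x) /\ forall y, qlow g x y <= q0 y.
    split; first exact: qlow_sublinear.
    by move=> y; apply: le_trans (qlow_le_q x gs y) (gq0 y).
  have /mmax /asboolP /(_ (- x)) /= h : Rl (exist _ g (conj gs gq0)) (exist _ _ ls).
    by apply/asboolP => y /=; exact: qlow_le_q.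
  have h2 := qlowN x gs; have h3 := g2 x (- x).
  have g0 : g 0 = 0 by rewrite -(scale0r x) g3 // mul0r.
  by apply/eqP; rewrite eq_le; apply/andP; split; move: h3; rewrite subrr g0; lra.
have gD x y : g (x + y) = g x + g y.
  apply/eqP; rewrite eq_le g2 /=.
  by have := g2 (x + y) (- y); rewrite addrK gN; lra.
have gZ (a : R) x : g (a *: x) = a * g x.
  have [a0|a0] := leP 0 a; first exact: g3.
  by rewrite -[a]opprK scaleNr gN g3 ?oppr_ge0 ?ltW //; lra.
split.
- by move=> a x y; rewrite gD gZ.
- by move=> x; rewrite ler_norml g1 andbT -[g x]opprK -gN lerN2 -(normrN x).
- apply/eqP; rewrite eq_le g1 /=.
  have := gq0 (- x0); have := qlowN x0 ns; rewrite gN -/q0; lra.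
Qed.
End HahnBanach.

(** * The space c0 and the dual norm induced by a Lipschitz isomorphism *)

Lemma exists_nat_gt (R : realType) (x : R) : exists n : nat, x < n.+1%:R.
Proof. by exists (Num.truncn x); exact: truncnS_gt. Qed.

Section C0basics.
Variable R : realType.
Implicit Types (x y w : c0 R) (u : nat -> R).

Definition null u := forall e : R, 0 < e -> exists N, forall n, (N <= n)%N -> `|u n| <= e.

Lemma null_c0 u : null u -> u \in @c0_pred R.
Proof.
move=> nu; apply/asboolP/cvgrPdist_le => e e0; have [N hN] := nu e e0.
by exists N => //= n Nn; rewrite sub0r normrN; exact: hN.
Qed.

Lemma c0_null w : null w.
Proof.
move=> e e0; have /asboolP/cvgrPdist_le/(_ e e0) [N _ hN] := c0valP w.
by exists N => n Nn; have := hN n Nn; rewrite sub0r normrN.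
Qed.

(** A total constructor, which keeps proofs of nullity out of terms; 0 is a default value, and
    [c0ofE] recovers the coordinates from a separate proof. *)
Definition c0of u : c0 R :=
  if pselect (u \in @c0_pred R) is left h then C0 h else 0.

Lemma c0ofE u : null u -> c0of u =1 u.
Proof. by move=> nu n; rewrite /c0of; case: pselect => // -[]; exact: null_c0. Qed.

Lemma c0_ext x y : x =1 y -> x = y.
Proof. by move=> h; apply: val_inj; exact/funext. Qed.

Lemma c0DE x y n : (x + y) n = x n + y n. Proof. by []. Qed.
Lemma c0NE x n : (- x) n = - x n. Proof. by []. Qed.
Lemma c0BE x y n : (x - y) n = x n - y n. Proof. by []. Qed.
Lemma c0ZE a x n : (a *: x) n = a * x n. Proof. by []. Qed.
Lemma c00E n : (0 : c0 R) n = 0. Proof. by []. Qed.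
Definition c0E := (c0DE, c0NE, c0ZE, c00E).

Lemma c0_sumE I (r : seq I) (P : pred I) (F : I -> c0 R) n :
  (\sum_(i <- r | P i) F i) n = \sum_(i <- r | P i) F i n.
Proof. by apply: (big_morph (fun x : c0 R => x n)). Qed.

Lemma c0_coord w n : `|w n| <= `|w|. Proof. exact: c0_le_norm. Qed.
Lemma c0_normP w M : (forall n, `|w n| <= M) -> `|w| <= M. Proof. exact: c0_norm_le. Qed.

Lemma null_eventually0 u N : (forall n, (N <= n)%N -> u n = 0) -> null u.
Proof. by move=> h e e0; exists N => n /h ->; rewrite normr0 ltW. Qed.

Definition trunc N w : c0 R := c0of (fun n => if (n < N)%N then w n else 0).

Lemma truncE N w n : trunc N w n = if (n < N)%N then w n else 0.
Proof.
apply: c0ofE; apply: (@null_eventually0 _ N) => k; by rewrite leqNgt => /negbTE ->.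
Qed.

Lemma trunc_norm N w : `|trunc N w| <= `|w|.
Proof.
apply: c0_normP => n; rewrite truncE; case: ifP => _; first exact: c0_coord.
by rewrite normr0.
Qed.

Lemma trunc_cvg w (e : R) : 0 < e -> exists N, forall M, (N <= M)%N -> `|w - trunc M w| <= e.
Proof.
move=> e0; have [N hN] := c0_null w e0; exists N => M NM.
apply: c0_normP => n; rewrite c0BE truncE; case: ltnP => nM.
  by rewrite subrr normr0 ltW.
by rewrite subr0 hN // (leq_trans NM).
Qed.
End C0basics.
Arguments c0_coord {R}.

Section DualNorm.
Variables (R : realType) (X : normedModType R) (U : X -> c0 R) (V : c0 R -> X) (L : R).
Hypotheses (UK : cancel U V) (VK : cancel V U) (L0 : 0 < L)
  (UL : forall x y, `|U x - U y| <= L * `|x - y|)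
  (VL : forall x y, `|V x - V y| <= L * `|x - y|).

Definition dual : set (X -> R) := [set g |
  (forall (a : R) x y, g (a *: x + y) = a * g x + g y) /\
  exists M : R, forall x, `|g x| <= M * `|x|].

(** The pairs with [uv.1 = uv.2] contribute [0 / 0 = 0], which is harmless in a supremum of
    nonnegative quotients. *)
Definition lipn (g : X -> R) : R :=
  sup (range (fun uv : c0 R * c0 R => `|g (V uv.1) - g (V uv.2)| / `|uv.1 - uv.2|)).

Lemma dualD g x y : dual g -> g (x + y) = g x + g y.
Proof. by case=> gl _; have := gl 1 x y; rewrite scale1r mul1r. Qed.

Lemma dual0 g : dual g -> g 0 = 0.
Proof. by move=> dg; have := dualD 0 0 dg; rewrite addr0; lra. Qed.

Lemma dualZ g a x : dual g -> g (a *: x) = a * g x.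
Proof. by move=> dg; case: (dg) => gl _; rewrite -[a *: x]addr0 gl dual0 // addr0. Qed.

Lemma dualB g x y : dual g -> g (x - y) = g x - g y.
Proof. by move=> dg; rewrite dualD // -scaleN1r dualZ // mulN1r. Qed.

Lemma dual_add g h : dual g -> dual h -> dual (g + h).
Proof.
move=> [gl [M hM]] [hl [M' hM']]; split.
  by move=> a x y; rewrite !fctE gl hl; ring.
exists (M + M') => x; rewrite fctE mulrDl; apply: le_trans (ler_normD _ _) _.
exact: lerD.
Qed.

Lemma dual_opp g : dual g -> dual (- g).
Proof.
move=> [gl [M hM]]; split; first by move=> a x y; rewrite !fctE gl; ring.
by exists M => x; rewrite fctE normrN.
Qed.

Lemma dual_sub g h : dual g -> dual h -> dual (g - h).
Proof. by move=> dg dh; apply: dual_add => //; exact: dual_opp. Qed.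

Lemma dual_zero : dual 0.
Proof.
split; first by move=> a x y; rewrite /= mulr0 addr0.
by exists 0 => x; rewrite mul0r normr0.
Qed.

Lemma lipn_ubound g : dual g -> has_ubound
  (range (fun uv : c0 R * c0 R => `|g (V uv.1) - g (V uv.2)| / `|uv.1 - uv.2|)).
Proof.
move=> dg; case: (dg) => _ [M hM]; exists (`|M| * L) => _ [[u v] _ <-] /=.
have [->|uv] := eqVneq u v.
  by rewrite !subrr !normr0 mul0r mulr_ge0 // ltW.
rewrite ler_pdivrMr ?normr_gt0 ?subr_eq0 // -dualB //.
apply: le_trans (hM _) _; apply: le_trans (_ : `|M| * `|V u - V v| <= _).
  by rewrite ler_wpM2r // ler_norm.
by rewrite -mulrA ler_wpM2l.
Qed.

Lemma lipn_ge g u v : dual g -> `|g (V u) - g (V v)| <= lipn g * `|u - v|.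
Proof.
move=> dg; have [->|uv] := eqVneq u v; first by rewrite !subrr !normr0 mulr0.
rewrite -ler_pdivrMr ?normr_gt0 ?subr_eq0 //.
by apply: ub_le_sup; [exact: lipn_ubound|exists (u, v)].
Qed.

Lemma lipn_ge0 g : dual g -> 0 <= lipn g.
Proof.
move=> dg; apply: le_trans (_ : `|g (V 0) - g (V 0)| / `|0 - 0 : c0 R| <= _).
  by rewrite divr_ge0.
by apply: ub_le_sup; [exact: lipn_ubound|exists (0, 0)].
Qed.

Lemma lipn_le g M : 0 <= M -> (forall u v, `|g (V u) - g (V v)| <= M * `|u - v|) ->
  lipn g <= M.
Proof.
move=> M0 h; apply: ge_sup; first by exists (`|g (V 0) - g (V 0)| / `|0 - 0 : c0 R|), (0, 0).
move=> _ [[u v] _ <-] /=; have [->|uv] := eqVneq u v; first by rewrite !subrr !normr0 mul0r.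
by rewrite ler_pdivrMr ?normr_gt0 ?subr_eq0.
Qed.

Lemma lipn_near g (e : R) : dual g -> 0 < e -> exists u v : c0 R, u != v /\
  (lipn g - e) * `|u - v| <= g (V u) - g (V v).
Proof.
move=> dg e0; have : exists2 y, range (fun uv : c0 R * c0 R =>
   `|g (V uv.1) - g (V uv.2)| / `|uv.1 - uv.2|) y & lipn g - e < y.
  apply: sup_adherent => //; split; last exact: lipn_ubound.
  by exists (`|g (V 0) - g (V 0)| / `|0 - 0 : c0 R|), (0, 0).
case=> _ [[u v] _ <-] /=; have [->|uv] := eqVneq u v.
  rewrite !subrr !normr0 mul0r => h.
  (* The almost optimal pair is diagonal, so [lipn g < e] and the required bound is at most 0: any
     two distinct points will do, once ordered by [g o V]. *)
  pose e1 : c0 R := c0of (fun n => (n == 0%N)%:R).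
  have e1E : e1 0%N = 1.
    by rewrite /e1 c0ofE //; apply: (@null_eventually0 _ _ 1) => -[].
  have e10 : e1 != 0 by apply/eqP => E; move: e1E; rewrite E c00E; lra.
  have [hg|hg] := leP (g (V 0)) (g (V e1)).
    by exists e1, 0; split=> //; have := normr_ge0 (e1 - 0); nra.
  by exists 0, e1; split; [rewrite eq_sym|have := normr_ge0 (0 - e1); nra].
have n0 : 0 < `|u - v| by rewrite normr_gt0 subr_eq0.
rewrite ltr_pdivlMr // => h; have [hg|hg] := leP 0 (g (V u) - g (V v)).
  by exists u, v; split=> //; rewrite ger0_norm // in h; exact: ltW.
exists v, u; split; first by rewrite eq_sym.
by rewrite distrC; move: h; rewrite ltr0_norm //; lra.
Qed.

Lemma dual_le g x : dual g -> `|g x| <= lipn g * L * `|x|.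
Proof.
move=> dg; have := lipn_ge (U x) (U 0) dg; rewrite !UK dual0 // subr0.
move/le_trans; apply; rewrite -mulrA ler_wpM2l ?lipn_ge0 //.
by have := UL x 0; rewrite subr0.
Qed.

Lemma lipn_le_norm g M : dual g -> 0 <= M -> (forall x, `|g x| <= M * `|x|) ->
  lipn g <= M * L.
Proof.
move=> dg M0 h; apply: lipn_le => [|u v]; first by rewrite mulr_ge0 // ltW.
by rewrite -dualB // -mulrA; apply: le_trans (h _) _; rewrite ler_wpM2l.
Qed.

Lemma lipn_add g h : dual g -> dual h -> lipn (g + h) <= lipn g + lipn h.
Proof.
move=> dg dh; apply: lipn_le => [|u v]; first by rewrite addr_ge0 ?lipn_ge0.
rewrite !fctE opprD addrACA mulrDl; apply: le_trans (ler_normD _ _) _.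
by apply: lerD; exact: lipn_ge.
Qed.

Lemma lipn_opp g : dual g -> lipn (- g) = lipn g.
Proof.
have h f : dual f -> lipn (- f) <= lipn f.
  move=> df; apply: lipn_le => [|u v]; first exact: lipn_ge0.
  by rewrite !fctE -opprD normrN; exact: lipn_ge.
move=> dg; apply/eqP; rewrite eq_le h //=.
by have := h _ (dual_opp dg); rewrite opprK.
Qed.

Lemma lipn_sub g h : dual g -> dual h -> lipn (g - h) <= lipn g + lipn h.
Proof. by move=> dg dh; rewrite -(lipn_opp dh); apply: lipn_add => //; exact: dual_opp. Qed.

(** A product of two factors [1 / (2 L)]: one comes from the length [t] of the displacement in
    [gorelik], the other from a vector [e] of norm at most 1 with [h e >= lipn h / (2 L)]. *)
Definition cgor : R := (4 * L ^+ 2)^-1.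

Lemma cgor_gt0 : 0 < cgor.
Proof. by rewrite invr_gt0 mulr_gt0 // exprn_gt0. Qed.

(* Gorelik principle: moving [V (m + k)] by a vector [t *: e] while correcting the first [N]
   coordinates with a grid point [k] yields an approximate midpoint on which [h] is large. *)
Lemma gorelik g (b eps : R) : dual g -> 0 <= b -> 0 < eps ->
  exists (D : seq X) (d : R), 0 < d /\ forall h, dual h -> lipn h <= b ->
    (forall x, x \in D -> `|h x| <= d) -> lipn g + cgor * lipn h - eps <= lipn (g + h).
Proof.
move=> dg b0 eps0; set G0 := lipn g; have G00 : 0 <= G0 := lipn_ge0 dg.
have cg0 := cgor_gt0; have Ln0 : L != 0 by rewrite gt_eqF.
pose A0 := G0 + cgor * b; have A00 : 0 <= A0 by rewrite addr_ge0 // mulr_ge0 // ltW.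
(* [eta] is the relative slack in the midpoint property; [eta * A0 <= eps / 4] makes the factors
   [1 - eta] and [1 + eta] affordable at the end. *)
pose eta : R := Num.min 2^-1 (eps / (4 * (A0 + 1))).
have eta0 : 0 < eta by rewrite lt_min invr_gt0 ltr0n divr_gt0 //; lra.
have eta1 : eta <= 2^-1 by rewrite ge_min lexx.
have eta2 : eta * A0 <= eps / 4.
  have : eta <= eps / (4 * (A0 + 1)) by rewrite ge_min lexx orbT.
  rewrite ler_pdivlMr; last lra. by move=> ?; rewrite ler_pdivlMr //; nra.
have [u [v [uv guv]]] := lipn_near dg (divr_gt0 eps0 (ltr0n _ 8)).
pose m : c0 R := 2^-1 *: (u + v); pose w : c0 R := 2^-1 *: (u - v).
have Eu : u = m + w by apply: c0_ext => i; rewrite !c0E; lra.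
have Ev : v = m - w by apply: c0_ext => i; rewrite !c0E; lra.
pose rho := `|w|.
have uvE : `|u - v| = 2 * rho.
  by rewrite /rho normrZ ger0_norm ?invr_ge0 // mulrA divff ?mul1r // pnatr_eq0.
have rho0 : 0 < rho by have : 0 < `|u - v|; [rewrite normr_gt0 subr_eq0|rewrite uvE; lra].
have [N hN] := c0_null w (mulr_gt0 eta0 rho0).
(* With [r = L t], the grid point [kap k] and the error made by the displacement each have norm at
   most [r], and [2 r = (1 - eta) rho] is the room left for an approximate midpoint. *)
pose t := (1 - eta) * rho / (2 * L).
have t0 : 0 < t by rewrite divr_gt0 ?mulr_gt0 //; lra.
pose r := L * t; have r0 : 0 < r by rewrite mulr_gt0.
have rE : 2 * r = (1 - eta) * rho by rewrite /r /t; field.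
(* The mesh [2 r / n] is so fine that the [L ^+ 2]-Lipschitz dependence of [z] on the grid point
   varies by at most [eta * rho] within a cube. *)
have [n' hn'] := exists_nat_gt (L ^+ 2 * (2 * r) / (eta * rho)); pose n := n'.+1.
have n0 : (0 : R) < n%:R by rewrite ltr0n.
have nn0 : (n%:R : R) != 0 by rewrite gt_eqF.
have hn : L ^+ 2 * (2 * r / n%:R) <= eta * rho.
  rewrite mulrA ler_pdivrMr // mulrC (mulrC (eta * rho)) -ler_pdivrMr ?mulr_gt0 //.
  by rewrite (mulrC (2 * r)); exact: ltW hn'.
pose kap (k : 'I_N -> nat) : c0 R :=
  c0of (fun i => if insub i is Some i' then (k i')%:R * (2 * r / n%:R) - r else 0).
have kapE k i : kap k i = if insub i is Some i' then (k i')%:R * (2 * r / n%:R) - r else 0.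
  rewrite /kap c0ofE //; apply: (@null_eventually0 _ _ N) => j Nj.
  by rewrite insubN // -leqNgt.
have kapO k (i : 'I_N) : kap k i = (k i)%:R * (2 * r / n%:R) - r.
  by rewrite kapE valK.
(* The test vectors do not depend on [h]: whichever grid point the topological argument selects for
   [h], its image is among them. *)
exists (V v :: [seq V (m + kap (posf p)) | p <- enum {ffun 'I_N -> 'I_n.+1}]), (eps / 8 * rho).
split; first by rewrite mulr_gt0 // divr_gt0.
move=> h dh hb hD; set H := lipn h; have H0 : 0 <= H := lipn_ge0 dh.
have [e [e1 he]] : exists e : X, `|e| <= 1 /\ H / (2 * L) <= h e.
  have [H00|H1] := leP H 0.
    exists 0; rewrite normr0 ler01 dual0 //; split=> //.
    by rewrite ler_pdivrMr ?mul0r // mulr_gt0.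
  have H2 : 0 < H / 2 by lra.
  have [a [a' [aa ha]]] := lipn_near dh H2.
  have na : 0 < `|a - a'| by rewrite normr_gt0 subr_eq0.
  have nL : 0 < L * `|a - a'| by rewrite mulr_gt0.
  have nan0 : `|a - a'| != 0 by rewrite gt_eqF.
  exists ((L * `|a - a'|)^-1 *: (V a - V a')); split.
    rewrite normrZ gtr0_norm ?invr_gt0 // mulrC ler_pdivrMr // mul1r; exact: VL.
  rewrite dualZ // dualB // ler_pdivlMl //; apply: le_trans ha.
  rewrite -/H le_eqVlt; apply/orP; left; apply/eqP; field.
  by rewrite Ln0.
pose z k := U (V (m + kap k) + t *: e) - m.
have zk k : `|z k - kap k| <= r.
  have -> : z k - kap k = U (V (m + kap k) + t *: e) - U (V (m + kap k)).
    by rewrite VK /z opprD addrA.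
  apply: le_trans (UL _ _) _; rewrite addrAC subrr add0r normrZ gtr0_norm //.
  by rewrite /r ler_wpM2l ?(ltW L0) // ler_piMr ?(ltW t0).
have zki k i : `|z k i - kap k i| <= r.
  by apply: le_trans (zk k); rewrite -c0BE; exact: c0_coord.
(* Coordinate [i] of [z] differs by at most [r] from that of [kap], which is [- r] and [r] on
   opposite faces: these are the sign conditions. *)
have [|i q q0|i q qn|p q pq qn i|k [kn kz]] := @discrete_miranda N n _ R (fun i k => z k i) (eta * rho).
- by [].
- have := zki q i; rewrite kapO q0 mul0r sub0r ler_norml; lra.
- have := zki q i; rewrite kapO qn (_ : n%:R * (2 * r / n%:R) - r = r); last by field.
  rewrite ler_norml; lra.
- rewrite -c0BE; apply: le_trans (c0_coord _ _) _.
  rewrite /z opprB addrA subrK; apply: le_trans (UL _ _) _.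
  rewrite opprD addrACA subrr addr0.
  apply: le_trans (ler_wpM2l (ltW L0) (VL _ _)) _.
  rewrite opprD addrACA subrr add0r mulrA -expr2; apply: le_trans hn.
  rewrite ler_wpM2l ?exprn_ge0 ?(ltW L0) //; apply: c0_normP => j; rewrite c0BE !kapE.
  have rn : 0 <= 2 * r / n%:R by rewrite divr_ge0 // mulr_ge0 // ltW.
  case: insubP => [j' _ _|_]; last by rewrite subrr normr0.
  rewrite opprB addrA subrK -mulrBl normrM (ger0_norm rn) ler_piMl //.
  have /andP[pq1 pq2] := pq j'.
  by rewrite -natrB // ger0_norm ?ler0n // (ler_nat _ _ 1) leq_subLR addn1.
have kapr : `|kap k| <= r.
  apply: c0_normP => j; rewrite kapE; case: insubP => [j' _ _|_]; last by rewrite normr0 ltW.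
  have h1 : 0 <= (k j')%:R * (2 * r / n%:R) by rewrite mulr_ge0 // divr_ge0 //; lra.
  have h2 : (k j')%:R * (2 * r / n%:R) <= 2 * r.
    rewrite mulrA ler_pdivrMr // mulrC ler_wpM2l ?ler_nat //; lra.
  by rewrite ler_norml; lra.
set zz := z k in kz.
have zzn : `|zz| <= (1 - eta) * rho.
  rewrite -rE; have := ler_normD (zz - kap k) (kap k); rewrite subrK; have := zk k; rewrite -/zz; lra.
(* The geometry of [c0]: [zz] is tiny on the first [N] coordinates and [w] on the others, so
   [m + zz] is almost as close to [u] and [v] as the midpoint [m]. *)
have znear (s : R) : `|s| = 1 -> `|s *: w + zz| <= (1 + eta) * rho.
  move=> s1; apply: c0_normP => i; rewrite c0DE c0ZE; apply: le_trans (ler_normD _ _) _.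
  rewrite normrM s1 mul1r; have [iN|Ni] := ltnP i N.
    have := kz (Ordinal iN) => /= hz; have := c0_coord w i; rewrite -/rho; lra.
  have := mulr_gt0 eta0 rho0; have := hN i Ni; have := le_trans (c0_coord zz i) zzn; lra.
have kE : V (m + zz) = V (m + kap k) + t *: e.
  by rewrite /zz /z addrC subrK UK.
have hk : `|h (V (m + kap k))| <= eps / 8 * rho.
  apply: hD; rewrite inE; apply/orP; right; apply/mapP.
  exists [ffun j => inord (k j)]; first by rewrite mem_enum.
  by congr (V (m + kap _)); apply/funext => j; rewrite /posf ffunE inordK // ltnS.
have hv : `|h (V v)| <= eps / 8 * rho by apply: hD; rewrite inE eqxx.
have hz : h (V (m + zz)) = h (V (m + kap k)) + t * h e.
  by rewrite kE dualD // dualZ.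
have g1 := lipn_ge u (m + zz) dg.
have g2 := lipn_ge (m + zz) v (dual_add dg dh).
have d1 : `|u - (m + zz)| <= (1 + eta) * rho.
  have := znear (-1) (normrN1 _); rewrite {1}Eu opprD addrACA subrr add0r scaleN1r.
  by rewrite -normrN opprD opprK.
have d2 : `|m + zz - v| <= (1 + eta) * rho.
  have := znear 1 (normr1 _); rewrite scale1r; rewrite (_ : m + zz - v = w + zz) //.
  by rewrite {1}Ev opprB addrC addrA subrK.
set P := lipn (g + h) in g2 *; have P0 : 0 <= P by exact: lipn_ge0 (dual_add dg dh).
(* The path from [u] to [v] through [m + zz] is tested with [g] on its first half and [g + h] on the
   second; the excess is [h] at [V (m + zz)], essentially [t * h e]. *)
have g1' : g (V u) - g (V (m + zz)) <= G0 * ((1 + eta) * rho).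
  by apply: le_trans (ler_norm _) _; apply: le_trans g1 _; rewrite ler_wpM2l.
have g2' : g (V (m + zz)) + h (V (m + zz)) - (g (V v) + h (V v)) <= P * ((1 + eta) * rho).
  by apply: le_trans (ler_norm _) _; apply: le_trans g2 _; rewrite ler_wpM2l.
have he' : (1 - eta) * rho * (cgor * H) <= t * h e.
  apply: le_trans (ler_wpM2l (ltW t0) he).
  rewrite le_eqVlt; apply/orP; left; apply/eqP; rewrite /t /cgor; field; lra.
move: guv; rewrite uvE -/G0 => guv.
have hk' := ler_normlW hk; have hk2 : - h (V (m + kap k)) <= eps / 8 * rho.
  by apply: le_trans hk; rewrite -normrN ler_norm.
have hv' := le_trans (ler_norm _) hv.
have cH : cgor * H <= cgor * b by rewrite ler_wpM2l // ltW.
set A := G0 + cgor * H; have AA : A <= A0 by rewrite lerD2l.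
have A1 : 0 <= A by rewrite addr_ge0 // mulr_ge0 // ltW.
have key : ((1 - eta) * A - eps / 2) * rho <= P * (1 + eta) * rho.
  rewrite hz in g2'; rewrite /A; lra.
have key2 : (1 - eta) * A - eps / 2 <= P * (1 + eta) by rewrite ler_pM2r in key.
have eA : eta * A <= eps / 4 by apply: le_trans eta2; rewrite ler_wpM2l // ltW.
rewrite leNgt; apply/negP => hlt.
have : P * (1 + eta) <= (A - eps) * (1 + eta) by rewrite ler_wpM2r //; lra.
have := mulr_gt0 eps0 eta0; lra.
Qed.

End DualNorm.

(** * Weak-* compactness *)

Section PointwiseCluster.
Import ArrowAsProduct.

(** Tychonoff's theorem, stated on finite sets of indices. Applied to the tails of a sequence it
    takes the place of a diagonal extraction. *)
Lemma pointwise_cluster (R : realType) (I : eqType) (M : I -> R)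
    (F : set_system (I -> R)) : ProperFilter F ->
  F [set f | forall i, `|f i| <= M i] ->
  exists t : I -> R, forall S, F S -> forall (s : seq I) (e : R), 0 < e ->
    exists2 f, S f & forall i, i \in s -> `|f i - t i| <= e.
Proof.
move=> FF FM; pose A (i : I) : set R := `[- M i, M i]%classic.
have : compact [set f : I -> R | forall i, A i (f i)].
  by apply: (@tychonoff I (fun=> R)) => i; exact: segment_compact.
move=> /(_ F FF) [|t [_ clt]].
  by apply: filterS FM => f fM i; rewrite /A /= in_itv /= -ler_norml.
exists t => S FS s e e0.
have nb : nbhs t [set f : I -> R | forall i, i \in s -> `|f i - t i| <= e].
  elim: s => [|i s IH]; first by apply: filterE.
  have ni : nbhs t [set f : I -> R | `|f i - t i| <= e].
    have /(_ t) := @proj_continuous I (fun=> R) i; move/cvgrPdist_le => /(_ e e0).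
    by apply: filterS => f /=; rewrite distrC.
  apply: filterS2 ni IH => f fi fs j; rewrite inE => /orP[/eqP -> //|]; exact: fs.
by have [f [Sf hf]] := clt _ _ FS nb; exists f.
Qed.

End PointwiseCluster.

Lemma dependent_choice_history (T : Type) (P : seq T -> T -> Prop) :
  (forall s, exists t, P s t) -> exists f : nat -> T, forall n, P (mkseq f n) (f n).
Proof.
move=> /choice [c hc]; pose h := fix h n := if n is k.+1 then rcons (h k) (c (h k)) else [::].
exists (fun n => c (h n)) => n; rewrite (_ : mkseq _ n = h n) //.
by elim: n => //= n IH; rewrite mkseqS IH.
Qed.

Lemma exists_half_lt (R : realType) (e : R) : 0 < e -> exists j, forall k, (j <= k)%N -> 2^-1 ^+ k <= e.
Proof.
move=> e0; have [n hn] := exists_nat_gt e^-1; exists n.+1 => k nk.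
have hk : n.+1%:R <= 2 ^+ k :> R.
  by rewrite -natrX ler_nat (leq_trans _ (ltnW (ltn_expl k (ltnSn 1)))).
rewrite exprVn -[e]invrK lef_pV2 ?posrE ?exprn_gt0 ?invr_gt0 //.
by apply: le_trans hk; exact: ltW.
Qed.

Lemma approx_rat_nat (R : realType) (w : c0 R) (e : R) : 0 < e -> exists s : seq rat,
  forall i, `|w i - ratr (nth 0 s i)| <= e.
Proof.
move=> e0; have [N hN] := c0_null w e0.
have q i : exists q : rat, `|w i - ratr q| <= e.
  have lt : w i - e < w i + e by lra.
  have [q] := rat_in_itvoo lt.
  rewrite in_itv /= => /andP[h1 h2]; exists q; rewrite ler_norml; lra.
have {q} [q hq] := choice q; exists (mkseq q N) => i.
have [iN|Ni] := ltnP i N; first by rewrite nth_mkseq.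
by rewrite nth_default ?size_mkseq // rmorph0 subr0 hN.
Qed.

Section WeakStar.
Variables (R : realType) (X : normedModType R) (U : X -> c0 R) (V : c0 R -> X) (L : R).
Hypotheses (UK : cancel U V) (VK : cancel V U) (L0 : 0 < L)
  (UL : forall x y, `|U x - U y| <= L * `|x - y|)
  (VL : forall x y, `|V x - V y| <= L * `|x - y|).
Notation lipn := (lipn V).
Notation dual := (@dual R X).

Lemma separable_of_lipschitz : exists d : nat -> X,
  forall x (e : R), 0 < e -> exists i, `|x - d i| <= e.
Proof.
exists (fun n => V (c0of (fun i => ratr (nth 0 (odflt [::] (unpickle n) : seq rat) i)))).
move=> x e e0; have [s hs] := approx_rat_nat (U x) (divr_gt0 e0 L0).
exists (pickle s); rewrite pickleK /= -{1}(UK x); apply: le_trans (VL _ _) _.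
rewrite -ler_pdivlMl // mulrC; apply: c0_normP => i; rewrite c0BE c0ofE //.
apply: (@null_eventually0 _ _ (size s)) => k sk.
by rewrite nth_default // rmorph0.
Qed.

Variable d : nat -> X.
Hypothesis d_dense : forall x (e : R), 0 < e -> exists i, `|x - d i| <= e.

(** On sets bounded for [lipn] these form a countable base of weak-* neighbourhoods of 0, by
    [wnbhd_finite]. One index governs both the number of test vectors and the precision; a
    difference costs one level. *)
Definition wnbhd (j : nat) (h : X -> R) := forall i, (i < j)%N -> `|h (d i)| <= 2^-1 ^+ j.

Lemma half_le (j k : nat) : (j <= k)%N -> 2^-1 ^+ k <= 2^-1 ^+ j :> R.
Proof. by move=> jk; apply: ler_wiXn2l => //; lra. Qed.

Lemma wnbhd_le j k h : (j <= k)%N -> wnbhd k h -> wnbhd j h.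
Proof.
by move=> jk Wk i ij; apply: le_trans (Wk i (leq_trans ij jk)) _; exact: half_le.
Qed.

Lemma wnbhd_sub j f g : wnbhd j.+1 f -> wnbhd j.+1 g -> wnbhd j (f - g).
Proof.
move=> Wf Wg i ij; rewrite fctE; apply: le_trans (ler_normB _ _) _.
have := Wf i (ltnW ij); have := Wg i (ltnW ij); rewrite !exprS; lra.
Qed.

Lemma wnbhd_opp j f : wnbhd j f -> wnbhd j (- f).
Proof. by move=> Wf i ij; rewrite fctE normrN; exact: Wf. Qed.

Lemma wnbhd_finite (D : seq X) (b del : R) : 0 <= b -> 0 < del ->
  exists j, forall k h, (j <= k)%N -> dual h -> lipn h <= b -> wnbhd k h ->
    forall x, x \in D -> `|h x| <= del.
Proof.
move=> b0 del0; elim: D => [|x D [j hj]]; first by exists 0%N.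
have bL : 0 < b * L + 1 by rewrite ltr_wpDl // mulr_ge0 // ltW.
have [i hi] := d_dense x (divr_gt0 (divr_gt0 del0 (ltr0n _ 2)) bL).
have [j2 hj2] := exists_half_lt (divr_gt0 del0 (ltr0n R 2)).
exists (maxn j (maxn i.+1 j2)) => k h; rewrite !geq_max => /and3P[k1 k2 k3] dh hb Wk y.
rewrite inE => /orP[/eqP ->|yD]; last exact: (hj k).
rewrite -(subrK (d i) x) dualD //; apply: le_trans (ler_normD _ _) _.
have h1 := le_trans (Wk i k2) (hj2 k k3).
have h2 : `|h (x - d i)| <= del / 2.
  apply: le_trans (dual_le UK L0 UL VL _ dh) _.
  apply: le_trans (_ : (b * L + 1) * `|x - d i| <= _).
    by apply: ler_wpM2r => //; rewrite ler_wpDr // ler_wpM2r // ltW.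
  by rewrite mulrC -ler_pdivlMr.
lra.
Qed.

Lemma gorelik_wnbhd g (b eps : R) : dual g -> 0 <= b -> 0 < eps ->
  exists j, forall h, dual h -> lipn h <= b -> wnbhd j h ->
    lipn g + cgor L * lipn h - eps <= lipn (g + h).
Proof.
move=> dg b0 e0; have [D [del [del0 hD]]] := gorelik UK VK L0 UL VL dg b0 e0.
have [j hj] := wnbhd_finite D b0 del0.
by exists j => h dh hb Wh; apply: hD => // x xD; apply: (hj j).
Qed.

(** Compactness of the ball for a cover in which the size of a neighbourhood depends on its centre;
    this matters because the neighbourhood given by the Gorelik principle depends on [g]. *)
Lemma ball_compact (J : (X -> R) -> nat) : exists G : seq (X -> R),
  (forall g, List.In g G -> dual g /\ lipn g <= 1) /\
  forall x, dual x -> lipn x <= 1 -> exists2 g, List.In g G & wnbhd (J g) (x - g).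
Proof.
pose B : set (X -> R) := [set g | dual g /\ lipn g <= 1].
pose BG (G : seq (X -> R)) : set (X -> R) :=
  [set f | B f /\ forall g, List.In g G -> ~ wnbhd (J g) (f - g)].
apply: contrapT => noG.
have BG0 G : (forall g, List.In g G -> B g) -> BG G !=set0.
  move=> GB; apply: contrapT => h; apply: noG; exists G; split=> // x dx x1.
  apply: contrapT => h2; apply: h; exists x; split=> // g gG Wg; apply: h2; by exists g.
(* Without a finite cover, the points avoiding finitely many neighbourhoods generate a proper
   filter. Its cluster point [t] is in the ball, and the neighbourhood of [t] is both avoided and
   approached. *)
pose F : set_system (X -> R) :=
  [set S | exists2 G, (forall g, List.In g G -> B g) & BG G `<=` S].
have FF : ProperFilter F.
  apply: Build_ProperFilter; first by move=> [G GB GS]; have [f /GS] := BG0 G GB.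
  split; first by exists [::].
    move=> P Q [G GB GP] [G' GB' GQ]; exists (G ++ G').
      by move=> g /List.in_app_iff[/GB|/GB'].
    move=> f [Bf fG]; split; [apply: GP|apply: GQ]; split=> // g gG; apply: fG;
      apply/List.in_app_iff; by [left|right].
  by move=> P Q PQ [G GB GP]; exists G => //; exact: subset_trans PQ.
have FB : F B by exists [::] => // f [].
have [|t ht] := @pointwise_cluster R X (fun x => L * `|x|) F FF.
  apply: filterS FB => f [df f1] x; apply: le_trans (dual_le UK L0 UL VL x df) _.
  by rewrite -mulrA ler_piMl // mulr_ge0 // ltW.
have tlin (a : R) x y : t (a *: x + y) = a * t x + t y.
  apply/eqP; rewrite -subr_eq0 -normr_le0; apply/ler_addgt0Pr => e e0; rewrite add0r.
  pose k := `|a| + 2; have k0 : 0 < k by rewrite ltr_wpDl.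
  have [f [[fl _] _] hf] := ht _ FB [:: a *: x + y; x; y] _ (divr_gt0 e0 k0).
  have h1 := hf (a *: x + y); have h2 := hf x; have h3 := hf y.
  rewrite !inE eqxx /= in h1; rewrite !inE eqxx orbT /= in h2.
  rewrite !inE eqxx !orbT /= in h3.
  have -> : t (a *: x + y) - (a * t x + t y) =
     - (f (a *: x + y) - t (a *: x + y)) + a * (f x - t x) + (f y - t y).
    by rewrite fl; ring.
  apply: le_trans (ler_normD _ _) _; apply: le_trans (lerD (ler_normD _ _) (lexx _)) _.
  rewrite normrN normrM.
  have ha : `|a| * `|f x - t x| <= `|a| * (e / k) by rewrite ler_wpM2l // h2.
  have -> : e = e / k + `|a| * (e / k) + e / k.
    have -> : e / k + `|a| * (e / k) + e / k = k * (e / k) by rewrite /k; ring.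
    by rewrite mulrC divfK // gt_eqF.
  by rewrite !lerD ?h1 ?h3.
have tV u v : `|t (V u) - t (V v)| <= `|u - v|.
  apply/ler_addgt0Pr => e e0.
  have [f [df f1] hf] := ht _ FB [:: V u; V v] _ (divr_gt0 e0 (ltr0n _ 2)).
  have h1 := hf (V u); have h2 := hf (V v).
  rewrite !inE eqxx /= in h1; rewrite !inE eqxx orbT /= in h2.
  have h3 := lipn_ge L0 VL u v df.
  have h4 : lipn f * `|u - v| <= `|u - v| by rewrite ler_piMl.
  have := ler_normD (- (f (V u) - t (V u))) ((f (V u) - f (V v)) + (f (V v) - t (V v))).
  have := ler_normD (f (V u) - f (V v)) (f (V v) - t (V v)).
  rewrite normrN (_ : - (f (V u) - t (V u)) + (f (V u) - f (V v) + (f (V v) - t (V v))) =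
     t (V u) - t (V v)); last by ring.
  have := h1 isT; have := h2 isT; lra.
have dt : dual t.
  split=> //; exists L => x.
  have t0 : t 0 = 0 by have := tlin 1 0 0; rewrite scaler0 addr0 mul1r; lra.
  have h := tV (U x) (U 0); rewrite !UK t0 subr0 in h; apply: le_trans h _.
  by have := UL x 0; rewrite subr0.
have Bt : B t by split=> //; apply: lipn_le => // u v; rewrite mul1r.
have Ft : F (BG [:: t]) by exists [:: t] => // g [<-|//].
have eJ : 0 < 2^-1 ^+ J t :> R by rewrite exprn_gt0 // invr_gt0.
have [f [Bf fn] hf] := ht _ Ft (mkseq d (J t)) _ eJ.
apply: (fn t); first by left.
move=> i ij; rewrite fctE; apply: hf; apply/mapP; exists i => //; by rewrite mem_iota.
Qed.

(** [Phi n] consists of the centres of a finite cover and [phi n] is a centre whose neighbourhood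
    contains [x]. The Gorelik principle at [phi n] then bounds the size of the next difference by
    the growth of the norm, and these bounds telescope. *)
Lemma weakstar_skeleton : exists (Phi : nat -> seq (X -> R)),
  (forall n f, List.In f (Phi n) -> dual f /\ lipn f <= 1) /\
  forall x, dual x -> lipn x <= 1 -> exists phi : nat -> X -> R,
    [/\ forall n, List.In (phi n) (Phi n),
        forall n, wnbhd n.*2 (phi n.+1 - phi n),
        forall n, cgor L * lipn (phi n.+1 - phi n) <= lipn (phi n.+1) - lipn (phi n) + 2^-1 ^+ n &
        forall e : R, 0 < e -> exists n, lipn (x - phi n) <= e].
Proof.
have half_gt0 n : 0 < 2^-1 ^+ n :> R by rewrite exprn_gt0 // invr_gt0.
have cg0 : 0 < cgor L by exact: cgor_gt0.
have jex n : exists j : (X -> R) -> nat, forall g, dual g -> forall h, dual h -> lipn h <= 2 ->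
    wnbhd (j g) h -> lipn g + cgor L * lipn h - 2^-1 ^+ n <= lipn (g + h).
  suff /choice[c hc] : forall g, exists j, dual g -> forall h, dual h -> lipn h <= 2 ->
    wnbhd j h -> lipn g + cgor L * lipn h - 2^-1 ^+ n <= lipn (g + h).
    by exists c.
  move=> g.
  have [dg|ndg] := pselect (dual g); last by exists 0%N.
  have [j hj] := gorelik_wnbhd dg (ler0n _ 2) (half_gt0 n).
  by exists j => _; exact: hj.
have [j hj] := choice jex.
pose T := (seq (X -> R) * ((X -> R) -> nat))%type.
pose l0 : T := ([::], fun=> 0%N).
(* A stage is a list of centres with the level of each neighbourhood. Levels exceed those of all
   preceding centres, so [x - phi n.+1] is also in the neighbourhood attached to [phi n]; the extra
   successors pay for the level lost in [wnbhd_sub]. *)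
pose P (s : seq T) (t : T) := [/\ forall f, List.In f t.1 -> dual f /\ lipn f <= 1,
  forall x, dual x -> lipn x <= 1 -> exists2 g, List.In g t.1 & wnbhd (t.2 g) (x - g),
  forall g, (maxn (size s).*2.+2 (j (size s) g).+1 <= t.2 g)%N &
  forall g g', List.In g (last l0 s).1 ->
    ((last l0 s).2 g <= t.2 g')%N].
have [s|f hf] := @dependent_choice_history T P.
  rewrite /P; set l := last l0 s.
  pose m := foldr maxn 0%N (map l.2 l.1).
  pose J g := maxn m (maxn (size s).*2.+2 (j (size s) g).+1).
  have [G [GB GJ]] := ball_compact J; exists (G, J); split=> //=.
    by move=> g; exact: leq_maxr.
  move=> g g' gl; apply: leq_trans (leq_maxl _ _); rewrite /m.
  elim: (l.1) gl => //= a r IH [->|/IH h]; first exact: leq_maxl.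
  exact: leq_trans h (leq_maxr _ _).
exists (fun n => (f n).1); split.
  by move=> n g; have [+ _ _ _] := hf n; exact.
move=> x dx x1.
have [phi hphi] : exists phi : nat -> X -> R, forall n, List.In (phi n) (f n).1 /\
    wnbhd ((f n).2 (phi n)) (x - phi n).
  suff /choice[c hc] : forall n, exists p, List.In p (f n).1 /\ wnbhd ((f n).2 p) (x - p).
    by exists c.
  move=> n.
  have [_ h _ _] := hf n; have [g gG Wg] := h x dx x1; by exists g.
have dphi n : dual (phi n) /\ lipn (phi n) <= 1.
  by have [h _ _ _] := hf n; apply: h; case: (hphi n).
have Jn n : ((f n).2 (phi n) <= (f n.+1).2 (phi n.+1))%N.
  have [_ _ _] := hf n.+1; rewrite mkseqS last_rcons; apply; by case: (hphi n).
have Jge n : (n.*2.+2 <= (f n).2 (phi n))%N /\ (j n (phi n) < (f n).2 (phi n))%N.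
  by have [_ _ h _] := hf n; have := h (phi n); rewrite size_mkseq geq_max => /andP[].
have lip2 g h : dual g -> lipn g <= 1 -> dual h -> lipn h <= 1 -> lipn (g - h) <= 2.
  by move=> dg g1 dh h1; have := lipn_sub L0 VL dg dh; lra.
have Wd n : wnbhd ((f n).2 (phi n)).-1 (phi n.+1 - phi n).
  have -> : phi n.+1 - phi n = (x - phi n) - (x - phi n.+1).
    by rewrite opprB [RHS]addrC addrA subrK.
  case E : ((f n).2 (phi n)) => [|k]; first by have := Jge n; rewrite E; lia.
  apply: wnbhd_sub; first by rewrite -E; case: (hphi n).
  by apply: wnbhd_le (_ : (k.+1 <= (f n.+1).2 (phi n.+1))%N) _; [rewrite -E|case: (hphi n.+1)].
exists phi; split.
- by move=> n; case: (hphi n).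
- by move=> n; apply: wnbhd_le (Wd n); have := Jge n; lia.
- move=> n; have [d1 n1] := dphi n; have [d2 n2] := dphi n.+1.
  have := hj n _ d1 (phi n.+1 - phi n) (dual_sub d2 d1) (lip2 _ _ d2 n2 d1 n1).
  have jn : (j n (phi n) <= ((f n).2 (phi n)).-1)%N by have := Jge n; lia.
  move=> /(_ (wnbhd_le jn (Wd n))); rewrite [phi n + _]addrC subrK; lra.
(* The Gorelik principle is used both ways, at [x] and at [phi n]: the norms cancel in the sum, so
   the weak-* approximation is one in norm. *)
- move=> e e0; have ce : 0 < cgor L * e / 2 by rewrite divr_gt0 // mulr_gt0.
  have [j0 hj0] := gorelik_wnbhd dx (ler0n _ 2) ce.
  have [n0 hn0] := exists_half_lt ce.
  pose n := maxn j0 n0; exists n; have [d1 n1] := dphi n.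
  have Wx : wnbhd j0 (phi n - x).
    rewrite -opprB; apply: wnbhd_opp; apply: wnbhd_le (_ : (j0 <= (f n).2 (phi n))%N) _.
      by have := Jge n; have : (j0 <= n)%N := leq_maxl _ _; lia.
    by case: (hphi n).
  have := hj0 _ (dual_sub d1 dx) (lip2 _ _ d1 n1 dx x1) Wx.
  rewrite [x + _]addrC subrK => h1.
  have Wn : wnbhd (j n (phi n)) (x - phi n).
    by case: (hphi n) => _; apply: wnbhd_le; have := Jge n; lia.
  have := hj n _ d1 _ (dual_sub dx d1) (lip2 _ _ dx x1 d1 n1) Wn.
  rewrite [phi n + _]addrC subrK => h2.
  have h3 := hn0 n (leq_maxr _ _).
  have h4 : 0 <= cgor L * lipn (phi n - x).
    exact: mulr_ge0 (ltW cg0) (lipn_ge0 L0 VL (dual_sub d1 dx)).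
  rewrite -(ler_pM2l cg0); lra.
Qed.

End WeakStar.

(** * Linear embedding into c0 *)

Lemma nat_pairing : exists (pr : nat -> nat * nat) (pi : nat * nat -> nat),
  cancel pr pi /\ cancel pi pr.
Proof.
have /card_set_bijP[f] := card_nat2; rewrite setTT_bijective => -[g fK gK].
by exists g, f.
Qed.

Section NullRows.
Variables (R : realType) (pr : nat -> nat * nat) (pi : nat * nat -> nat).
Hypothesis prK : cancel pr pi.

(** This is the identification of [c0(c0)] with [c0] along an enumeration of pairs. *)
Lemma null_rows (u : nat -> nat -> R) :
  (forall e : R, 0 < e -> exists n0, forall n k, (n0 <= n)%N -> `|u n k| <= e) ->
  (forall n, null (u n)) -> null (fun i => u (pr i).1 (pr i).2).
Proof.
move=> uu un e e0; have [n0 hn0] := uu e e0.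
have [M hM] : exists M, forall n k, (n < n0)%N -> (M <= pi (n, k))%N -> `|u n k| <= e.
  elim: n0 {hn0} => [|m [M hM]]; first by exists 0%N.
  have [N hN] := un m e e0.
  have [M' hM'] : exists M', forall k, (k < N)%N -> (pi (m, k) < M')%N.
    elim: N {hN} => [|N [M' h]]; first by exists 0%N.
    exists (maxn M' (pi (m, N)).+1) => k; rewrite ltnS leq_eqVlt => /orP[/eqP ->|/h hk].
      exact: leq_maxr.
    exact: leq_trans hk (leq_maxl _ _).
  exists (maxn M M') => n k; rewrite ltnS leq_eqVlt geq_max => /orP[/eqP ->|nm] /andP[h1 h2].
    apply: hN; rewrite leqNgt; apply/negP => /hM'; lia.
  exact: hM.
exists M => i Mi; have [h|h] := leqP n0 (pr i).1; first exact: hn0.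
by apply: hM => //; rewrite -surjective_pairing prK.
Qed.

End NullRows.

Section Embedding.
Variables (R : realType) (X : normedModType R) (U : X -> c0 R) (V : c0 R -> X) (L : R).
Hypotheses (UK : cancel U V) (VK : cancel V U) (L0 : 0 < L)
  (UL : forall x y, `|U x - U y| <= L * `|x - y|)
  (VL : forall x y, `|V x - V y| <= L * `|x - y|).
Notation lipn := (lipn V).
Notation dual := (@dual R X).

Lemma linear_embedding_c0 : exists (J : X -> c0 R) (K : R), [/\ 0 < K,
  forall (a : R) x y, J (a *: x + y) = a *: J x + J y,
  forall x, `|J x| <= L * `|x| & forall x, `|x| <= K * `|J x|].
Proof.
have half_gt0 n : 0 < 2^-1 ^+ n :> R by rewrite exprn_gt0 // invr_gt0.
have cg0 : 0 < cgor L by exact: cgor_gt0.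
have [pr [pi [prK piK]]] := nat_pairing.
have [d d_dense] := separable_of_lipschitz UK L0 VL.
have [Phi [PhiB Phiex]] := weakstar_skeleton UK VK L0 UL VL d_dense.
pose Gam n := if n is m.+1 then
    List.filter (fun h => `[< wnbhd d m.*2 h >])
      (List.map (fun p => p.1 - p.2) (List.list_prod (Phi m.+1) (Phi m)))
  else Phi 0%N.
pose gam n k : X -> R := List.nth k (Gam n) 0.
have gam_or n k : List.In (gam n k) (Gam n) \/ gam n k = 0.
  by have [|] := List.nth_in_or_default k (Gam n) 0; [left|right].
have gam_dual n k : dual (gam n k).
  case: (gam_or n k) => [|->]; last exact: dual_zero.
  case: n => [|n] /=; first by move=> /PhiB[].
  move=> /List.filter_In[/List.in_map_iff[[f g] [<- /List.in_prod_iff[/PhiB[df _] /PhiB[dg _]]]] _].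
  exact: dual_sub.
have gam_w n k : wnbhd d n.*2 (gam n.+1 k).
  case: (gam_or n.+1 k) => [/List.filter_In[_ /asboolP //]|->].
  by move=> i _; rewrite /= normr0 ltW.
(* [gam n k] is small on [d 0], ..., [d (n.*2 - 3)] but may have an even smaller norm: capping the
   weight from below by [2^-n] keeps the normalised functionals weak-* null. *)
pose wt n k := Num.max (lipn (gam n k)) (2^-1 ^+ n).
have wt0 n k : 0 < wt n k by rewrite lt_max half_gt0 orbT.
pose u x n k := gam n k x / wt n k.
have u_le x n k : `|u x n k| <= L * `|x|.
  rewrite normrM normfV (gtr0_norm (wt0 _ _)) ler_pdivrMr //.
  apply: le_trans (dual_le UK L0 UL VL x (gam_dual n k)) _.
  rewrite -mulrA mulrC ler_wpM2l ?mulr_ge0 // ?(ltW L0) //.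
  by rewrite le_max lexx.
have uB x y n k : u (x - y) n k = u x n k - u y n k.
  by rewrite /u (dualB _ _ (gam_dual n k)) mulrBl.
have nullu x : null (fun i => u x (pr i).1 (pr i).2).
  apply: (null_rows prK) => [e e0|n]; last first.
    apply: (@null_eventually0 _ _ (length (Gam n))) => k /ssrnat.leP nk.
    by rewrite /u /gam List.nth_overflow // mul0r.
  have [i hi] := d_dense x (e / 2 / L) (divr_gt0 (divr_gt0 e0 (ltr0n _ 2)) L0).
  have e8 : 0 < e / 4 by lra.
  have [n0 hn0] := exists_half_lt e8.
  exists (maxn i.+2 n0.+1) => -[|n] k; rewrite geq_max => /andP[h1 h2] //.
  have -> : u x n.+1 k = u (x - d i) n.+1 k - u (- d i) n.+1 k by rewrite -uB opprK subrK.
  have h3 : `|u (x - d i) n.+1 k| <= e / 2.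
    by apply: le_trans (u_le _ _ _) _; rewrite -ler_pdivlMl // mulrC.
  have h4 : `|u (- d i) n.+1 k| <= e / 2.
    rewrite -sub0r uB /u (dual0 (gam_dual _ _)) mul0r sub0r normrN.
    rewrite normrM normfV (gtr0_norm (wt0 _ _)) ler_pdivrMr //.
    have i2 : (i < n.*2)%N by lia.
    apply: le_trans (gam_w n k i i2) _.
    apply: le_trans (_ : e / 2 * 2^-1 ^+ n.+1 <= _).
      rewrite -addnn exprD exprS mulrA ler_pM2r //.
      by have := hn0 n h2; lra.
    by rewrite ler_wpM2l ?le_max ?lexx ?orbT //; lra.
  by apply: le_trans (ler_normB _ _) _; lra.
pose J x := c0of (fun i => u x (pr i).1 (pr i).2).
have JE x i : J x i = u x (pr i).1 (pr i).2 by rewrite /J c0ofE.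
have uJ x n k : `|u x n k| <= `|J x|.
  by have := @c0_coord R (J x) (pi (n, k)); rewrite JE piK.
have gamJ x n f : List.In f (Gam n) -> `|f x| <= (lipn f + 2^-1 ^+ n) * `|J x|.
  move=> fG; have [k [_ fE]] := List.In_nth (Gam n) f 0 fG; have := uJ x n k.
  rewrite /u normrM normfV (gtr0_norm (wt0 _ _)) ler_pdivrMr // mulrC /wt.
  rewrite (_ : gam n k = f) // => /le_trans; apply; rewrite ler_wpM2r //.
  rewrite ge_max lerDl lerDr (ltW (half_gt0 _)) /=.
  by apply: (lipn_ge0 L0 VL); rewrite -fE; exact: gam_dual.
exists J, (2 * L * (3 + 3 / cgor L)); split.
- by rewrite mulr_gt0 ?mulr_gt0 // addr_gt0 // divr_gt0.
- move=> a x y; apply: c0_ext => i; rewrite c0DE c0ZE !JE /u.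
  by case: (gam_dual (pr i).1 (pr i).2) => -> _; rewrite mulrDl mulrA.
- by move=> x; apply: c0_normP => i; rewrite JE; exact: u_le.
move=> x.
have [g [glin gle gx]] := norming_functional x.
(* Division by [L] puts the norming functional in the unit ball for [lipn], where [Phiex]
   applies. *)
pose g' : X -> R := fun y => L^-1 * g y.
have g'le y : `|g' y| <= L^-1 * `|y|.
  by rewrite normrM gtr0_norm ?invr_gt0 // ler_wpM2l // invr_ge0 ltW.
have dg' : dual g'.
  by split; [move=> a y z; rewrite /g' glin; ring|exists L^-1].
have g'1 : lipn g' <= 1.
  have := lipn_le_norm L0 VL dg' (ltW (_ : 0 < L^-1)) g'le.
  by rewrite mulVf ?gt_eqF // invr_gt0; exact.
have [phi [phiP phiW phic phie]] := Phiex g' dg' g'1.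
have dphi n : dual (phi n) by case: (PhiB n _ (phiP n)).
have phi1 n : lipn (phi n) <= 1 by case: (PhiB n _ (phiP n)).
(* The quotient by [cgor L] collects the telescoping growth of [lipn (phi n)] and the errors [2^-k]
   of the Gorelik principle; the rest bounds the term [phi 0] and the caps [2^-k] of the weights. *)
have sum n : `|phi n x| <= (1 + (lipn (phi n) + 2 - 2 * 2^-1 ^+ n) / cgor L + (lipn (phi 0%N) + 1 - 2^-1 ^+ n)) * `|J x|.
  elim: n => [|n IH].
    apply: le_trans (gamJ x 0%N _ (phiP 0%N)) _; rewrite expr0 ler_wpM2r //.
    rewrite (_ : lipn (phi 0%N) + 2 - 2 * 1 = lipn (phi 0%N)); last ring.
    have : 0 <= lipn (phi 0%N) / cgor L.
      by rewrite divr_ge0 ?(ltW cg0) //; exact: (lipn_ge0 L0 VL).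
    lra.
  have E : phi n.+1 x = (phi n.+1 - phi n) x + phi n x by rewrite fctE subrK.
  rewrite {1}E; apply: le_trans (ler_normD _ _) _.
  have Gn : List.In (phi n.+1 - phi n) (Gam n.+1).
    apply/List.filter_In; split; last by apply/asboolP; exact: phiW.
    apply/List.in_map_iff; exists (phi n.+1, phi n); split=> //.
    by apply/List.in_prod_iff.
  have h1 := gamJ x n.+1 _ Gn.
  have h2 : lipn (phi n.+1 - phi n) <= (lipn (phi n.+1) - lipn (phi n) + 2^-1 ^+ n) / cgor L.
    by rewrite ler_pdivlMr // mulrC.
  have h3 : (lipn (phi n.+1 - phi n) + 2^-1 ^+ n.+1) * `|J x| <=
     ((lipn (phi n.+1) - lipn (phi n) + 2^-1 ^+ n) / cgor L + 2^-1 ^+ n.+1) * `|J x|.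
    by rewrite ler_wpM2r // lerD2r.
  apply: le_trans (lerD (le_trans h1 h3) IH) _.
  rewrite -mulrDl ler_wpM2r // le_eqVlt; apply/orP; left; apply/eqP.
  rewrite exprS; field; by rewrite gt_eqF.
(* With this error, [g' - phi n] is at most [|x| / (2 L)] at [x], half of [g' x = |x| / L], and can
   be absorbed. *)
have e0 : 0 < (2 * L ^+ 2)^-1 by rewrite invr_gt0 mulr_gt0 // exprn_gt0.
have [n hn] := phie _ e0.
have h1 : `|phi n x| <= (3 + 3 / cgor L) * `|J x|.
  apply: le_trans (sum n) _; rewrite ler_wpM2r //.
  have : (lipn (phi n) + 2 - 2 * 2^-1 ^+ n) / cgor L <= 3 / cgor L.
    have ic : 0 < (cgor L)^-1 by move: cg0; rewrite -invr_gt0.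
    by rewrite (ler_pM2r ic); move: (phi1 n) (half_gt0 n); lra.
  by move: (phi1 0%N) (half_gt0 n); lra.
have h2 : `|(g' - phi n) x| <= (2 * L)^-1 * `|x|.
  apply: le_trans (dual_le UK L0 UL VL x (dual_sub dg' (dphi n))) _.
  rewrite ler_wpM2r //; apply: le_trans (ler_wpM2r (ltW L0) hn) _.
  rewrite le_eqVlt; apply/orP; left; apply/eqP; field; by rewrite gt_eqF.
have h3 : L^-1 * `|x| <= (2 * L)^-1 * `|x| + (3 + 3 / cgor L) * `|J x|.
  have -> : L^-1 * `|x| = `|g' x| by rewrite /g' gx ger0_norm // mulr_ge0 // invr_ge0 ltW.
  have -> : g' x = (g' - phi n) x + phi n x by rewrite fctE subrK.
  by apply: le_trans (ler_normD _ _) _; exact: lerD.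
rewrite -mulrA -ler_pdivrMl ?mulr_gt0 //.
have E : L^-1 * `|x| = (2 * L)^-1 * `|x| + (2 * L)^-1 * `|x|.
  by field; rewrite gt_eqF.
by move: h3; rewrite {}E; lra.
Qed.

End Embedding.

(** * Linearization of Lipschitz maps *)

Section LipschitzExtension.
Variables (R : realType) (T : Type) (U : T -> c0 R) (Z : normedModType R) (J : T -> Z) (A : R) (t0 : T).
Hypotheses (A0 : 0 < A) (UJ : forall x y, `|U x - U y| <= A * `|J x - J y|).

(** McShane's formula for the coordinate [s * U n]. It is controlled only from above far out in [n],
    so positive parts are taken for [s = 1] and [s = - 1] and subtracted, hence the constant
    [4 * A]. *)
Let term (s : R) (n : nat) (z : Z) (x : T) : R := s * U x n - 2 * A * `|z - J x|.
Let ext s n z := sup (range (term s n z)).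

Let term_le s n z x y : `|s| = 1 ->
  term s n z x <= s * U y n + A * (`|z - J y| - `|z - J x|).
Proof.
move=> s1; rewrite /term.
have h1 : s * U x n - s * U y n <= A * `|J x - J y|.
  apply: le_trans (ler_norm _) _; rewrite -mulrBr normrM s1 mul1r.
  by apply: le_trans (UJ x y); rewrite -c0BE; exact: c0_coord.
have h2 : `|J x - J y| <= `|z - J x| + `|z - J y|.
  have := ler_normB (z - J y) (z - J x); rewrite opprB addrC addrA subrK; lra.
have := ler_wpM2l (ltW A0) h2; lra.
Qed.

Let term_ub s n z : `|s| = 1 -> has_ubound (range (term s n z)).
Proof.
move=> s1; exists (s * U t0 n + A * `|z - J t0|) => _ [x _ <-].
apply: le_trans (term_le n z x t0 s1) _; rewrite lerD2l ler_wpM2l ?(ltW A0) //.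
by rewrite gerBl.
Qed.

Let le_ext s n z x : `|s| = 1 -> term s n z x <= ext s n z.
Proof. by move=> s1; apply: ub_le_sup; [exact: term_ub|exists x]. Qed.

Let ext_le s n z M : (forall x, term s n z x <= M) -> ext s n z <= M.
Proof. by move=> h; apply: ge_sup; [exists (term s n z t0), t0|move=> _ [x _ <-]]. Qed.

Let ext_lip s n z z' : `|s| = 1 -> `|ext s n z - ext s n z'| <= 2 * A * `|z - z'|.
Proof.
move=> s1; have half a b : ext s n a <= ext s n b + 2 * A * `|a - b|.
  apply: ext_le => x; rewrite -lerBlDr; apply: le_trans (le_ext n b x s1); rewrite /term.
  have h : `|b - J x| <= `|a - b| + `|a - J x|.
    by have := ler_normB (a - J x) (a - b); rewrite opprB addrC addrA subrK; lra.
  have := ler_wpM2l (ltW A0) h; lra.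
by have := half z z'; have := half z' z; rewrite (distrC z' z) ler_norml; lra.
Qed.

Let ext_J s n x : `|s| = 1 -> ext s n (J x) = s * U x n.
Proof.
move=> s1; apply/eqP; rewrite eq_le; apply/andP; split.
  apply: ext_le => y; apply: le_trans (term_le n _ y x s1) _.
  by rewrite subrr normr0 sub0r mulrN gerBl mulr_ge0 // ltW.
by have := le_ext n (J x) x s1; rewrite /term subrr normr0 mulr0 subr0.
Qed.

Let pos s n z := Num.max 0 (ext s n z).

Let pos_null s z : `|s| = 1 -> null (fun n => pos s n z).
Proof.
move=> s1 e e0; have e2 : 0 < e / (2 * A) by rewrite divr_gt0 // mulr_gt0.
(* [x] almost realises the distance from [z] to the range: in [term_le] the difference of distances
   is then at most [e / (2 * A)], and only [U x n] remains. *)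
have [_ [x _ <-] hx] : exists2 y, range (fun x => `|z - J x|) y &
    y < inf (range (fun x => `|z - J x|)) + e / (2 * A).
  apply: inf_adherent => //; split; first by exists `|z - J t0|, t0.
  by exists 0 => _ [y _ <-].
have hy y : `|z - J x| <= `|z - J y| + e / (2 * A).
  apply: le_trans (ltW hx) _; rewrite lerD2r; apply: ge_inf; last by exists y.
  by exists 0 => _ [w _ <-].
have [N hN] := c0_null (U x) (divr_gt0 e0 (ltr0n _ 2)).
exists N => n Nn; have h1 := hN n Nn.
rewrite ger0_norm ?le_max ?lexx // ge_max (ltW e0) /=; apply: ext_le => y.
apply: le_trans (term_le n z y x s1) _.
have h2 : s * U x n <= e / 2.
  by apply: le_trans (ler_norm _) _; rewrite normrM s1 mul1r.
have h3 : A * (`|z - J x| - `|z - J y|) <= A * (e / (2 * A)).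
  by rewrite ler_wpM2l ?(ltW A0) //; have := hy y; lra.
have -> : e = e / 2 + A * (e / (2 * A)) by field; rewrite gt_eqF.
exact: lerD.
Qed.

Let pos_lip s n z z' : `|s| = 1 -> `|pos s n z - pos s n z'| <= 2 * A * `|z - z'|.
Proof.
move=> s1; apply: le_trans (ext_lip n z z' s1); rewrite /pos.
case: (leP 0 (ext s n z)) => h; case: (leP 0 (ext s n z')) => h'; rewrite ?subrr ?normr0 //.
  rewrite subr0 !ger0_norm //; lra.
by rewrite sub0r normrN distrC !ger0_norm //; lra.
Qed.

(* The slope [2 * A], twice the Lipschitz constant, makes the supremum essentially attained
   near the points of the range closest to [z], so that the extension stays in [c0]. *)
Lemma lipschitz_extension_c0 : exists W : Z -> c0 R,
  (forall x, W (J x) = U x) /\ forall z z', `|W z - W z'| <= 4 * A * `|z - z'|.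
Proof.
have n1 : `|1 : R| = 1 := normr1 _; have nN1 : `|- 1 : R| = 1 := normrN1 _.
have nW z : null (fun n => pos 1 n z - pos (-1) n z).
  move=> e e0; have [N hN] := pos_null z n1 (divr_gt0 e0 (ltr0n _ 2)).
  have [N' hN'] := pos_null z nN1 (divr_gt0 e0 (ltr0n _ 2)).
  exists (maxn N N') => n; rewrite geq_max => /andP[h1 h2].
  by apply: le_trans (ler_normB _ _) _; have := hN n h1; have := hN' n h2; lra.
exists (fun z => c0of (fun n => pos 1 n z - pos (-1) n z)); split.
  move=> x; apply: c0_ext => n; rewrite c0ofE // /pos !ext_J // mul1r mulN1r.
  by case: (leP 0 (U x n)) => h; case: (leP 0 (- U x n)) => h'; lra.
move=> z z'; apply: c0_normP => n; rewrite c0BE !c0ofE //.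
have := pos_lip n z z' n1; have := pos_lip n z z' nN1.
have := ler_normB (pos 1 n z - pos 1 n z') (pos (-1) n z - pos (-1) n z').
rewrite (_ : pos 1 n z - pos 1 n z' - (pos (-1) n z - pos (-1) n z') =
  pos 1 n z - pos (-1) n z - (pos 1 n z' - pos (-1) n z')); last by ring.
lra.
Qed.

End LipschitzExtension.

(** * Averaging along a direction, and slopes of averaged maps *)

Section Averages.
Variables (R : realType) (Z X : normedModType R).
Implicit Types (F G : Z -> X) (v z : Z).

Definition avg v (n : nat) F z : X := n.+1%:R^-1 *: \sum_(s < n.+1) F (z + s%:R *: v).

Lemma mean_le (n : nat) (f : 'I_n.+1 -> X) (c : R) : (forall s, `|f s| <= c) ->
  `|n.+1%:R^-1 *: \sum_(s < n.+1) f s| <= c.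
Proof.
move=> fc; rewrite normrZ gtr0_norm ?invr_gt0 ?ltr0n // ler_pdivrMl ?ltr0n //.
apply: le_trans (ler_norm_sum _ _ _) _.
apply: le_trans (ler_sum _ (fun s _ => fc s)) _.
by rewrite sumr_const card_ord -[leLHS]mulr_natl.
Qed.

Lemma mean_cst (n : nat) (x : X) : n.+1%:R^-1 *: \sum_(s < n.+1) x = x.
Proof.
by rewrite sumr_const card_ord -[x *+ _]scaler_nat scalerA mulVf ?scale1r // pnatr_eq0.
Qed.

Lemma avgB v n F z z' : avg v n F z - avg v n F z' =
  n.+1%:R^-1 *: \sum_(s < n.+1) (F (z + s%:R *: v) - F (z' + s%:R *: v)).
Proof. by rewrite -scalerBr -sumrB. Qed.

Definition lip (lam : R) F := forall z z', `|F z - F z'| <= lam * `|z - z'|.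

Lemma avg_lip lam v n F : lip lam F -> lip lam (avg v n F).
Proof.
move=> FL z z'; rewrite avgB; apply: mean_le => s; apply: le_trans (FL _ _) _.
by rewrite opprD addrACA subrr addr0.
Qed.

Lemma avg_near lam v n F z : 0 <= lam -> lip lam F -> `|avg v n F z - F z| <= lam * n%:R * `|v|.
Proof.
move=> l0 FL; rewrite -[X in _ - X](mean_cst n (F z)) -scalerBr -sumrB; apply: mean_le => s.
apply: le_trans (FL _ _) _; rewrite addrAC subrr add0r normrZ normr_nat -mulrA.
by rewrite ler_wpM2l // ler_wpM2r // ler_nat -ltnS.
Qed.

Lemma avg_telescope v n F z :
  avg v n F (z + v) - avg v n F z = n.+1%:R^-1 *: (F (z + n.+1%:R *: v) - F z).
Proof.
rewrite avgB; congr (_ *: _).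
have := telescope_sumr (fun s => F (z + s%:R *: v)) (leq0n n.+1).
rewrite big_mkord scale0r addr0 => <-; apply: eq_bigr => s _; congr (F _ - _).
by rewrite -addrA -natr1 scalerDl scale1r (addrC v).
Qed.

Definition slowdiff (v : Z) (kap : R) F :=
  forall z y, `|(F (z + v) - F z) - (F (y + v) - F y)| <= kap * `|z - y|.

(** The increments of an average along [v] telescope to a difference quotient at distance [n.+1],
    whose numerator is [2 * lam]-Lipschitz in the base point: long averages have almost constant
    increments. *)
Lemma avg_slowdiff lam v n F : lip lam F -> slowdiff v (2 * lam / n.+1%:R) (avg v n F).
Proof.
move=> FL z y; rewrite !avg_telescope -scalerBr normrZ gtr0_norm ?invr_gt0 ?ltr0n //.
rewrite ler_pdivrMl ?ltr0n //.
have aux (N a b : R) : N != 0 -> N * (2 * a / N * b) = a * b + a * b by move=> N0; field.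
rewrite aux ?pnatr_eq0 //.
rewrite opprB addrACA (addrC (- F z)) -addrACA.
apply: le_trans (ler_normD _ _) _; apply: lerD.
  by apply: le_trans (FL _ _) _; rewrite opprD addrACA subrr addr0.
by rewrite distrC.
Qed.

Lemma slowdiff_avg v k w n F : slowdiff v k F -> slowdiff v k (avg w n F).
Proof.
move=> Fv z y; rewrite !avgB -scalerBr -sumrB; apply: mean_le => s.
rewrite !(addrAC _ v); apply: le_trans (Fv _ _) _.
by rewrite opprD addrACA subrr addr0.
Qed.
End Averages.

Section UnitVectors.
Variable R : realType.

Definition unitv (j : nat) : c0 R := c0of (fun i => (i == j)%:R).

Lemma unitvE j i : unitv j i = (i == j)%:R.
Proof.
rewrite c0ofE //; apply: (@null_eventually0 _ _ j.+1) => n; case: eqP => // ->; lia.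
Qed.

Lemma unitv_norm j : `|unitv j| <= 1.
Proof. by apply: c0_normP => n; rewrite unitvE; case: eqP; rewrite ?normr1 ?normr0. Qed.

Lemma truncS k (a : c0 R) : trunc k.+1 a = trunc k a + a k *: unitv k.
Proof.
apply: c0_ext => i; rewrite c0DE c0ZE !truncE unitvE ltnS leq_eqVlt.
by case: (ltngtP i k) => [ik|ik|->] /=; rewrite ?mulr0 ?mulr1 ?addr0 ?add0r.
Qed.

Lemma trunc_at0 (a : c0 R) : trunc 0 a = 0.
Proof. by apply: c0_ext => i; rewrite truncE. Qed.
End UnitVectors.

Section Linearize.
Variables (R : realType) (X : normedModType R) (J : X -> c0 R) (Phi : c0 R -> X) (lam : R).
Hypotheses (Jlin : forall (a : R) x y, J (a *: x + y) = a *: J x + J y)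
  (lam0 : 0 < lam) (Phil : lip lam Phi) (PhiJ : cancel J Phi).
Implicit Types F : c0 R -> X.

Let JD x y : J (x + y) = J x + J y.
Proof. by have := Jlin 1 x y; rewrite !scale1r. Qed.

Let J0 : J 0 = 0.
Proof. by have := JD 0 0; rewrite addr0 => /eqP; rewrite -subr_eq0 opprD addrA subrr sub0r oppr_eq0 => /eqP. Qed.

Let JZ a x : J (a *: x) = a *: J x.
Proof. by have := Jlin a x 0; rewrite !addr0 J0 addr0. Qed.

Definition affine_on_range (rho : R) F := exists x0, forall x, `|F (J x) - x - x0| <= rho.

Lemma average_unit_directions (M m : nat) (t : R) : 0 <= t ->
  exists F, [/\ lip lam F, forall z, `|F z - Phi z| <= M%:R * (lam * m%:R * t) &
    forall j, (j < M)%N -> slowdiff (t *: unitv R j) (2 * lam / m.+1%:R) F].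
Proof.
move=> t0; elim: M => [|M [F [F1 F2 F3]]].
  by exists Phi; split=> // z; rewrite subrr normr0 mul0r.
exists (avg (t *: unitv R M) m F); split; first exact: avg_lip.
  move=> z; set a := avg _ _ _ _.
  have -> : a - Phi z = (F z - Phi z) + (a - F z) by abel.
  apply: le_trans (ler_normD _ _) _; rewrite -natr1 mulrDl mul1r; apply: lerD => //.
  apply: le_trans (avg_near _ _ _ (ltW lam0) F1) _.
  rewrite ler_wpM2l ?mulr_ge0 ?(ltW lam0) //.
  by rewrite normrZ ger0_norm // ler_piMr // unitv_norm.
move=> j; rewrite ltnS leq_eqVlt => /orP[/eqP ->|jM]; first exact: avg_slowdiff.
by apply: slowdiff_avg; exact: F3.
Qed.

(** On the range of [J], [F] is at distance [rho] from a translate of the inverse of [J], so its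
    increment over [n.+1] steps along [J f] is [n.+1] times [f] up to [2 * rho]. Even a large [rho]
    is beaten by [n], and the earlier properties survive averaging. *)
Lemma average_range_directions (n : nat) (rho kap : R) (D : c0 R -> Prop) F (fs : seq X) :
  lip lam F -> (forall v, D v -> slowdiff v kap F) -> affine_on_range rho F ->
  exists G, [/\ lip lam G, forall v, D v -> slowdiff v kap G, affine_on_range rho G &
    forall f, f \in fs -> forall x, `|G (J x + J f) - G (J x) - f| <= 2 * rho / n.+1%:R].
Proof.
move=> Fl FD Fa; elim: fs => [|f fs [G [G1 G2 [x0 G3] G4]]]; first by exists F.
exists (avg (J f) n G); split; first exact: avg_lip.
- by move=> v Dv; apply: slowdiff_avg; exact: G2.
- exists (x0 + n.+1%:R^-1 *: \sum_(s < n.+1) s%:R *: f) => x.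
  have -> : avg (J f) n G (J x) - x - (x0 + n.+1%:R^-1 *: \sum_(s < n.+1) s%:R *: f) =
     n.+1%:R^-1 *: \sum_(s < n.+1) (G (J (x + s%:R *: f)) - (x + s%:R *: f) - x0).
    rewrite !sumrB big_split /= !scalerBr scalerDr !mean_cst /avg.
    have -> : \sum_(s < n.+1) G (J x + s%:R *: J f) = \sum_(s < n.+1) G (J (x + s%:R *: f)).
      by apply: eq_bigr => s _; rewrite JD JZ.
    by abel.
  by apply: mean_le => s; exact: G3.
- move=> g; rewrite inE => /orP[/eqP ->|gfs] x.
    rewrite avg_telescope.
    have -> : n.+1%:R^-1 *: (G (J x + n.+1%:R *: J f) - G (J x)) - f =
       n.+1%:R^-1 *: ((G (J (x + n.+1%:R *: f)) - (x + n.+1%:R *: f) - x0) -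
                      (G (J x) - x - x0)).
      rewrite JD JZ -[in X in _ - X = _](mean_cst n f) sumr_const card_ord -[f *+ _]scaler_nat.
      rewrite -scalerBr; congr (_ *: _).
      by abel.
    rewrite normrZ gtr0_norm ?invr_gt0 ?ltr0n // mulrC ler_pM2r ?invr_gt0 ?ltr0n //.
    have := ler_normB (G (J (x + n.+1%:R *: f)) - (x + n.+1%:R *: f) - x0) (G (J x) - x - x0).
    have := G3 (x + n.+1%:R *: f); have := G3 x; lra.
  rewrite avgB -[X in _ - X](mean_cst n g) -scalerBr -sumrB; apply: mean_le => s.
  by rewrite (addrAC (J x)) -JZ -(JD x); exact: G4.
Qed.

Section Slope.
Variables (F : c0 R -> X) (t kap A : R) (j : nat).
Hypotheses (Fl : lip lam F) (t0 : 0 < t) (kap0 : 0 <= kap) (A0 : 0 < A)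
  (Fs : slowdiff (t *: unitv R j) kap F).

Definition slope : X := t^-1 *: (F (t *: unitv R j) - F 0).

Lemma slope_le : `|slope| <= lam.
Proof.
rewrite /slope normrZ gtr0_norm ?invr_gt0 // ler_pdivrMl // mulrC.
apply: le_trans (Fl _ _) _; rewrite subr0 normrZ (gtr0_norm t0) ler_wpM2l ?(ltW lam0) //.
by rewrite ler_piMr ?(ltW t0) // unitv_norm.
Qed.

Lemma slope_steps z (k : nat) :
  `|F (z + (k%:R * t) *: unitv R j) - F z - (k%:R * t) *: slope| <= k%:R * (kap * (`|z| + k%:R * t)).
Proof.
elim: k => [|k IH]; first by rewrite !mul0r !scale0r addr0 subrr subr0 normr0.
set zk := z + (k%:R * t) *: unitv R j.
have E : z + (k.+1%:R * t) *: unitv R j = zk + t *: unitv R j.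
  by rewrite /zk -natr1 mulrDl mul1r scalerDl addrA.
have S : (k.+1%:R * t) *: slope = (k%:R * t) *: slope + (F (t *: unitv R j) - F 0).
  by rewrite -natr1 mulrDl mul1r scalerDl; congr (_ + _); rewrite /slope scalerA divff ?scale1r // gt_eqF.
have h := Fs zk 0; rewrite add0r subr0 in h.
have zkn : `|zk| <= `|z| + k%:R * t.
  apply: le_trans (ler_normD _ _) _; rewrite lerD2l normrZ ger0_norm ?mulr_ge0 ?(ltW t0) //.
  by rewrite ler_piMr ?mulr_ge0 ?(ltW t0) // unitv_norm.
have -> : F (z + (k.+1%:R * t) *: unitv R j) - F z - (k.+1%:R * t) *: slope =
   (F zk - F z - (k%:R * t) *: slope) + (F (zk + t *: unitv R j) - F zk - (F (t *: unitv R j) - F 0)).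
  rewrite E S; move: (F (zk + _)) (F zk) (F z) (_ *: slope) (F _ - F 0) => a b c d e.
  by abel.
apply: le_trans (ler_normD _ _) _.
have h2 := le_trans h (ler_wpM2l kap0 zkn).
apply: le_trans (lerD IH h2) _.
have : 0 <= kap * t by rewrite mulr_ge0 // ltW.
rewrite -natr1 => h3; have k0 : 0 <= k%:R :> R by [].
have := mulr_ge0 k0 h3; have := mulr_ge0 k0 (mulr_ge0 k0 h3); nra.
Qed.

(** Rounding the length to a multiple of [t] costs [2 * lam * t]; the at most [A / t] steps each
    cost [kap] times the norm of a point of the ball of radius [3 * A]. *)
Definition slope_err : R := 2 * lam * t + A / t * (kap * (3 * A)).

Lemma slope_pos z s : 0 <= s -> s <= A -> `|z| <= 2 * A ->
  `|F (z + s *: unitv R j) - F z - s *: slope| <= slope_err.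
Proof.
move=> s0 sA zA.
pose k := Num.truncn (s / t).
have k1 : k%:R * t <= s by rewrite -ler_pdivlMr // truncn_le // divr_ge0 // ltW.
have k2 : s < k%:R * t + t by rewrite -[X in _ + X]mul1r -mulrDl natr1 -ltr_pdivrMr // truncnS_gt.
have h1 : `|F (z + s *: unitv R j) - F (z + (k%:R * t) *: unitv R j)| <= lam * t.
  apply: le_trans (Fl _ _) _; rewrite ler_wpM2l ?(ltW lam0) //.
  rewrite opprD addrACA subrr add0r -scalerBl normrZ ger0_norm; last lra.
  by apply: le_trans (_ : (s - k%:R * t) * 1 <= _); [rewrite ler_wpM2l ?unitv_norm|]; lra.
have h2 : `|(s - k%:R * t) *: slope| <= t * lam.
  rewrite normrZ ger0_norm; last lra.
  by apply: ler_pM => //; [lra|lra|exact: slope_le].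
have h3 := slope_steps z k.
have h4 : k%:R * (kap * (`|z| + k%:R * t)) <= A / t * (kap * (3 * A)).
  apply: ler_pM => //; first by rewrite mulr_ge0 // addr_ge0 // mulr_ge0 // ltW.
    by rewrite ler_pdivlMr //; lra.
  by rewrite ler_wpM2l //; lra.
have -> : F (z + s *: unitv R j) - F z - s *: slope =
  (F (z + s *: unitv R j) - F (z + (k%:R * t) *: unitv R j)) +
  (F (z + (k%:R * t) *: unitv R j) - F z - (k%:R * t) *: slope) - (s - k%:R * t) *: slope.
  by rewrite scalerBl; abel.
apply: le_trans (ler_normB _ _) _; apply: le_trans (lerD (ler_normD _ _) (lexx _)) _.
rewrite /slope_err; lra.
Qed.

Lemma slope_real z s : `|s| <= A -> `|z| <= A ->
  `|F (z + s *: unitv R j) - F z - s *: slope| <= slope_err.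
Proof.
move=> sA zA; have [s0|s0] := leP 0 s; first by apply: slope_pos => //; rewrite ?ger0_norm // in sA *; lra.
have z2 : `|z + s *: unitv R j| <= 2 * A.
  apply: le_trans (ler_normD _ _) _; rewrite normrZ.
  have : `|s| * `|unitv R j| <= A * 1 by apply: ler_pM => //; exact: unitv_norm.
  lra.
(* A negative displacement is a positive one from [z + s *: unitv R j], whence the radius [2 * A] in
   [slope_pos]. *)
have sA' : - s <= A by move: sA; rewrite ltr0_norm.
have := slope_pos (ltW (_ : 0 < - s)) sA' z2; rewrite !scaleNr addrK opprK oppr_gt0 => /(_ s0).
move=> h; rewrite -normrN.
suff -> : - (F (z + s *: unitv R j) - F z - s *: slope) =
  F z - F (z + s *: unitv R j) + s *: slope by [].
by abel.
Qed.

End Slope.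

Lemma linearize (fs : seq X) (eps : R) : 0 < eps -> exists (M : nat) (b : nat -> X),
  (forall a : c0 R, `|\sum_(j < M) a j *: b j| <= (lam + 1) * `|a|) /\
  forall f, f \in fs -> `|\sum_(j < M) (J f) j *: b j - f| <= eps.
Proof.
move=> eps0.
have [A [A1 hA]] : exists A : R, 1 <= A /\ forall f, f \in fs -> `|J f| <= A.
  elim: fs => [|f fs [A [A1 hA]]]; first by exists 1.
  exists (Num.max A `|J f|); split; first by rewrite le_max A1.
  by move=> g; rewrite inE le_max => /orP[/eqP ->|/hA ->//]; rewrite lexx orbT.
have A0 : 0 < A by apply: lt_le_trans A1.
have [M hM] : exists M, forall k, (M <= k)%N -> forall f, f \in fs ->
    `|J f - trunc k (J f)| <= eps / (4 * lam).
  have e0 : 0 < eps / (4 * lam) by rewrite divr_gt0 // mulr_gt0.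
  elim: fs {hA} => [|f fs [M hM]]; first by exists 0%N.
  have [N hN] := trunc_cvg (J f) e0; exists (maxn M N) => k.
  rewrite geq_max => /andP[Mk Nk] g; rewrite inE => /orP[/eqP ->|gf]; first exact: hN.
  exact: hM.
(* [del <= 1] gives the norm [lam + 1] of the operator, by homogeneity from the unit sphere
   (included since [A >= 1]); [del <= eps / 4] serves for the approximation on [fs]. *)
pose del := Num.min 1 (eps / 4).
have del0 : 0 < del by rewrite lt_min ltr01; lra.
have del1 : del <= 1 by rewrite ge_min lexx.
have del2 : del <= eps / 4 by rewrite ge_min lexx orbT.
have M0 : (0 : R) < M.+1%:R by rewrite ltr0n.
pose t := del / (4 * lam * M.+1%:R).
have t0 : 0 < t by rewrite divr_gt0 // !mulr_gt0.
have tE : M.+1%:R * (2 * lam * t) = del / 2.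
  by rewrite /t; move: M0; move: (M.+1%:R : R) => N N0; field; rewrite !gt_eqF.
pose C := M.+1%:R * (A / t * (2 * lam * (3 * A))).
have [m hm] := exists_nat_gt (C / (del / 2)).
pose kap := 2 * lam / m.+1%:R.
have kap0 : 0 <= kap by rewrite divr_ge0 // mulr_ge0 // ltW.
have kE : M.+1%:R * (A / t * (kap * (3 * A))) <= del / 2.
  have -> : M.+1%:R * (A / t * (kap * (3 * A))) = C / m.+1%:R.
    rewrite /C /kap; set N : R := m.+1%:R; set N' : R := M.+1%:R; field.
    by rewrite !gt_eqF // ltr0n.
  by rewrite ler_pdivrMr ?ltr0n // mulrC -ler_pdivrMr ?divr_gt0 // ltW.
have Merr : M%:R * slope_err t kap A <= del.
  apply: le_trans (_ : M.+1%:R * slope_err t kap A <= _).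
    rewrite ler_wpM2r ?ler_nat //.
    have h1 : 0 <= 2 * lam * t by apply: mulr_ge0 _ (ltW t0); apply: mulr_ge0 _ (ltW lam0).
    have h2 : 0 <= A / t by exact: divr_ge0 (ltW A0) (ltW t0).
    have h3 : 0 <= kap * (3 * A) by apply: mulr_ge0 => //; lra.
    exact: addr_ge0 h1 (mulr_ge0 h2 h3).
  by rewrite /slope_err mulrDr tE; lra.
have [F1 [F1l F1n F1s]] := average_unit_directions M m (ltW t0).
pose rho := M%:R * (lam * m%:R * t).
have F1a : affine_on_range rho F1.
  by exists 0 => x; rewrite subr0 -{2}(PhiJ x).
(* The first averages have moved [Phi] by up to [rho], which grows with [m]; [n] is chosen last to
   make up for it. *)
have [n hn] := exists_nat_gt (2 * rho / (eps / 4)).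
have [v [j jM ->]|G [Gl Gs _ GJ]] := @average_range_directions n rho kap
    (fun v => exists2 j, (j < M)%N & v = t *: unitv R j) F1 fs F1l _ F1a.
  exact: F1s.
have {}Gs j : (j < M)%N -> slowdiff (t *: unitv R j) kap G by move=> jM; apply: Gs; exists j.
exists M, (slope G t).
have key (a : c0 R) k : `|a| <= A -> (k <= M)%N ->
    `|G (trunc k a) - G 0 - \sum_(j < k) a j *: slope G t j| <= k%:R * slope_err t kap A.
  move=> aA; elim: k => [|k IH] kM; first by rewrite trunc_at0 big_ord0 !subrr normr0 mul0r.
  rewrite truncS big_ord_recr /=.
  have h1 := IH (ltnW kM).
  have h2 : `|G (trunc k a + a k *: unitv R k) - G (trunc k a) - a k *: slope G t k| <= slope_err t kap A.
    apply: slope_real => //; first exact: Gs.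
      exact: le_trans (c0_coord a k) aA.
    exact: le_trans (trunc_norm k a) aA.
  set S := \sum_(j < k) _ in h1 *; set s := a k *: slope _ _ _ in h2 *.
  have -> : G (trunc k a + a k *: unitv R k) - G 0 - (S + s) =
    (G (trunc k a) - G 0 - S) + (G (trunc k a + a k *: unitv R k) - G (trunc k a) - s) by abel.
  by apply: le_trans (ler_normD _ _) _; rewrite -natr1 mulrDl mul1r; exact: lerD.
split.
  move=> a; have [->|a0] := eqVneq a 0.
    rewrite normr0 mulr0 big1 ?normr0 // => j _; by rewrite c00E scale0r.
  have na : 0 < `|a| by rewrite normr_gt0.
  pose a' := `|a|^-1 *: a.
  have a'1 : `|a'| = 1 by rewrite normrZ gtr0_norm ?invr_gt0 // mulVf // gt_eqF.
  have -> : \sum_(j < M) a j *: slope G t j = `|a| *: \sum_(j < M) a' j *: slope G t j.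
    rewrite scaler_sumr; apply: eq_bigr => j _.
    by rewrite -[a' j]/(`|a|^-1 * a j) [RHS]scalerA mulrA divff ?mul1r // gt_eqF.
  rewrite normrZ normr_id mulrC ler_wpM2r //.
  have h1 : `|a'| <= A by rewrite a'1.
  have h2 := key a' M h1 (leqnn M).
  have h3 : `|G (trunc M a') - G 0| <= lam.
    apply: le_trans (Gl _ _) _; rewrite subr0 -[leRHS]mulr1 ler_wpM2l ?(ltW lam0) //.
    by rewrite -a'1 trunc_norm.
  set S := \sum_(j < M) _ in h2 *.
  have -> : S = (G (trunc M a') - G 0) - (G (trunc M a') - G 0 - S) by abel.
  by apply: le_trans (ler_normB _ _) _; lra.
move=> f ff.
have h1 := key (J f) M (hA f ff) (leqnn M).
have h2 : `|G (trunc M (J f)) - G (J f)| <= eps / 4.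
  apply: le_trans (Gl _ _) _; rewrite distrC.
  apply: le_trans (ler_wpM2l (ltW lam0) (hM M (leqnn M) f ff)) _.
  by rewrite le_eqVlt; apply/orP; left; apply/eqP; field; rewrite gt_eqF.
have h3 : `|G (J f) - G 0 - f| <= eps / 4.
  have := GJ f ff 0; rewrite J0 add0r => /le_trans; apply.
  have e4 : 0 < eps / 4 by lra.
  rewrite ler_pdivrMr ?ltr0n // [leRHS]mulrC; move: (ltW hn); by rewrite (ler_pdivrMr _ _ e4).
set S := \sum_(j < M) _ in h1 *.
have -> : S - f = (G (trunc M (J f)) - G (J f)) + (G (J f) - G 0 - f) -
  (G (trunc M (J f)) - G 0 - S) by abel.
apply: le_trans (ler_normB _ _) _; apply: le_trans (lerD (ler_normD _ _) (lexx _)) _.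
lra.
Qed.

End Linearize.

(** * Linear maps, convergence and Neumann series *)

Section LinearMaps.
Variables (R : realType) (X Y : normedModType R).

Definition linmap (f : X -> Y) := forall (a : R) x y, f (a *: x + y) = a *: f x + f y.

Variable f : X -> Y.
Hypothesis fl : linmap f.

Lemma linmapD x y : f (x + y) = f x + f y.
Proof. by have := fl 1 x y; rewrite !scale1r. Qed.

Lemma linmap0 : f 0 = 0.
Proof. by apply: (addrI (f 0)); rewrite -linmapD !addr0. Qed.

Lemma linmapZ a x : f (a *: x) = a *: f x.
Proof. by have := fl a x 0; rewrite !addr0 linmap0 addr0. Qed.

Lemma linmapN x : f (- x) = - f x.
Proof. by rewrite -scaleN1r linmapZ scaleN1r. Qed.

Lemma linmapB x y : f (x - y) = f x - f y.
Proof. by rewrite linmapD linmapN. Qed.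

Lemma linmap_sum I (r : seq I) (P : pred I) (F : I -> X) :
  f (\sum_(i <- r | P i) F i) = \sum_(i <- r | P i) f (F i).
Proof. by apply: (big_morph f linmapD linmap0). Qed.
End LinearMaps.

Section Convergence.
Variables (R : realType) (X : normedModType R).
Implicit Types (u v : nat -> X) (l : X).

Definition conv u l := forall e : R, 0 < e -> exists N, forall n, (N <= n)%N -> `|u n - l| <= e.

Definition cauchy_seq u := forall e : R, 0 < e ->
  exists N, forall m n, (N <= m)%N -> (N <= n)%N -> `|u m - u n| <= e.

Definition seq_complete := forall u, cauchy_seq u -> exists l, conv u l.

Lemma conv_norm_le u l v k (M : R) : conv u l -> conv v k ->
  (forall n, `|u n - v n| <= M) -> `|l - k| <= M.
Proof.
move=> ul vk h; apply/ler_addgt0Pr => e e0; have e2 : 0 < e / 2 by lra.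
have [N hN] := ul _ e2; have [N' hN'] := vk _ e2; pose n := maxn N N'.
have -> : l - k = (u n - v n) - (u n - l) + (v n - k) by abel.
apply: le_trans (ler_normD _ _) _; apply: le_trans (lerD (ler_normB _ _) (lexx _)) _.
by have := h n; have := hN n (leq_maxl _ _); have := hN' n (leq_maxr _ _); lra.
Qed.

Lemma conv_uniq u l k : conv u l -> conv u k -> l = k.
Proof.
move=> ul uk; apply/eqP; rewrite -subr_eq0 -normr_le0.
by apply: (conv_norm_le ul uk) => n; rewrite subrr normr0.
Qed.

Lemma conv_cst l : conv (fun=> l) l.
Proof. by move=> e e0; exists 0%N => n _; rewrite subrr normr0 ltW. Qed.

Lemma conv_bound u l (M : R) : conv u l -> (forall n, `|u n| <= M) -> `|l| <= M.
Proof.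
move=> ul h; rewrite -[l]subr0; apply: (conv_norm_le ul (conv_cst 0)) => n.
by rewrite subr0.
Qed.

Lemma conv_lin u v l k (a : R) : conv u l -> conv v k ->
  conv (fun n => a *: u n + v n) (a *: l + k).
Proof.
move=> ul vk e e0; have a0 : 0 < `|a| + 1 by rewrite ltr_wpDl.
have [N hN] := ul _ (divr_gt0 (divr_gt0 e0 (ltr0n _ 2)) a0).
have [N' hN'] := vk _ (divr_gt0 e0 (ltr0n _ 2)).
exists (maxn N N') => n; rewrite geq_max => /andP[Nn Nn'].
have -> : a *: u n + v n - (a *: l + k) = a *: (u n - l) + (v n - k) by rewrite scalerBr; abel.
apply: le_trans (ler_normD _ _) _; rewrite normrZ.
have h1 : `|a| * `|u n - l| <= (`|a| + 1) * (e / 2 / (`|a| + 1)).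
  by apply: ler_pM => //; [rewrite lerDl|exact: hN].
have -> : e = (`|a| + 1) * (e / 2 / (`|a| + 1)) + e / 2 by field; rewrite gt_eqF.
by apply: lerD => //; exact: hN'.
Qed.

Hypothesis Xc : seq_complete.

Lemma geometric_conv u (C : R) : (forall n, `|u n.+1 - u n| <= C * 2^-1 ^+ n) ->
  exists l, conv u l.
Proof.
move=> h; have C0 : 0 <= C by have := h 0%N; rewrite expr0 mulr1; exact: le_trans.
have h2 n k : `|u (n + k)%N - u n| <= 2 * C * 2^-1 ^+ n * (1 - 2^-1 ^+ k).
  elim: k => [|k IH]; first by rewrite addn0 subrr normr0 expr0 subrr mulr0.
  have -> : u (n + k.+1)%N - u n = (u (n + k).+1 - u (n + k)%N) + (u (n + k)%N - u n).
    by rewrite addnS; abel.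
  apply: le_trans (ler_normD _ _) _; apply: le_trans (lerD (h _) IH) _.
  by rewrite exprD exprS; lra.
have h3 n k : (n <= k)%N -> `|u k - u n| <= 2 * C * 2^-1 ^+ n.
  move=> nk; rewrite -(subnKC nk); apply: le_trans (h2 _ _) _.
  have hp m : 0 <= 2^-1 ^+ m :> R by rewrite exprn_ge0 // invr_ge0.
  by rewrite ler_piMr ?mulr_ge0 //; have := hp (k - n)%N; lra.
apply: Xc => e e0; have C1 : 0 < 4 * C + 1 by lra.
have [N hN] := exists_half_lt (divr_gt0 e0 C1); exists N => m n Nm Nn.
have -> : u m - u n = (u m - u N) - (u n - u N) by abel.
apply: le_trans (ler_normB _ _) _.
have := h3 N m Nm; have := h3 N n Nn.
have : (4 * C + 1) * 2^-1 ^+ N <= e by rewrite mulrC -ler_pdivlMr // hN.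
have hp : 0 <= 2^-1 ^+ N :> R by rewrite exprn_ge0 // invr_ge0.
lra.
Qed.

Lemma neumann (T : X -> X) : linmap T -> (forall x, `|T x - x| <= 2^-1 * `|x|) ->
  exists G : X -> X, [/\ linmap G, forall x, `|G x| <= 2 * `|x|, cancel G T & cancel T G].
Proof.
move=> Tl Ts.
have Tlow x : `|x| <= 2 * `|T x|.
  have := ler_normB (T x) (T x - x); rewrite (_ : T x - (T x - x) = x); last by abel.
  by have := Ts x; lra.
have Tinj x y : T x = T y -> x = y.
  move=> Txy; apply/eqP; rewrite -subr_eq0 -normr_le0.
  by apply: le_trans (Tlow _) _; rewrite (linmapB Tl) Txy subrr normr0 mulr0.
have Tsurj y : exists x, T x = y.
  (* Successive approximations for [T x = y]: the increments are halved at each step because [T] is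
     within [1 / 2] of the identity. *)
  pose u := fix u n := if n is k.+1 then y + (u k - T (u k)) else 0.
  have hu n : `|u n.+1 - u n| <= `|y| * 2^-1 ^+ n.
    elim: n => [|n IH]; first by rewrite /= linmap0 // subrr addr0 subr0 mulr1.
    have -> : u n.+2 - u n.+1 = - (T (u n.+1 - u n) - (u n.+1 - u n)).
      have uS k : u k.+1 = y + (u k - T (u k)) by [].
      have yE : y = u n.+1 - (u n - T (u n)) by rewrite uS; abel.
      by rewrite (linmapB Tl) (uS n.+1) {1}yE; abel.
    rewrite normrN; apply: le_trans (Ts _) _; rewrite exprS; lra.
  have [l ul] := geometric_conv hu; exists l.
  have hT : conv (fun n => T (u n)) (T l).
    move=> e e0; have [N hN] := ul _ (divr_gt0 e0 (ltr0n _ 2)); exists N => n Nn.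
    rewrite -(linmapB Tl); have := ler_normD (T (u n - l) - (u n - l)) (u n - l); rewrite subrK.
    by have := Ts (u n - l); have := hN n Nn; lra.
  have hS : conv (fun n => u n.+1) l.
    by move=> e e0; have [N hN] := ul e e0; exists N => n Nn; apply: hN; exact: leqW.
  have : conv (fun n => T (u n)) y.
    have := conv_lin (-1) hS (conv_lin 1 ul (conv_cst y)).
    move=> /= h e e0; have [N hN] := h e e0; exists N => n /hN.
    rewrite scaleN1r !scale1r (_ : _ - (-1 *: l + (l + y)) = T (u n) - y) //.
    by rewrite scaleN1r; abel.
  exact: conv_uniq.
have [G TG] := choice Tsurj.
have GT x : G (T x) = x by apply: Tinj.
exists G; split=> //.
- by move=> a x y; apply: Tinj; rewrite TG Tl !TG.
- by move=> x; have := Tlow (G x); rewrite TG.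
Qed.
End Convergence.

(** The bound on partial sums is applied to [w] with its first terms replaced by 0, which is small
    in norm. *)
Lemma null_series_conv (R : realType) (W X : normedModType R) (B : nat -> W -> X) (CB : R) :
  @seq_complete R X -> 0 <= CB -> (forall n, B n 0 = 0) ->
  (forall q (w : nat -> W) (om : R), (forall n, `|w n| <= om) ->
     `|\sum_(n < q) B n (w n)| <= CB * om) ->
  forall w : nat -> W, (forall e : R, 0 < e -> exists N, forall n, (N <= n)%N -> `|w n| <= e) ->
  exists l, conv (fun q => \sum_(n < q) B n (w n)) l.
Proof.
move=> Xc CB0 B0 B_sum w wn; apply: Xc => e ee.
have CB1 : 0 < CB + 1 by rewrite ltr_wpDl.
have e1 : 0 < e / (CB + 1) by rewrite divr_gt0.
have [M hM] := wn _ e1.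
have aux m n : (M <= m)%N -> (m <= n)%N ->
    `|\sum_(k < n) B k (w k) - \sum_(k < m) B k (w k)| <= e.
  move=> Mm mn.
  have -> : \sum_(k < n) B k (w k) - \sum_(k < m) B k (w k) =
      \sum_(k < n) B k (if (m <= k)%N then w k else 0).
    rewrite -!(big_mkord xpredT (fun k => B k (w k))) (big_cat_nat _ mn) //= addrAC subrr add0r.
    rewrite -(big_mkord xpredT (fun k => B k (if (m <= k)%N then w k else 0))).
    rewrite [RHS](big_cat_nat _ mn) //= [X in _ = X + _]big_nat [X in _ = X + _]big1 ?add0r.
      by rewrite !big_nat; apply: eq_bigr => k /andP[-> _].
    by move=> k /andP[_ km]; rewrite leqNgt km /= B0.
  apply: le_trans (@B_sum n (fun k => if (m <= k)%N then w k else 0) (e / (CB + 1)) _) _.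
    move=> k; case: ifP => mk; last by rewrite normr0 ltW.
    exact: hM (leq_trans Mm mk).
  by rewrite mulrA ler_pdivrMr // mulrC ler_wpM2l ?(ltW ee) // lerDl.
exists M => m n Mm Mn; have [mn|nm] := leqP m n; first by rewrite distrC; exact: aux.
by apply: aux => //; exact: ltnW.
Qed.

Lemma complete_seq_complete (R : realType) (X : completeNormedModType R) : @seq_complete R X.
Proof.
move=> u cu.
have /cauchy_cvgP/cvg_ex[l ul] : cauchy (u @ \oo).
  apply/cauchyP => e e0; have e2 : 0 < e / 2 by lra.
  have [N hN] := cu _ e2; exists (u N); exists N => //= n Nn.
  rewrite /= -ball_normE /=; apply: le_lt_trans (hN N n _ Nn) _; [exact: leqnn|lra].
exists l => e e0; have /cvgrPdist_le/(_ e e0)[N _ hN] := ul.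
by exists N => n Nn; rewrite distrC; exact: hN.
Qed.

(** * Complemented copies *)

Section Rows.
Variables (R : realType) (pr : nat -> nat * nat) (pi : nat * nat -> nat).
Hypotheses (prK : cancel pr pi) (piK : cancel pi pr).

Definition row (n : nat) (w : c0 R) : c0 R := c0of (fun k => w (pi (n, k))).

Lemma pi_unbounded N n : exists K, forall k, (K <= k)%N -> (N <= pi (n, k))%N.
Proof.
elim: N => [|N [K hK]]; first by exists 0%N.
exists (maxn K (pr N).2.+1) => k; rewrite geq_max => /andP[Kk Nk].
rewrite ltn_neqAle hK // andbT; apply/eqP => E.
by move: Nk; rewrite E piK ltnn.
Qed.

Lemma rowE n w k : row n w k = w (pi (n, k)).
Proof.
rewrite c0ofE // => e e0; have [N hN] := c0_null w e0.
by have [K hK] := pi_unbounded N n; exists K => j /hK; exact: hN.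
Qed.

Lemma row_norm n w : `|row n w| <= `|w|.
Proof. by apply: c0_normP => k; rewrite rowE; exact: c0_coord. Qed.

Lemma row_lin n : linmap (row n).
Proof. by move=> a x y; apply: c0_ext => k; rewrite c0DE c0ZE !rowE. Qed.

Lemma row_null w (e : R) : 0 < e -> exists N, forall n, (N <= n)%N -> `|row n w| <= e.
Proof.
move=> e0; have [M hM] := c0_null w e0.
suff [N hN] : exists N, forall i, (i < M)%N -> ((pr i).1 < N)%N.
  exists N => n Nn; apply: c0_normP => k; rewrite rowE; apply: hM; rewrite leqNgt.
  by apply/negP => /hN; rewrite piK /= ltnNge Nn.
elim: M {hM} => [|M [N hN]]; first by exists 0%N.
exists (maxn N (pr M).1.+1) => i; rewrite ltnS leq_eqVlt => /orP[/eqP ->|/hN h].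
  exact: leq_maxr.
exact: leq_trans h (leq_maxl _ _).
Qed.

Definition glue (r : nat -> c0 R) : c0 R := c0of (fun i => r (pr i).1 (pr i).2).

Definition rnull (r : nat -> c0 R) :=
  forall e : R, 0 < e -> exists N, forall n, (N <= n)%N -> `|r n| <= e.

Lemma glueE r i : rnull r -> glue r i = r (pr i).1 (pr i).2.
Proof.
move=> rn; rewrite c0ofE //; apply: (null_rows prK (u := fun n k => r n k)) => [e e0|n].
  have [N hN] := rn e e0; exists N => n k Nn.
  by apply: le_trans (c0_coord _ _) _; exact: hN.
exact: c0_null.
Qed.

Lemma row_glue r n : rnull r -> row n (glue r) = r n.
Proof. by move=> rn; apply: c0_ext => k; rewrite rowE glueE // piK. Qed.

Lemma glue_norm r M : rnull r -> (forall n, `|r n| <= M) -> `|glue r| <= M.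
Proof.
move=> rn h; apply: c0_normP => i; rewrite glueE //.
exact: le_trans (c0_coord _ _) (h _).
Qed.

Lemma row_ext w w' : (forall n, row n w = row n w') -> w = w'.
Proof.
move=> h; apply: c0_ext => i; rewrite -(prK i) (surjective_pairing (pr i)) -!rowE.
by rewrite h.
Qed.
End Rows.

(** * Almost disjoint blocks and complementation in [c0] *)

Section Blocks.
Variables (R : realType) (X : normedModType R) (J : X -> c0 R) (Lj K Lam e0 : R)
  (tau : nat -> c0 R -> X) (N : nat -> nat).
Hypotheses (Xc : @seq_complete R X) (Jl : linmap J) (Lj0 : 0 <= Lj) (K0 : 0 <= K)
  (JL : forall x, `|J x| <= Lj * `|x|) (JK : forall x, `|x| <= K * `|J x|)
  (Lam0 : 0 <= Lam) (taul : forall n, linmap (tau n))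
  (tauL : forall n a, `|tau n a| <= Lam * `|a|)
  (tauN : forall n (a : c0 R) (e : R), 0 <= e -> (forall i, (i < N n)%N -> `|a i| <= e) -> `|tau n a| <= Lam * e)
  (e00 : 0 <= e0).
Let eps n := e0 * 2^-1 ^+ n.
(** [C1] says that late operators fix the ranges of earlier ones; [C2] is the same for adjoints,
    tested on coordinate functionals; by [C4] earlier ranges are almost supported below [N n]. *)
Hypotheses (C1 : forall m n a, (m < n)%N -> `|tau n (J (tau m a)) - tau m a| <= eps n * `|a|)
  (C2 : forall m n i x, (m < n)%N -> (i < N m)%N -> `|J (tau n (J x)) i - J x i| <= eps n * `|x|)
  (C3 : forall x, conv (fun n => tau n (J x)) x)
  (C4 : forall m n i a, (m < n)%N -> (N n <= i)%N -> `|J (tau m a) i| <= eps n * `|a|)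
  (C5 : forall m n, (m < n)%N -> (N m <= N n)%N).

Let sig := Lam * Lj.
Let S n x := tau n (J x).
Let E n x := x - S n x.
Let c3 := 2 * Lj + 2 * Lam * (1 + sig).
Hypothesis small : 2 * c3 * e0 <= 2^-1.

Let sig0 : 0 <= sig. Proof. exact: mulr_ge0. Qed.

Let Sl n : linmap (S n). Proof. by move=> a x y; rewrite /S Jl taul. Qed.
Let El n : linmap (E n). Proof. by move=> a x y; rewrite /E Sl scalerBr; abel. Qed.

Let Sn n x : `|S n x| <= sig * `|x|.
Proof. by apply: le_trans (tauL _ _) _; rewrite -mulrA ler_wpM2l. Qed.

Let En n x : `|E n x| <= (1 + sig) * `|x|.
Proof. by apply: le_trans (ler_normB _ _) _; rewrite mulrDl mul1r lerD2l. Qed.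

Let eps_ge0 n : 0 <= eps n.
Proof. by rewrite mulr_ge0 // exprn_ge0 // invr_ge0. Qed.

Let eps_le m n : (m <= n)%N -> eps n <= eps m.
Proof. by move=> mn; rewrite ler_wpM2l //; exact: half_le. Qed.

Let eps_sum n : \sum_(k < n) eps k <= 2 * e0.
Proof.
have -> : \sum_(k < n) eps k = 2 * e0 * (1 - 2^-1 ^+ n).
  elim: n => [|n IH]; first by rewrite big_ord0 expr0 subrr mulr0.
  by rewrite big_ord_recr /= IH /eps exprS; lra.
by rewrite ler_piMr ?mulr_ge0 // gerBl exprn_ge0 // invr_ge0.
Qed.

(** The factor [E k] is used twice. In [B] it removes the low coordinates, so that the blocks are
    almost disjoint; in [A] it makes the [n]-th term tend to 0, so that the rows [J (A n x)] glue to
    a point of [c0]. *)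
Let B n a : X := if n is k.+1 then E k (tau k.+2 a - tau k.+1 a) else tau 1 a.
Let A n x : X := if n is k.+1 then E k x else x.

Let Bl n : linmap (B n).
Proof.
case: n => [|n] a x y /=; first exact: taul.
by rewrite -El; congr (E n _); rewrite !taul scalerBr; abel.
Qed.

Let Al n : linmap (A n).
Proof. by case: n => [|n] a x y /=; [|exact: El]. Qed.

Let An n x : `|A n x| <= (1 + sig) * `|x|.
Proof. by case: n => [|n] //=; rewrite ler_peMl // lerDl. Qed.

(* The [n]-th block lives essentially on the coordinates between [N n.-1] and [N n.+3], which is
   what the increments of [ind i] detect. *)
Let ind (i n : nat) : R := if n is k.+1 then (i < N k)%N%:R else 0.

Let ind_le i n k : (n <= k)%N -> ind i n <= ind i k.
Proof.
case: n k => [|n] [|k] //=; rewrite ltnS leq_eqVlt => /orP[/eqP -> //|/C5 NN].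
by rewrite ler_nat; case: (ltnP i (N n)) => // h; rewrite (leq_trans h NN).
Qed.

Let ind01 i n : 0 <= ind i n <= 1.
Proof. by case: n => [|n] /=; [rewrite lexx ler01|case: (_ < _)%N; rewrite ?lexx ?ler01]. Qed.

(** A sum that telescopes with step 4: a coordinate meets at most four blocks. *)
Let ind_sum i n : \sum_(k < n) (ind i (k + 4)%N - ind i k) <= 4.
Proof.
have -> : \sum_(k < n) (ind i (k + 4)%N - ind i k) =
  ind i n + ind i n.+1 + ind i n.+2 + ind i n.+3 - (ind i 0 + ind i 1 + ind i 2 + ind i 3).
  move: (ind i) => b; elim: n => [|n IH]; first by rewrite big_ord0 subrr.
  by rewrite big_ord_recr /= IH addn4; lra.
have := ind01 i n; have := ind01 i n.+1; have := ind01 i n.+2; have := ind01 i n.+3.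
have := ind01 i 0; have := ind01 i 1; have := ind01 i 2; have := ind01 i 3.
lra.
Qed.

Let c1 := 2 * Lam + 2 + 2 * sig.
Let c2 := Lj * ((1 + sig) * (2 * Lam)).

Let B_coord n i a : `|J (B n.+1 a) i| <= (c1 * eps n + c2 * (ind i (n + 4)%N - ind i n)) * `|a|.
Proof.
rewrite /=; set z := tau n.+2 a - tau n.+1 a.
have zn : `|z| <= 2 * Lam * `|a|.
  by apply: le_trans (ler_normB _ _) _; have := tauL n.+2 a; have := tauL n.+1 a; lra.
have a0 : 0 <= `|a| by [].
have ea : 0 <= eps n * `|a| by rewrite mulr_ge0.
have sa : 0 <= sig * (eps n * `|a|) by rewrite mulr_ge0.
have la : 0 <= Lam * (eps n * `|a|) by rewrite mulr_ge0.
have JE : J (E n z) i = J z i - J (S n z) i by rewrite /E (linmapB Jl) c0BE.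
have mid : `|J (E n z) i| <= c2 * `|a|.
  apply: le_trans (c0_coord _ _) _; apply: le_trans (JL _) _.
  rewrite /c2 -!mulrA ler_wpM2l //; apply: le_trans (En n z) _.
  by rewrite ler_wpM2l ?mulrA // addr_ge0.
have c20 : 0 <= c2 by rewrite !mulr_ge0 // addr_ge0.
have diff0 : 0 <= ind i (n + 4)%N - ind i n by have := ind_le i (leq_addr 4 n); lra.
have d2 : 0 <= c2 * (ind i (n + 4)%N - ind i n) * `|a| by exact: mulr_ge0 (mulr_ge0 c20 diff0) a0.
have [h3|h3] := leqP (N n.+3) i.
  have t1 := C4 a (ltnSn n.+2) h3; have t2 := C4 a (leqW (leqnn n.+2)) h3.
  have t3 := @C4 n n.+3 i (J z) (leqW (leqW (leqnn n.+1))) h3.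
  have t4 : eps n.+3 * `|J z| <= eps n * (Lj * (2 * Lam * `|a|)).
    apply: ler_pM => //; first exact: eps_le (leqW (leqW (leqnSn n))).
    by apply: le_trans (JL z) _; rewrite ler_wpM2l.
  have t5 : eps n.+3 * `|a| <= eps n * `|a|.
    by rewrite ler_wpM2r //; exact: eps_le (leqW (leqW (leqnSn n))).
  rewrite JE /z (linmapB Jl) c0BE.
  apply: le_trans (ler_normB _ _) _; apply: le_trans (lerD (ler_normB _ _) (lexx _)) _.
  rewrite mulrDl /c1; have := le_trans t3 t4; rewrite -/(S n z) -/z.
  have -> : eps n * (Lj * (2 * Lam * `|a|)) = 2 * sig * (eps n * `|a|) by rewrite /sig; ring.
  move: t1 t2; lra.
case: n => [|n] in z zn ea sa la JE mid diff0 d2 h3 *.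
  rewrite /= h3 subr0 mulr1; apply: le_trans mid _; rewrite mulrDl lerDr.
  by rewrite /c1; lra.
have [h1|h1] := ltnP i (N n).
  have t1 := @C2 n n.+1 i z (ltnSn n) h1.
  rewrite JE distrC; apply: le_trans t1 _.
  have : eps n.+1 * `|z| <= eps n.+1 * (2 * Lam * `|a|) by rewrite ler_wpM2l.
  rewrite mulrDl /c1; lra.
have -> : ind i (n.+1 + 4)%N - ind i n.+1 = 1.
  by rewrite addn4 /= h3 ltnNge h1 subr0.
rewrite mulr1; apply: le_trans mid _; rewrite mulrDl lerDr /c1; lra.
Qed.

Let CB := K * (Lj * Lam + c1 * (2 * e0) + c2 * 4).

Let c10 : 0 <= c1. Proof. by rewrite /c1 !addr_ge0 // mulr_ge0. Qed.
Let c20 : 0 <= c2. Proof. by rewrite !mulr_ge0 // addr_ge0. Qed.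

Let CB0 : 0 <= CB.
Proof. by rewrite mulr_ge0 // !addr_ge0 // mulr_ge0 // mulr_ge0. Qed.

Let B_sum q (w : nat -> c0 R) (om : R) : (forall n, `|w n| <= om) ->
  `|\sum_(n < q) B n (w n)| <= CB * om.
Proof.
move=> wom; have om0 : 0 <= om := le_trans (normr_ge0 _) (wom 0%N).
apply: le_trans (JK _) _; rewrite -mulrA ler_wpM2l //.
apply: c0_normP => i; rewrite (linmap_sum Jl) c0_sumE.
case: q => [|q]; first by rewrite big_ord0 normr0 mulr_ge0 // !addr_ge0 // mulr_ge0 // mulr_ge0.
have -> : (Lj * Lam + c1 * (2 * e0) + c2 * 4) * om = Lj * Lam * om + (c1 * (2 * e0) + c2 * 4) * om by ring.
rewrite big_ord_recl; apply: le_trans (ler_normD _ _) _; apply: lerD.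
  apply: le_trans (c0_coord _ _) _; apply: le_trans (JL _) _; rewrite -mulrA ler_wpM2l //.
  by apply: le_trans (tauL _ _) _; rewrite ler_wpM2l.
apply: le_trans (ler_norm_sum _ _ _) _; under eq_bigr do rewrite lift0.
apply: le_trans (ler_sum _ (fun (n : 'I_q) _ => B_coord n i (w n.+1))) _.
apply: (@le_trans _ _ (\sum_(n < q) (c1 * eps n + c2 * (ind i (n + 4)%N - ind i n)) * om)).
  apply: ler_sum => n _; rewrite ler_wpM2l //.
  apply: addr_ge0; first exact: mulr_ge0 c10 (eps_ge0 n).
  by apply: mulr_ge0 c20 _; rewrite subr_ge0 ind_le // leq_addr.
rewrite -mulr_suml big_split /= -!mulr_sumr ler_wpM2r //.
have h := eps_sum q; rewrite /eps -mulr_sumr in h.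
have h2 := ind_sum i q.
by apply: lerD; apply: ler_wpM2l.
Qed.

(** In the expansion of the product the cross terms cancel in pairs. [S m (S n x)] is close to
    [S n x] by [C1], and [S n (S m y)] to [S n y] by [C2], since [tau n] sees only the coordinates
    below [N n]. *)
Let defect n x : `|E n (S n.+2 (E n x) - S n.+1 (E n x)) - (S n.+2 x - S n.+1 x)| <= c3 * eps n * `|x|.
Proof.
pose y := E n x; have yn : `|y| <= (1 + sig) * `|x| by exact: En.
have SS m : (n < m)%N -> `|S n (S m y) - S n y| <= Lam * (eps n * ((1 + sig) * `|x|)).
  move=> nm; rewrite /S -(linmapB (taul n)); apply: tauN => [|i iN].
    by rewrite !mulr_ge0 // addr_ge0.
  rewrite c0BE; apply: le_trans (C2 y nm iN) _.
  by apply: ler_pM => //; exact: eps_le (ltnW nm).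
have SE m : (n < m)%N -> `|S m (S n x) - S n x| <= eps n * (Lj * `|x|).
  move=> nm; apply: le_trans (C1 (J x) nm) _.
  by apply: ler_pM => //; exact: eps_le (ltnW nm).
have s1 := SS n.+1 (ltnSn n); have s2 := SS n.+2 (leqW (ltnSn n)).
have t1 := SE n.+1 (ltnSn n); have t2 := SE n.+2 (leqW (ltnSn n)).
rewrite -/y.
have -> : E n (S n.+2 y - S n.+1 y) - (S n.+2 x - S n.+1 x) =
  (S n.+1 (S n x) - S n x) - (S n.+2 (S n x) - S n x) -
  ((S n (S n.+2 y) - S n y) - (S n (S n.+1 y) - S n y)).
  rewrite {1}/E (linmapB (Sl n)).
  rewrite [in X in X - _ - _](_ : S n.+2 y = S n.+2 x - S n.+2 (S n x)); last by rewrite -(linmapB (Sl _)).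
  rewrite [in X in X - _ - _](_ : S n.+1 y = S n.+1 x - S n.+1 (S n x)); last by rewrite -(linmapB (Sl _)).
  by abel.
apply: le_trans (ler_normB _ _) _.
apply: le_trans (lerD (ler_normB _ _) (ler_normB _ _)) _.
have -> : c3 * eps n * `|x| = eps n * (Lj * `|x|) + eps n * (Lj * `|x|) +
   (Lam * (eps n * ((1 + sig) * `|x|)) + Lam * (eps n * ((1 + sig) * `|x|))).
  by rewrite /c3; ring.
by rewrite !lerD.
Qed.

Let total_defect q x : `|\sum_(n < q) B n (J (A n x)) - S q x| <= c3 * (2 * e0) * `|x| + (if q is 0 then `|S 0 x| else 0).
Proof.
have c30 : 0 <= c3 by rewrite addr_ge0 ?mulr_ge0 // addr_ge0.
case: q => [|q]; first by rewrite big_ord0 sub0r normrN lerDr !mulr_ge0.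
rewrite addr0.
have -> : \sum_(n < q.+1) B n (J (A n x)) - S q.+1 x =
  \sum_(n < q) (E n (S n.+2 (E n x) - S n.+1 (E n x)) - (S n.+2 x - S n.+1 x)).
  rewrite [RHS]sumrB big_ord_recl.
  have := telescope_sumr (fun n => S n.+1 x) (leq0n q); rewrite big_mkord => ->.
  have -> : \sum_(n < q) B (lift ord0 n) (J (A (lift ord0 n) x)) =
      \sum_(n < q) E n (S n.+2 (E n x) - S n.+1 (E n x)).
    by apply: eq_bigr => n _; rewrite lift0.
  rewrite -[B ord0 _]/(S 1 x); by abel.
apply: le_trans (ler_norm_sum _ _ _) _.
apply: le_trans (ler_sum _ (fun (n : 'I_q) _ => defect n x)) _.
rewrite -mulr_suml; apply: ler_wpM2r => //; rewrite -mulr_sumr; apply: ler_wpM2l => //.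
exact: eps_sum.
Qed.

(** Summing the blocks along the rows of [J1 x] gives the limit of [S q x], which is [x], up to the
    total defect, at most [|x| / 2]; a Neumann series corrects the rest. *)
Lemma complemented_in_c0 : exists (J1 : X -> c0 R) (Q1 : c0 R -> X) (C : R),
  [/\ linmap J1, linmap Q1, forall x, `|J1 x| <= C * `|x|, forall a, `|Q1 a| <= C * `|a| &
      cancel J1 Q1].
Proof.
have [pr [pi [prK piK]]] := nat_pairing.
pose rw : nat -> c0 R -> c0 R := row pi.
have Qex (w : c0 R) : exists l, conv (fun q => \sum_(n < q) B n (rw n w)) l.
  apply: (null_series_conv (w := rw^~ w) Xc CB0 _ B_sum); last exact: row_null.
  by move=> n; exact: linmap0.
have [Q0 hQ0] := choice Qex.
have Q0l : linmap Q0.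
  move=> a x y; apply: conv_uniq (hQ0 _) _.
  have h := conv_lin a (hQ0 x) (hQ0 y).
  suff -> : (fun q => \sum_(n < q) B n (rw n (a *: x + y))) =
    (fun q => a *: \sum_(n < q) B n (rw n x) + \sum_(n < q) B n (rw n y)) by [].
  apply/funext => q.
  rewrite scaler_sumr -big_split /=; apply: eq_bigr => n _.
  by rewrite /rw (row_lin piK) Bl.
have Q0n w : `|Q0 w| <= CB * `|w|.
  apply: (conv_bound (hQ0 w)) => q; apply: (@B_sum q (fun n => rw n w)) => n.
  exact: row_norm.
pose rJ x n := J (A n x).
have rJn x : rnull (rJ x).
  move=> e ee; have L1 : 0 < Lj + 1 by rewrite ltr_wpDl.
  have [M hM] := C3 x (divr_gt0 ee L1); exists M.+1 => -[//|n] Mn.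
  rewrite /rJ /=; apply: le_trans (JL _) _; rewrite /E distrC.
  apply: le_trans (ler_wpM2l Lj0 (hM n Mn)) _.
  by rewrite mulrA ler_pdivrMr // mulrC ler_wpM2l ?(ltW ee) // lerDl.
pose J1 x := glue pr (rJ x).
have J1l : linmap J1.
  move=> a x y; apply: (row_ext prK piK) => n; rewrite (row_lin piK) !(row_glue prK piK) //.
  by rewrite /rJ Al Jl.
have J1n x : `|J1 x| <= Lj * (1 + sig) * `|x|.
  apply: (glue_norm prK) => // n; apply: le_trans (JL _) _.
  by rewrite -mulrA ler_wpM2l.
pose T x := Q0 (J1 x).
have Tl : linmap T by move=> a x y; rewrite /T J1l Q0l.
have Ts x : `|T x - x| <= 2^-1 * `|x|.
  have h1 := hQ0 (J1 x); have h2 := C3 x.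
  have h1' : conv (fun q => \sum_(n < q.+1) B n (J (A n x))) (T x).
    move=> e ee; have [M hM] := h1 e ee; exists M => n Mn.
    have := hM n.+1 (leqW Mn).
    suff -> : \sum_(k < n.+1) B k (rw k (J1 x)) = \sum_(k < n.+1) B k (J (A k x)) by [].
    by apply: eq_bigr => k _; rewrite /rw /J1 (row_glue prK piK).
  have h2' : conv (fun q => S q.+1 x) x.
    by move=> e ee; have [M hM] := h2 e ee; exists M => n Mn; exact: hM (leqW Mn).
  apply: (conv_norm_le h1' h2') => q; have := total_defect q.+1 x; rewrite addr0.
  move=> /le_trans; apply; apply: ler_wpM2r => //; by rewrite mulrCA mulrA.
have [G [Gl Gn GT TG]] := neumann Xc Tl Ts.
exists J1, (fun a => G (Q0 a)), (Lj * (1 + sig) + 2 * CB); split=> //.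
- by move=> a x y; rewrite Q0l Gl.
- move=> x; apply: le_trans (J1n x) _; rewrite ler_wpM2r // lerDl mulr_ge0 //.
- move=> a; apply: le_trans (Gn _) _; apply: le_trans (ler_wpM2l _ (Q0n a)) _ => //.
  by rewrite mulrA ler_wpM2r // lerDr mulr_ge0 // addr_ge0.
Qed.

End Blocks.

Lemma trunc_sum (R : realType) N (a : c0 R) : trunc N a = \sum_(j < N) a j *: unitv R j.
Proof.
elim: N => [|N IH]; first by rewrite trunc_at0 big_ord0.
by rewrite truncS big_ord_recr /= IH.
Qed.

Lemma trunc_lin (R : realType) N : linmap (@trunc R N).
Proof.
by move=> a x y; apply: c0_ext => i; rewrite c0DE c0ZE !truncE; case: ifP; rewrite ?mulr0 ?addr0.
Qed.

(** * Limits of matrices and truncation *)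

Section LimitMatrix.
Variables (R : realType) (X : normedModType R) (J : X -> c0 R) (Lj Lam : R) (T : nat -> c0 R -> X).
Hypotheses (Jl : linmap J) (Lj0 : 0 <= Lj) (JL : forall x, `|J x| <= Lj * `|x|)
  (Lam0 : 0 <= Lam) (Tl : forall n, linmap (T n)) (TL : forall n a, `|T n a| <= Lam * `|a|)
  (TJ : forall x, conv (fun n => T n (J x)) x).

Let mat n (p : nat * nat) : R := J (T n (unitv R p.2)) p.1.

Let mat_sum n N a i : J (T n (trunc N a)) i = \sum_(j < N) a j * mat n (i, j : nat).
Proof.
rewrite trunc_sum (linmap_sum (Tl n)) (linmap_sum Jl) c0_sumE; apply: eq_bigr => j _.
by rewrite (linmapZ (Tl n)) (linmapZ Jl) c0ZE.
Qed.

(** Tested on the signs of the row, a vector of norm at most 1. *)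
Let mat_row n N i : \sum_(j < N) `|mat n (i, j : nat)| <= Lj * Lam.
Proof.
pose a : c0 R := trunc N (c0of (fun j => if (j < N)%N then Num.sg (mat n (i, j)) else 0)).
have aE j : (j < N)%N -> a j = Num.sg (mat n (i, j)).
  move=> jN; rewrite truncE jN c0ofE ?jN //; apply: (@null_eventually0 _ _ N) => k.
  by rewrite leqNgt => /negbTE ->.
have a1 : `|a| <= 1.
  apply: c0_normP => j; have [jN|Nj] := ltnP j N.
    by rewrite aE // normr_sg; case: (_ != 0); rewrite ?lexx ?ler01.
  by rewrite truncE ltnNge Nj normr0 ler01.
have -> : \sum_(j < N) `|mat n (i, j : nat)| = J (T n (trunc N a)) i.
  by rewrite mat_sum; apply: eq_bigr => j _; rewrite aE // -normrEsg.
apply: le_trans (ler_norm _) _; apply: le_trans (c0_coord _ _) _; apply: le_trans (JL _) _.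
rewrite ler_wpM2l //; apply: le_trans (TL _ _) _; rewrite -[leRHS]mulr1 ler_wpM2l //.
exact: le_trans (trunc_norm _ _) a1.
Qed.

Let cluster : exists t : nat * nat -> R, forall (s : seq (nat * nat)) (e : R) n0, 0 < e ->
  exists2 n, (n0 <= n)%N & forall p, p \in s -> `|mat n p - t p| <= e.
Proof.
have [|t ht] := @pointwise_cluster R (nat * nat)%type (fun=> Lj * Lam) (mat @ \oo) _.
  exists 0%N => //= n _ p; apply: le_trans (mat_row n p.2.+1 p.1).
  rewrite big_ord_recr /= -surjective_pairing lerDr; exact: sumr_ge0.
exists t => s e n0 e0.
have [|f [n n0n <-] hf] := ht [set mat n | n in [set n | (n0 <= n)%N]] _ s e e0.
  by exists n0 => //= n n0n; exists n.
by exists n.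
Qed.

(** The row [i] of the limit is in [l1] and gives back coordinate [i] on the range of [J]; its small
    tail makes the error uniform in [x]. The tails of the rows of [mat n] need not be small
    uniformly in [n], so a cut must be read off the limit. *)
Lemma limit_matrix : exists t : nat * nat -> R,
  (forall (s : seq (nat * nat)) (e : R) n0, 0 < e ->
     exists2 n, (n0 <= n)%N & forall p, p \in s -> `|mat n p - t p| <= e) /\
  forall i (e : R), 0 < e -> exists N0, forall N, (N0 <= N)%N ->
     forall x, `|\sum_(j < N) J x j * t (i, j : nat) - J x i| <= e * `|x|.
Proof.
have [t ht] := cluster; exists t; split=> // i.
have near N e n0 : 0 < e -> exists2 n, (n0 <= n)%N &
    \sum_(j < N) `|mat n (i, j : nat) - t (i, j : nat)| <= e.
  move=> e0; have eN : 0 < e / N.+1%:R by rewrite divr_gt0 // ltr0n.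
  have [n n0n hn] := ht [seq (i, j) | j <- iota 0 N] _ n0 eN; exists n => //.
  apply: le_trans (_ : \sum_(j < N) e / N.+1%:R <= _).
    by apply: ler_sum => j _; apply: hn; apply: map_f; rewrite mem_iota ltn_ord.
  rewrite sumr_const card_ord -[leLHS]mulr_natl mulrA ler_pdivrMr ?ltr0n // mulrC.
  by rewrite ler_wpM2l ?(ltW e0) // ler_nat.
have t_row N : \sum_(j < N) `|t (i, j : nat)| <= Lj * Lam.
  apply/ler_addgt0Pr => e e0; have [n _ hn] := near N e 0%N e0.
  apply: le_trans (lerD (mat_row n N i) hn); rewrite -big_split /=.
  apply: ler_sum => j _; rewrite -[X in `|X| <= _](subrK (mat n (i, j : nat))) addrC.
  by apply: le_trans (ler_normD _ _) _; rewrite [X in X + _ <= _]distrC.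
pose St N := \sum_(j < N) `|t (i, j : nat)|.
have St_le m n : (m <= n)%N -> St m <= St n.
  move=> mn; rewrite /St -!(big_mkord xpredT (fun j => `|t (i, j)|)) (big_cat_nat _ mn) //=.
  by rewrite lerDl; exact: sumr_ge0.
have t_tail e : 0 < e -> exists N0, forall N N', (N0 <= N)%N -> (N <= N')%N -> St N' - St N <= e.
  move=> e0; have [_ [N0 _ <-] h] : exists2 y, range St y & sup (range St) - e < y.
    apply: sup_adherent => //; split; first by exists (St 0%N), 0%N.
    by exists (Lj * Lam) => _ [n _ <-]; exact: t_row.
  exists N0 => N N' h1 h2; have := St_le _ _ h1.
  have : St N' <= sup (range St).
    apply: ub_le_sup; last by exists N'.
    by exists (Lj * Lam) => _ [n _ <-]; exact: t_row.
  lra.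
have t_id x e : 0 < e -> exists N0, forall N, (N0 <= N)%N ->
    `|\sum_(j < N) J x j * t (i, j : nat) - J x i| <= e.
  move=> e0.
  have LL : 0 < Lj * Lam + 1 by rewrite ltr_wpDl // mulr_ge0.
  have Jx : 0 < `|J x| + 1 by rewrite ltr_wpDl.
  have L1 : 0 < Lj + 1 by rewrite ltr_wpDl.
  have e3 : 0 < e / 3 by rewrite divr_gt0.
  have [N0 hN0] := trunc_cvg (J x) (divr_gt0 e3 LL); exists N0 => N /hN0 hN.
  have [n0 hn0] := TJ x (divr_gt0 e3 L1).
  have [n n0n hn] := near N _ n0 (divr_gt0 e3 Jx).
  have h1 : `|\sum_(j < N) J x j * t (i, j : nat) - \sum_(j < N) J x j * mat n (i, j : nat)| <= e / 3.
    rewrite -sumrB; apply: le_trans (ler_norm_sum _ _ _) _.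
    apply: le_trans (_ : (`|J x| + 1) * (e / 3 / (`|J x| + 1)) <= _); last first.
      by rewrite mulrC divfK // gt_eqF.
    apply: le_trans (ler_wpM2l (ltW Jx) hn); rewrite mulr_sumr; apply: ler_sum => j _.
    rewrite -mulrBr normrM distrC ler_wpM2r //.
    by apply: le_trans (c0_coord (J x) j) _; rewrite lerDl.
  have h2 : `|J (T n (trunc N (J x))) i - J (T n (J x)) i| <= e / 3.
    rewrite -c0BE -(linmapB Jl) -(linmapB (Tl n)); apply: le_trans (c0_coord _ _) _.
    apply: le_trans (JL _) _; apply: le_trans (ler_wpM2l Lj0 (TL _ _)) _.
    rewrite distrC mulrA; apply: le_trans (_ : (Lj * Lam + 1) * (e / 3 / (Lj * Lam + 1)) <= _).
      by apply: ler_pM => //; [rewrite mulr_ge0|rewrite lerDl].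
    by rewrite mulrC divfK // gt_eqF.
  have h3 : `|J (T n (J x)) i - J x i| <= e / 3.
    rewrite -c0BE -(linmapB Jl); apply: le_trans (c0_coord _ _) _; apply: le_trans (JL _) _.
    apply: le_trans (_ : (Lj + 1) * (e / 3 / (Lj + 1)) <= _).
      by apply: ler_pM => //; [rewrite lerDl|exact: hn0].
    by rewrite mulrC divfK // gt_eqF.
  rewrite -mat_sum in h1.
  set a := \sum_(j < N) _ in h1 *; set b := J (T n (trunc N (J x))) i in h1 h2.
  have -> : a - J x i = (a - b) + (b - J (T n (J x)) i) + (J (T n (J x)) i - J x i) by ring.
  apply: le_trans (ler_normD _ _) _; apply: le_trans (lerD (ler_normD _ _) (lexx _)) _.
  lra.
move=> e e0; have L1 : 0 < Lj + 1 by rewrite ltr_wpDl.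
have [N0 hN0] := t_tail _ (divr_gt0 e0 L1); exists N0 => N NN x.
apply/ler_addgt0Pr => e' e'0; have [N1 hN1] := t_id x e' e'0.
pose N' := maxn N N1; have h1 := hN1 N' (leq_maxr _ _).
have h2 := hN0 N N' NN (leq_maxl _ _).
have h3 : `|\sum_(j < N') J x j * t (i, j : nat) - \sum_(j < N) J x j * t (i, j : nat)| <= e * `|x|.
  have NN' : (N <= N')%N := leq_maxl _ _.
  rewrite -!(big_mkord xpredT (fun j => J x j * t (i, j))) (big_cat_nat _ NN') //= addrAC subrr add0r.
  apply: le_trans (ler_norm_sum _ _ _) _.
  apply: le_trans (_ : `|J x| * (St N' - St N) <= _).
    have -> : St N' - St N = \sum_(N <= j < N') `|t (i, j)|.
      rewrite /St -!(big_mkord xpredT (fun j => `|t (i, j)|)).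
      by rewrite (big_cat_nat _ NN') //= addrAC subrr add0r.
    rewrite mulr_sumr; apply: ler_sum => j _; rewrite normrM ler_wpM2r //; exact: c0_coord.
  apply: le_trans (ler_wpM2l (normr_ge0 _) h2) _.
  apply: le_trans (ler_wpM2r _ (JL x)) _; first by rewrite divr_ge0 // ltW.
  rewrite [leRHS]mulrC mulrA ler_pdivrMr // -!mulrA mulrCA ler_wpM2l //.
  by rewrite mulrC ler_wpM2l ?(ltW e0) // lerDl.
set a := \sum_(j < N) _ in h3 *; set b := \sum_(j < N') _ in h1 h3.
have -> : a - J x i = (b - J x i) - (b - a) by ring.
by apply: le_trans (ler_normB _ _) _; rewrite addrC; exact: lerD.
Qed.

(** [N] is fixed first, from the limit matrix, and then [n], late enough for [Y] and with [mat n]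
    close to the limit on the finite box of rows below [I] and columns below [N]. *)
Lemma truncation_step (Y : seq X) (I n0 : nat) (e : R) : 0 < e -> exists N n : nat, [/\ (n0 <= N)%N,
  forall y, y \in Y -> `|T n (trunc N (J y)) - y| <= e,
  forall i x, (i < I)%N -> `|J (T n (trunc N (J x))) i - J x i| <= e * `|x| &
  forall i y, y \in Y -> (N <= i)%N -> `|J y i| <= e].
Proof.
move=> e0; have [t [ht tu]] := limit_matrix.
have e2 : 0 < e / 2 by rewrite divr_gt0.
have LL : 0 < Lam + 1 by rewrite ltr_wpDl.
have L1 : 0 < Lj + 1 by rewrite ltr_wpDl.
have [N1 hN1] : exists N1, forall N, (N1 <= N)%N -> forall y, y \in Y ->
    `|J y - trunc N (J y)| <= Num.min e (e / 2 / (Lam + 1)).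
  have e3 : 0 < Num.min e (e / 2 / (Lam + 1)) by rewrite lt_min e0 divr_gt0.
  elim: Y => [|y Y [N1 h]]; first by exists 0%N.
  have [N2 h2] := trunc_cvg (J y) e3; exists (maxn N1 N2) => N.
  rewrite geq_max => /andP[a b] z; rewrite inE => /orP[/eqP ->|zY]; first exact: h2.
  exact: h.
have [N2 hN2] : exists N2, forall N, (N2 <= N)%N -> forall i, (i < I)%N -> forall x,
    `|\sum_(j < N) J x j * t (i, j : nat) - J x i| <= e / 2 * `|x|.
  elim: I => [|I [N2 h]]; first by exists 0%N.
  have [N3 h3] := tu I _ e2; exists (maxn N2 N3) => N.
  rewrite geq_max => /andP[a b] i; rewrite ltnS leq_eqVlt => /orP[/eqP -> x|iI]; first exact: h3.
  exact: h.
pose N := maxn n0 (maxn N1 N2).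
have Nn0 : (n0 <= N)%N by exact: leq_maxl.
have NN1 : (N1 <= N)%N by rewrite /N; lia.
have NN2 : (N2 <= N)%N by rewrite /N; lia.
have [n1 hn1] : exists n1, forall n, (n1 <= n)%N -> forall y, y \in Y -> `|T n (J y) - y| <= e / 2.
  elim: Y {hN1} => [|y Y [n1 h]]; first by exists 0%N.
  have [n2 h2] := TJ y e2; exists (maxn n1 n2) => n.
  rewrite geq_max => /andP[a b] z; rewrite inE => /orP[/eqP ->|zY]; first exact: h2.
  exact: h.
have eN : 0 < e / 2 / ((Lj + 1) * N.+1%:R) by rewrite divr_gt0 // mulr_gt0 // ltr0n.
have [n n1n hn] := ht [seq (i, j) | i <- iota 0 I, j <- iota 0 N] _ n1 eN.
exists N, n; split=> //.
- move=> y yY.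
  have -> : T n (trunc N (J y)) - y = (T n (J y) - y) - T n (J y - trunc N (J y)).
    by rewrite (linmapB (Tl n)); abel.
  apply: le_trans (ler_normB _ _) _.
  have h1 := hn1 n n1n y yY.
  have h2 : `|T n (J y - trunc N (J y))| <= e / 2.
    apply: le_trans (TL _ _) _; apply: le_trans (_ : (Lam + 1) * (e / 2 / (Lam + 1)) <= _).
      apply: ler_pM => //; first by rewrite lerDl.
      by apply: le_trans (hN1 N NN1 y yY) _; rewrite ge_min lexx orbT.
    by rewrite mulrC divfK // gt_eqF.
  lra.
- move=> i x iI.
  have -> : J (T n (trunc N (J x))) i - J x i =
    (\sum_(j < N) J x j * t (i, j : nat) - J x i) +
    \sum_(j < N) J x j * (mat n (i, j : nat) - t (i, j : nat)).
    rewrite mat_sum; under [X in _ = _ + X]eq_bigr do rewrite mulrBr.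
    by rewrite sumrB; ring.
  apply: le_trans (ler_normD _ _) _; rewrite [X in X * _](splitr e) mulrDl; apply: lerD.
    exact: hN2.
  apply: le_trans (ler_norm_sum _ _ _) _.
  apply: le_trans (_ : \sum_(j < N) (Lj * `|x|) * (e / 2 / ((Lj + 1) * N.+1%:R)) <= _).
    apply: ler_sum => j _; rewrite normrM; apply: ler_pM => //.
      exact: le_trans (c0_coord _ _) (JL _).
    by apply: hn; apply: allpairs_f; rewrite mem_iota ?ltn_ord.
  rewrite sumr_const card_ord -[leLHS]mulr_natl.
  have Np : (0 : R) < N.+1%:R by rewrite ltr0n.
  have -> : e / 2 * `|x| = (N.+1%:R * ((Lj + 1) * `|x|)) * (e / 2 / ((Lj + 1) * N.+1%:R)).
    by move: Np; move: (N.+1%:R : R) => M M0; field; rewrite !gt_eqF.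
  rewrite mulrA ler_wpM2r ?(ltW eN) //; apply: ler_pM => //; rewrite ?mulr_ge0 ?ler_nat //.
  by rewrite ler_wpM2r // lerDl.
- move=> i y yY Ni; have := c0_coord (J y - trunc N (J y)) i.
  rewrite c0BE truncE ltnNge Ni subr0 => /le_trans; apply.
  by apply: le_trans (hN1 N NN1 y yY) _; rewrite ge_min lexx.
Qed.

End LimitMatrix.

Section Factorization.
Variables (R : realType) (X : normedModType R) (J : X -> c0 R) (Lj K lam : R)
  (Phi : c0 R -> X) (d : nat -> X).
Hypotheses (Xc : @seq_complete R X) (Jl : linmap J) (Lj0 : 0 <= Lj) (K0 : 0 <= K)
  (JL : forall x, `|J x| <= Lj * `|x|) (JK : forall x, `|x| <= K * `|J x|)
  (lam0 : 0 < lam) (Phil : lip lam Phi) (PhiJ : cancel J Phi)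
  (d_dense : forall x (e : R), 0 < e -> exists i, `|x - d i| <= e).

Lemma conv_of_dense (Lam : R) (S : nat -> X -> X) (eps : nat -> R) :
  0 <= Lam -> (forall n, linmap (S n)) -> (forall n x, `|S n x| <= Lam * `|x|) ->
  (forall n i, (i < n)%N -> `|S n (d i) - d i| <= eps n) ->
  (forall e : R, 0 < e -> exists N, forall n, (N <= n)%N -> eps n <= e) ->
  forall x, conv (fun n => S n x) x.
Proof.
move=> Lam0 Sl SL Sd eps0 x e e0.
have L1 : 0 < Lam + 1 by rewrite ltr_wpDl.
have e2 : 0 < e / 2 by rewrite divr_gt0.
have [i hi] := d_dense x (divr_gt0 e2 L1); have [N hN] := eps0 _ e2.
exists (maxn i.+1 N) => n; rewrite geq_max => /andP[ni nN].
have -> : S n x - x = S n (x - d i) + (S n (d i) - d i) - (x - d i).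
  by rewrite (linmapB (Sl n)); abel.
apply: le_trans (ler_normB _ _) _; apply: le_trans (lerD (ler_normD _ _) (lexx _)) _.
have h1 := le_trans (Sd n i ni) (hN n nN).
have h2 := SL n (x - d i).
have h3 : (Lam + 1) * `|x - d i| <= e / 2 by rewrite mulrC -ler_pdivlMr.
lra.
Qed.

Lemma finite_rank_operators : exists T : nat -> c0 R -> X,
  [/\ forall n, linmap (T n), forall n a, `|T n a| <= (lam + 1) * `|a| &
      forall x, conv (fun n => T n (J x)) x].
Proof.
have half_gt0 n : 0 < 2^-1 ^+ n :> R by rewrite exprn_gt0 // invr_gt0.
have ex n : exists p : nat * (nat -> X),
    (forall a : c0 R, `|\sum_(j < p.1) a j *: p.2 j| <= (lam + 1) * `|a|) /\
    forall f, f \in mkseq d n -> `|\sum_(j < p.1) (J f) j *: p.2 j - f| <= 2^-1 ^+ n.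
  have [M [b [h1 h2]]] := linearize Jl lam0 Phil PhiJ (mkseq d n) (half_gt0 n).
  by exists (M, b).
have [p hp] := choice ex.
pose T n (a : c0 R) := \sum_(j < (p n).1) a j *: (p n).2 j.
have Tl n : linmap (T n).
  move=> a x y; rewrite /T scaler_sumr -big_split /=; apply: eq_bigr => j _.
  by rewrite scalerA -scalerDl.
have TL n a : `|T n a| <= (lam + 1) * `|a| by case: (hp n) => h _; exact: h.
have l1 : 0 <= lam + 1 by rewrite addr_ge0 // ltW.
exists T; split=> //.
apply: (@conv_of_dense ((lam + 1) * Lj) (fun n x => T n (J x)) (fun n => 2^-1 ^+ n)).
- exact: mulr_ge0.
- by move=> n a x y; rewrite Jl Tl.
- by move=> n x; apply: le_trans (TL _ _) _; rewrite -mulrA ler_wpM2l.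
- move=> n i ni; case: (hp n) => _; apply; apply/mapP; exists i => //; by rewrite mem_iota.
- by move=> e e0; exact: exists_half_lt.
Qed.

Lemma complemented : exists (J1 : X -> c0 R) (Q1 : c0 R -> X) (C : R),
  [/\ linmap J1, linmap Q1, forall x, `|J1 x| <= C * `|x|, forall a, `|Q1 a| <= C * `|a| &
      cancel J1 Q1].
Proof.
have [T [Tl TL TJ]] := finite_rank_operators.
set Lam := lam + 1 in TL; have Lam0 : 0 <= Lam by rewrite addr_ge0 // ltW.
pose c3 := 2 * Lj + 2 * Lam * (1 + Lam * Lj).
have c30 : 0 <= c3 by rewrite addr_ge0 ?mulr_ge0 // addr_ge0 // mulr_ge0.
have c31 : 0 < 4 * (c3 + 1) by lra.
(* This makes the total defect [2 * c3 * e0] at most [1 / 2]. *)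
pose e0 : R := (4 * (c3 + 1))^-1; have e00 : 0 < e0 by rewrite invr_gt0.
pose eps n := e0 * 2^-1 ^+ n.
have eps0 n : 0 < eps n by rewrite mulr_gt0 // exprn_gt0 // invr_gt0.
pose tau (p : nat * nat) (a : c0 R) := T p.2 (trunc p.1 a).
have taul p : linmap (tau p) by move=> a x y; rewrite /tau trunc_lin Tl.
have tauL p a : `|tau p a| <= Lam * `|a|.
  by apply: le_trans (TL _ _) _; rewrite ler_wpM2l // trunc_norm.
have tau_sum p a : tau p a = \sum_(j < p.1) a j *: T p.2 (unitv R j).
  rewrite /tau trunc_sum (linmap_sum (Tl _)); apply: eq_bigr => j _.
  by rewrite (linmapZ (Tl _)).
pose P (s : seq (nat * nat)) (p : nat * nat) := [/\
  forall m a, m \in s -> `|tau p (J (tau m a)) - tau m a| <= eps (size s) * `|a|,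
  forall m i x, m \in s -> (i < m.1)%N -> `|J (tau p (J x)) i - J x i| <= eps (size s) * `|x|,
  forall k, (k < size s)%N -> `|tau p (J (d k)) - d k| <= eps (size s),
  forall m i a, m \in s -> (p.1 <= i)%N -> `|J (tau m a) i| <= eps (size s) * `|a| &
  forall m, m \in s -> (m.1 <= p.1)%N].
have [s|f hf] := @dependent_choice_history (nat * nat)%type P.
  pose I := foldr maxn 0%N (map fst s).
  have sI m : m \in s -> (m.1 <= I)%N.
    rewrite /I; elim: (s) => //= a r IH; rewrite inE => /orP[/eqP ->|/IH h]; first exact: leq_maxl.
    exact: leq_trans h (leq_maxr _ _).
  pose Y := flatten [seq [seq T m.2 (unitv R j) | j <- iota 0 m.1] | m <- s] ++ mkseq d (size s).
  have YT (m : nat * nat) j : m \in s -> (j < m.1)%N -> T m.2 (unitv R j) \in Y.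
    move=> ms jm; rewrite mem_cat; apply/orP; left; apply/flattenP.
    exists [seq T m.2 (unitv R j) | j <- iota 0 m.1]; first by apply/mapP; exists m.
    by apply/mapP; exists j => //; rewrite mem_iota.
  have Yd k : (k < size s)%N -> d k \in Y.
    by move=> ks; rewrite mem_cat; apply/orP; right; apply/mapP; exists k => //; rewrite mem_iota.
  have I0 : (0 : R) < I.+1%:R by rewrite ltr0n.
  (* An element of such a range is a combination of at most [I] of these images with coefficients
     bounded by [|a|], whence the division. *)
  pose e := eps (size s) / I.+1%:R; have ee : 0 < e by rewrite divr_gt0.
  have e_le : e <= eps (size s).
    by rewrite ler_pdivrMr // ler_peMr ?(ltW (eps0 _)) // ler1n.
  have sum_le (m : nat * nat) (a : c0 R) (F : nat -> R) : m \in s -> (forall j, (j < m.1)%N -> F j <= e) ->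
      \sum_(j < m.1) `|a j| * F j <= eps (size s) * `|a|.
    move=> ms Fe; apply: le_trans (_ : \sum_(j < m.1) `|a| * e <= _).
      apply: ler_sum => j _; apply: le_trans (ler_wpM2l (normr_ge0 _) (Fe j (ltn_ord j))) _.
      by rewrite ler_wpM2r ?(ltW ee) //; exact: c0_coord.
    rewrite sumr_const card_ord -[leLHS]mulr_natl mulrCA [leRHS]mulrC ler_wpM2l //.
    rewrite /e mulrCA ler_piMr ?(ltW (eps0 _)) // ler_pdivrMr // mul1r ler_nat.
    exact: leqW (sI m ms).
  have [N [n [n0N hY hI hT]]] := truncation_step Jl Lj0 JL Lam0 Tl TL TJ Y I I ee.
  exists (N, n); split.
  - move=> m a ms; rewrite (tau_sum m) (linmap_sum Jl) (linmap_sum (taul _)) -sumrB.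
    apply: le_trans (ler_norm_sum _ _ _) _.
    apply: le_trans (sum_le m a (fun j => `|tau (N, n) (J (T m.2 (unitv R j))) - T m.2 (unitv R j)|) ms _).
      apply: ler_sum => j _.
      by rewrite (linmapZ Jl) (linmapZ (taul _)) -scalerBr normrZ.
    by move=> j jm; apply: hY; exact: YT.
  - move=> m i x ms im; apply: le_trans (hI i x (leq_trans im (sI m ms))) _.
    by rewrite ler_wpM2r.
  - by move=> k ks; apply: le_trans (hY _ (Yd k ks)) e_le.
  - move=> m i a ms Ni; rewrite (tau_sum m) (linmap_sum Jl) c0_sumE.
    apply: le_trans (ler_norm_sum _ _ _) _.
    apply: le_trans (sum_le m a (fun j => `|J (T m.2 (unitv R j)) i|) ms _).
      by apply: ler_sum => j _; rewrite (linmapZ Jl) c0ZE normrM.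
    by move=> j jm; apply: hT => //; exact: YT.
  - by move=> m ms; exact: leq_trans (sI m ms) n0N.
have hm m n : (m < n)%N -> f m \in mkseq f n.
  by move=> mn; apply/mapP; exists m => //; rewrite mem_iota.
have epsE n : eps (size (mkseq f n)) = eps n by rewrite size_mkseq.
apply: (@complemented_in_c0 R X J Lj K Lam e0 (fun n => tau (f n)) (fun n => (f n).1)) => //.
- move=> n a e ee h; apply: le_trans (TL _ _) _; rewrite ler_wpM2l //.
  apply: c0_normP => i; rewrite truncE; case: ifP => [/h //|_]; by rewrite normr0.
- exact: ltW.
- move=> m n a mn; have [h _ _ _ _] := hf n; rewrite epsE in h; exact: h (hm _ _ mn).
- move=> m n i x mn iN; have [_ h _ _ _] := hf n; rewrite epsE in h; exact: h (hm _ _ mn) iN.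
- apply: (@conv_of_dense (Lam * Lj) (fun n x => tau (f n) (J x)) eps).
  + exact: mulr_ge0.
  + by move=> n a x y; rewrite Jl taul.
  + by move=> n x; apply: le_trans (tauL _ _) _; rewrite -mulrA ler_wpM2l.
  + move=> n i ni; have [_ _ h _ _] := hf n; rewrite epsE in h; apply: h; by rewrite size_mkseq.
  + move=> e ee; have [N hN] := exists_half_lt (divr_gt0 ee e00); exists N => n Nn.
    by rewrite /eps mulrC -ler_pdivlMr //; exact: hN.
- move=> m n i a mn iN; have [_ _ _ h _] := hf n; rewrite epsE in h; exact: h (hm _ _ mn) iN.
- move=> m n mn; have [_ _ _ _ h] := hf n; exact: h (hm _ _ mn).
- by rewrite -/c3 /e0 ler_pdivrMr //; lra.
Qed.

End Factorization.

(** * A complemented copy of [c0] inside [X] *)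

Section GlidingHump.
Variables (R : realType) (X : normedModType R) (U : X -> c0 R) (V : c0 R -> X) (L : R)
  (J : X -> c0 R) (Lj K : R).
Hypotheses (Xc : @seq_complete R X) (c0c : @seq_complete R (c0 R))
  (VK : cancel V U) (L0 : 0 < L)
  (UL : forall x y, `|U x - U y| <= L * `|x - y|)
  (VL : forall x y, `|V x - V y| <= L * `|x - y|)
  (Jl : linmap J) (Lj0 : 0 <= Lj) (K0 : 0 < K)
  (JL : forall x, `|J x| <= Lj * `|x|) (JK : forall x, `|x| <= K * `|J x|).

(** The points [V (unitv R n)] are separated by [1 / L] because [U] is Lipschitz, while their images
    under [J] cluster coordinatewise; [x] is a difference of two of them. *)
Lemma almost_kernel (M : nat) (e : R) : 0 < e ->
  exists x, L^-1 <= `|x| /\ forall i, (i < M)%N -> `|J x i| <= e.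
Proof.
move=> e0; pose g n i := J (V (unitv R n)) i.
have [|t ht] := @pointwise_cluster R nat (fun=> Lj * (`|V 0| + L)) (g @ \oo) _.
  exists 0%N => //= n _ i; apply: le_trans (c0_coord _ _) _; apply: le_trans (JL _) _.
  rewrite ler_wpM2l //; have := ler_normD (V 0) (V (unitv R n) - V 0).
  rewrite addrC subrK => /le_trans; apply; rewrite lerD2l; apply: le_trans (VL _ _) _.
  by rewrite subr0 ler_piMr ?(ltW L0) // unitv_norm.
have e2 : 0 < e / 2 by rewrite divr_gt0.
have pick n0 : exists2 n, (n0 <= n)%N & forall i, (i < M)%N -> `|g n i - t i| <= e / 2.
  have [|_ [n n0n <-] hn] := ht [set g n | n in [set n | (n0 <= n)%N]] _ (iota 0 M) _ e2.
    by exists n0 => //= n n0n; exists n.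
  by exists n => // i iM; apply: hn; rewrite mem_iota.
have [n _ hn] := pick 0%N; have [m nm hm] := pick n.+1.
exists (V (unitv R m) - V (unitv R n)); split.
  rewrite -div1r ler_pdivrMr // mulrC; have := UL (V (unitv R m)) (V (unitv R n)).
  rewrite !VK => /(le_trans _); apply.
  have := c0_coord (unitv R m - unitv R n) m; rewrite c0BE !unitvE eqxx.
  by rewrite (_ : (m == n) = false) ?subr0 ?normr1 //; lia.
move=> i iM; rewrite (linmapB Jl) c0BE -/(g m i) -/(g n i).
have -> : g m i - g n i = (g m i - t i) - (g n i - t i) by ring.
by apply: le_trans (ler_normB _ _) _; have := hn i iM; have := hm i iM; lra.
Qed.

Lemma hump (M : nat) (e : R) : 0 < e -> exists (y : X) (i : nat),
  [/\ (M <= i)%N, J y i = 1, `|J y| <= 2 & forall k, (k < M)%N -> `|J y k| <= e].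
Proof.
move=> e0; pose kap := (L * K)^-1; have kap0 : 0 < kap by rewrite invr_gt0 mulr_gt0.
(* [kap] bounds [|J x|] from below. The bound [kap / 4] forces a coordinate of at least half the
   norm to have index at least [M]; the other one leaves [e] after normalising it to 1. *)
pose e' := Num.min (e * kap / 2) (kap / 4).
have e'0 : 0 < e' by rewrite lt_min !divr_gt0 // mulr_gt0.
have [x [xn xM]] := almost_kernel M e'0.
have Jx : kap <= `|J x|.
  have := le_trans xn (JK x); rewrite mulrC -ler_pdivrMr // => /(le_trans _); apply.
  by rewrite /kap invfM.
have [i hi] : exists i, `|J x| / 2 <= `|J x i|.
  apply: contrapT => /forallNP h; have : `|J x| <= `|J x| / 2.
    by apply: c0_normP => i; have := h i; move/negP; rewrite -ltNge => /ltW.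
  lra.
have ni : kap / 2 <= `|J x i| by lra.
have nz : J x i != 0 by rewrite -normr_gt0; lra.
have Mi : (M <= i)%N.
  rewrite leqNgt; apply/negP => /xM h; have : e' <= kap / 4 by rewrite ge_min lexx orbT.
  lra.
have n0 : 0 < `|J x i| by rewrite normr_gt0.
exists ((J x i)^-1 *: x), i; split=> //.
- by rewrite (linmapZ Jl) c0ZE mulVf.
- rewrite (linmapZ Jl) normrZ normfV mulrC ler_pdivrMr //; lra.
- move=> k kM; rewrite (linmapZ Jl) c0ZE normrM normfV mulrC ler_pdivrMr //.
  apply: le_trans (xM k kM) _; apply: le_trans (_ : e * kap / 2 <= _).
    by rewrite ge_min lexx.
  by rewrite -mulrA ler_wpM2l // ltW.
Qed.

Lemma contains_complemented_c0 : exists (J2 : c0 R -> X) (Q2 : X -> c0 R) (C : R),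
  [/\ linmap J2, linmap Q2, forall a, `|J2 a| <= C * `|a|, forall x, `|Q2 x| <= C * `|x| &
      cancel J2 Q2].
Proof.
(* Off-diagonal entries in a row of [Q o J2] sum to at most [2 * e0 = 1 / 2], so [neumann]
   applies. *)
pose e0 : R := 4^-1; pose eps n : R := e0 * 2^-1 ^+ n.
have eps0 n : 0 < eps n by rewrite mulr_gt0 ?invr_gt0 // exprn_gt0 // invr_gt0.
have eps_sum n : \sum_(k < n) eps k <= 2 * e0.
  have -> : \sum_(k < n) eps k = 2 * e0 * (1 - 2^-1 ^+ n).
    elim: n => [|n IH]; first by rewrite big_ord0 expr0 subrr mulr0.
    by rewrite big_ord_recr /= IH /eps exprS; lra.
  by rewrite ler_piMr // ?gerBl ?exprn_ge0 ?invr_ge0 // mulr_ge0 // invr_ge0.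
have eps_le n : eps n.+1 <= eps n.
  by rewrite /eps exprS; have := eps0 n; rewrite /eps; lra.
pose T := (X * (nat * nat))%type.
pose P (s : seq T) (t : T) := [/\
  forall k, (k < t.2.2)%N -> `|J t.1 k| <= eps (size s),
  forall m k, m \in s -> (t.2.2 <= k)%N -> `|J m.1 k| <= eps (size s),
  forall m, m \in s -> (m.2.1 < t.2.2)%N,
  (t.2.2 <= t.2.1)%N & J t.1 t.2.1 = 1 /\ `|J t.1| <= 2].
have [s|f hf] := @dependent_choice_history T P.
  have [M hM] : exists M, forall m : T, m \in s -> (m.2.1 < M)%N /\
      forall k, (M <= k)%N -> `|J m.1 k| <= eps (size s).
    move: (eps0 (size s)); move: (eps (size s)) => e ee; elim: s => [|m s [M hM]]; first by exists 0%N.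
    have [N hN] := c0_null (J m.1) ee; exists (maxn M (maxn N m.2.1.+1)) => p.
    rewrite inE => /orP[/eqP ->|/hM[h1 h2]]; split.
    - lia.
    - by move=> k; rewrite !geq_max => /and3P[_ h _]; exact: hN.
    - exact: leq_trans h1 (leq_maxl _ _).
    - by move=> k; rewrite geq_max => /andP[h _]; exact: h2.
  have [y [i [h1 h2 h3 h4]]] := hump M (eps0 (size s)).
  exists (y, (i, M)); split=> //= m; first by move=> k /hM[_]; exact.
  by move=> /hM[].
pose y n := (f n).1; pose ix n := (f n).2.1; pose M n := (f n).2.2.
have hm m n : (m < n)%N -> f m \in mkseq f n.
  by move=> mn; apply/mapP; exists m => //; rewrite mem_iota.
have y1 n k : (k < M n)%N -> `|J (y n) k| <= eps n.
  by have [h _ _ _ _] := hf n; rewrite size_mkseq in h; exact: h.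
have y2 m n k : (m < n)%N -> (M n <= k)%N -> `|J (y m) k| <= eps n.
  move=> mn; have [_ h _ _ _] := hf n; rewrite size_mkseq in h; exact: h (hm _ _ mn).
have iM m n : (m < n)%N -> (ix m < M n)%N.
  by move=> mn; have [_ _ h _ _] := hf n; exact: h (hm _ _ mn).
have Mi n : (M n <= ix n)%N by have [] := hf n.
have yi n : J (y n) (ix n) = 1 by have [_ _ _ _ []] := hf n.
have yn n : `|J (y n)| <= 2 by have [_ _ _ _ []] := hf n.
have M_le m n : (m <= n)%N -> (M m <= M n)%N.
  rewrite leq_eqVlt => /orP[/eqP -> //|mn]; exact: ltnW (leq_ltn_trans (Mi m) (iM _ _ mn)).
have y_coord n k : `|J (y n) k| <= eps n + 2 * ((k < M n.+1)%N%:R - (k < M n)%N%:R).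
  have [h|h] := ltnP k (M n).
    by rewrite (leq_trans h (M_le _ _ (leqnSn n))) subrr mulr0 addr0 y1.
  have [h'|h'] := ltnP k (M n.+1).
    rewrite subr0 mulr1; apply: le_trans (le_trans (c0_coord _ _) (yn n)) _.
    by rewrite lerDr ltW.
  by rewrite subrr mulr0 addr0; apply: le_trans (y2 n n.+1 k (ltnSn n) h') _.
have row_sum k q : \sum_(n < q) `|J (y n) k| <= 2 * e0 + 2.
  apply: le_trans (ler_sum _ (fun (n : 'I_q) _ => y_coord n k)) _.
  rewrite big_split /=; apply: lerD; first exact: eps_sum.
  rewrite -mulr_sumr.
  have := telescope_sumr (fun n => ((k < M n)%N%:R : R)) (leq0n q); rewrite big_mkord => ->.
  rewrite -[leRHS]mulr1 ler_wpM2l //.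
  by case: (k < M q)%N; case: (k < M 0%N)%N; rewrite ?subrr ?subr0 ?sub0r ?oppr_le0 ?ler01.
pose CB := K * (2 * e0 + 2).
have CB0 : 0 <= CB by rewrite mulr_ge0 ?(ltW K0) // addr_ge0 // mulr_ge0 // invr_ge0.
have B_sum q (w : nat -> R^o) (om : R) : (forall n, `|w n| <= om) ->
    `|\sum_(n < q) (w n : R) *: y n| <= CB * om.
  move=> wom; have om0 : 0 <= om := le_trans (normr_ge0 _) (wom 0%N).
  apply: le_trans (JK _) _; rewrite -mulrA ler_wpM2l ?(ltW K0) //.
  apply: c0_normP => k; rewrite (linmap_sum Jl) c0_sumE.
  apply: le_trans (ler_norm_sum _ _ _) _; rewrite mulrC.
  apply: le_trans (ler_wpM2l om0 (row_sum k q)); rewrite mulr_sumr; apply: ler_sum => n _.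
  by rewrite (linmapZ Jl) c0ZE normrM ler_wpM2r //; exact: wom.
have Jex (a : c0 R) : exists l, conv (fun q => \sum_(n < q) a n *: y n) l.
  apply: (@null_series_conv R R^o X (fun n (r : R^o) => (r : R) *: y n) CB) => //.
    by move=> n; rewrite scale0r.
  exact: c0_null.
have [J2 hJ2] := choice Jex.
have J2l : linmap J2.
  move=> r a b; apply: conv_uniq (hJ2 _) _; have h := conv_lin r (hJ2 a) (hJ2 b).
  suff -> : (fun q => \sum_(n < q) (r *: a + b) n *: y n) =
    (fun q => r *: \sum_(n < q) a n *: y n + \sum_(n < q) b n *: y n) by [].
  apply/funext => q; rewrite scaler_sumr -big_split /=; apply: eq_bigr => n _.
  by rewrite scalerA -scalerDl.
have J2n a : `|J2 a| <= CB * `|a|.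
  by apply: (conv_bound (hJ2 a)) => q; apply: B_sum => n; exact: c0_coord.
(* The hump positions tend to infinity, so sampling [J x] there gives a null sequence. *)
have ixn n : (n <= ix n)%N.
  by elim: n => // n IH; apply: leq_ltn_trans IH _; exact: leq_trans (iM _ _ (ltnSn n)) (Mi _).
have Qnull x : null (fun n => J x (ix n)).
  move=> e ee; have [N hN] := c0_null (J x) ee; exists N => n Nn.
  exact: hN (leq_trans Nn (ixn n)).
pose Q x : c0 R := c0of (fun n => J x (ix n)).
have QE x n : Q x n = J x (ix n) by rewrite /Q c0ofE.
have Ql : linmap Q.
  by move=> r x z; apply: c0_ext => n; rewrite c0DE c0ZE !QE Jl.
have Qn x : `|Q x| <= Lj * `|x|.
  by apply: c0_normP => n; rewrite QE; exact: le_trans (c0_coord _ _) (JL _).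
pose S a := Q (J2 a).
have Sl : linmap S by move=> r a b; rewrite /S J2l Ql.
have Ss a : `|S a - a| <= 2^-1 * `|a|.
  apply: c0_normP => k; rewrite c0BE QE; apply/ler_addgt0Pr => e ee.
  have L1 : 0 < Lj + 1 by rewrite ltr_wpDl.
  have [N hN] := hJ2 a _ (divr_gt0 ee L1); pose q := maxn N k.+1.
  have h1 := hN q (leq_maxl _ _); have kq : (k < q)%N by exact: leq_maxr.
  set s := \sum_(n < q) _ in h1.
  have h2 : `|J (J2 a) (ix k) - J s (ix k)| <= e.
    rewrite -c0BE -(linmapB Jl); apply: le_trans (c0_coord _ _) _; apply: le_trans (JL _) _.
    rewrite distrC; apply: le_trans (_ : (Lj + 1) * (e / (Lj + 1)) <= _).
      by apply: ler_pM => //; rewrite lerDl.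
    by rewrite mulrC divfK // gt_eqF.
  have h3 : `|J s (ix k) - a k| <= 2^-1 * `|a|.
    rewrite /s (linmap_sum Jl) c0_sumE (bigD1 (Ordinal kq)) //= (linmapZ Jl) c0ZE yi mulr1.
    rewrite addrAC subrr add0r; apply: le_trans (ler_norm_sum _ _ _) _.
    apply: le_trans (_ : \sum_(n < q) `|a| * eps n <= _); last first.
      rewrite -mulr_sumr mulrC ler_wpM2r //; apply: le_trans (eps_sum q) _.
      by rewrite /e0; lra.
    rewrite [leRHS](bigD1 (Ordinal kq)) //= -[leLHS]add0r; apply: lerD.
      by rewrite mulr_ge0 // ltW.
    apply: ler_sum => n /eqP nk; rewrite (linmapZ Jl) c0ZE normrM; apply: ler_pM => //.
      exact: c0_coord.
    have [nk'|kn|E] := ltngtP n k.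
    - apply: le_trans (y2 n n.+1 _ (ltnSn n) _) (eps_le n).
      exact: leq_trans (M_le _ _ nk') (Mi k).
    - by apply: y1; exact: iM.
    - by case: nk; apply: val_inj.
  have -> : J (J2 a) (ix k) - a k = (J s (ix k) - a k) + (J (J2 a) (ix k) - J s (ix k)) by ring.
  by apply: le_trans (ler_normD _ _) _; exact: lerD.
have [G [Gl Gn GS SG]] := neumann c0c Sl Ss.
exists J2, (fun x => G (Q x)), (CB + 2 * Lj); split=> //.
- by move=> r x z; rewrite Ql Gl.
- by move=> a; apply: le_trans (J2n a) _; rewrite ler_wpM2r // lerDl mulr_ge0.
- move=> x; apply: le_trans (Gn _) _; apply: le_trans (ler_wpM2l _ (Qn x)) _ => //.
  by rewrite mulrA ler_wpM2r // lerDr.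
Qed.

End GlidingHump.

(** * Pelczynski decomposition *)

Section EvenOdd.
Variable R : realType.
Implicit Types a b : c0 R.

Definition evens b : c0 R := c0of (fun n => b n.*2).
Definition odds b : c0 R := c0of (fun n => b n.*2.+1).
Definition merge a b : c0 R := c0of (fun n => if odd n then b n./2 else a n./2).

Lemma evensE b n : evens b n = b n.*2.
Proof.
rewrite c0ofE // => e e0; have [N hN] := c0_null b e0; exists N => k Nk; apply: hN; lia.
Qed.

Lemma oddsE b n : odds b n = b n.*2.+1.
Proof.
rewrite c0ofE // => e e0; have [N hN] := c0_null b e0; exists N => k Nk; apply: hN; lia.
Qed.

Lemma mergeE a b n : merge a b n = if odd n then b n./2 else a n./2.
Proof.
rewrite c0ofE // => e e0; have [N hN] := c0_null a e0; have [M hM] := c0_null b e0.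
exists (maxn N M).*2 => k Nk; case: ifP => _; [apply: hM|apply: hN]; lia.
Qed.

Lemma evens_merge a b : evens (merge a b) = a.
Proof. by apply: c0_ext => n; rewrite evensE mergeE odd_double doubleK. Qed.

Lemma odds_merge a b : odds (merge a b) = b.
Proof. by apply: c0_ext => n; rewrite oddsE mergeE /= odd_double /= uphalf_double. Qed.

Lemma merge_evens_odds b : merge (evens b) (odds b) = b.
Proof.
apply: c0_ext => n; rewrite mergeE evensE oddsE -[in RHS](odd_double_half n).
by case: (odd n).
Qed.

Lemma evens_lin : linmap evens.
Proof. by move=> r x y; apply: c0_ext => n; rewrite c0DE c0ZE !evensE. Qed.

Lemma odds_lin : linmap odds.
Proof. by move=> r x y; apply: c0_ext => n; rewrite c0DE c0ZE !oddsE. Qed.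

Lemma merge_lin (r : R) a a' b b' :
  merge (r *: a + a') (r *: b + b') = r *: merge a b + merge a' b'.
Proof. by apply: c0_ext => n; rewrite c0DE c0ZE !mergeE; case: ifP. Qed.

Lemma evens_norm b : `|evens b| <= `|b|.
Proof. by apply: c0_normP => n; rewrite evensE; exact: c0_coord. Qed.

Lemma odds_norm b : `|odds b| <= `|b|.
Proof. by apply: c0_normP => n; rewrite oddsE; exact: c0_coord. Qed.

Lemma merge_norm a b : `|merge a b| <= `|a| + `|b|.
Proof.
apply: c0_normP => n; rewrite mergeE; case: ifP => _.
  by apply: le_trans (c0_coord _ _) _; rewrite lerDr.
by apply: le_trans (c0_coord _ _) _; rewrite lerDl.
Qed.
End EvenOdd.

(* Pelczynski's decomposition, made explicit: [X = X' + c0 = X' + c0 + c0 = X + c0] through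
   [evens] and [odds], and [X + c0(c0) = c0(c0)] by shifting the [X]-components of the rows. *)
Section Decomposition.
Variables (R : realType) (X : normedModType R) (J1 : X -> c0 R) (Q1 : c0 R -> X)
  (J2 : c0 R -> X) (Q2 : X -> c0 R) (C : R).
Hypotheses (C0 : 0 <= C) (J1l : linmap J1) (Q1l : linmap Q1) (J2l : linmap J2) (Q2l : linmap Q2)
  (J1n : forall x, `|J1 x| <= C * `|x|) (Q1n : forall a, `|Q1 a| <= C * `|a|)
  (J2n : forall a, `|J2 a| <= C * `|a|) (Q2n : forall x, `|Q2 x| <= C * `|x|)
  (JQ1 : cancel J1 Q1) (JQ2 : cancel J2 Q2).
Variables (pr : nat -> nat * nat) (pi : nat * nat -> nat).
Hypotheses (prK : cancel pr pi) (piK : cancel pi pr).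
Notation rw := (@row R pi).

Let P a := J1 (Q1 a).
Let Pc a := a - P a.
Let Pl : linmap P. Proof. by move=> r x y; rewrite /P Q1l J1l. Qed.
Let Pcl : linmap Pc. Proof. by move=> r x y; rewrite /Pc Pl scalerBr; abel. Qed.
Let PJ x : P (J1 x) = J1 x. Proof. by rewrite /P JQ1. Qed.
Let PP a : P (P a) = P a. Proof. exact: PJ. Qed.
Let PPc a : P (Pc a) = 0. Proof. by rewrite (linmapB Pl) PP subrr. Qed.
Let PcP a : Pc (P a) = 0. Proof. by rewrite /Pc PP subrr. Qed.
Let PcJ x : Pc (J1 x) = 0. Proof. by rewrite /Pc PJ subrr. Qed.
Let PcPc a : Pc (Pc a) = Pc a. Proof. by rewrite {1}/Pc PPc subr0. Qed.
Let Q1Pc a : Q1 (Pc a) = 0. Proof. by rewrite (linmapB Q1l) JQ1 subrr. Qed.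

Let Pn a : `|P a| <= C * C * `|a|.
Proof. by apply: le_trans (J1n _) _; rewrite -mulrA ler_wpM2l. Qed.
Let Pcn a : `|Pc a| <= (1 + C * C) * `|a|.
Proof. by apply: le_trans (ler_normB _ _) _; rewrite mulrDl mul1r lerD2l. Qed.

Let fwd_row x w n := (if n is k.+1 then P (rw k w) else J1 x) + Pc (rw n w).
Let bwd_row (w : c0 R) n := P (rw n.+1 w) + Pc (rw n w).

Let Cr := C + (1 + C * C + C * C).
Let CC : 0 <= C * C. Proof. exact: mulr_ge0. Qed.
Let Cr0 : 0 <= Cr. Proof. by move: C0 CC; rewrite /Cr; lra. Qed.

Let fwd_norm x w n : `|fwd_row x w n| <= Cr * (`|x| + `|w|).
Proof.
apply: le_trans (ler_normD _ _) _.
have h1 := Pcn (rw n w); have h2 : `|rw n w| <= `|w| := row_norm piK n w.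
have h3 : `|if n is k.+1 then P (rw k w) else J1 x| <= C * `|x| + C * C * `|w|.
  case: n {h1 h2} => [|n]; first by apply: le_trans (J1n x) _; rewrite lerDl mulr_ge0.
  apply: le_trans (Pn _) _; apply: le_trans (ler_wpM2l CC (row_norm piK n w)) _.
  by rewrite lerDr mulr_ge0.
have h4 : (1 + C * C) * `|rw n w| <= (1 + C * C) * `|w| by rewrite ler_wpM2l // addr_ge0.
have hx : 0 <= C * C * `|x| by rewrite mulr_ge0.
have hw : 0 <= C * `|w| by rewrite mulr_ge0.
have x0 : 0 <= `|x| by []; rewrite /Cr; lra.
Qed.

Let bwd_norm w n : `|bwd_row w n| <= Cr * `|w|.
Proof.
apply: le_trans (ler_normD _ _) _.
have h1 := le_trans (Pcn (rw n w)) (ler_wpM2l (addr_ge0 ler01 CC) (row_norm piK n w)).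
have h2 := le_trans (Pn (rw n.+1 w)) (ler_wpM2l CC (row_norm piK n.+1 w)).
have hw : 0 <= C * `|w| by rewrite mulr_ge0.
rewrite /Cr; lra.
Qed.

(** Rows of both shifted families are bounded by two rows of [w] whose indices tend to infinity; row
    0 is left aside because it may carry [J1 x]. *)
Let rnull_comb w (r : nat -> c0 R) : (exists K, forall n, (0 < n)%N ->
  `|r n| <= Cr * (`|rw n w| + `|rw (K n) w|) /\ (n <= (K n).+1)%N) -> rnull r.
Proof.
move=> [K hK] e e0; have Cr1 : 0 < 2 * Cr + 1 by rewrite ltr_wpDl // mulr_ge0.
have [N hN] := row_null piK w (divr_gt0 e0 Cr1); exists N.+1 => n Nn.
have [h1 h2] := hK n (leq_ltn_trans (leq0n _) Nn).
apply: le_trans h1 _; have a1 := hN n (ltnW Nn); have a2 : `|rw (K n) w| <= e / (2 * Cr + 1).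
  by apply: hN; lia.
apply: le_trans (ler_wpM2l Cr0 (lerD a1 a2)) _.
rewrite -mulr2n -[_ *+ 2]mulr_natl mulrA [Cr * 2]mulrC mulrA ler_pdivrMr //.
by move: e0; lra.
Qed.

Let CrP n w k : `|P (rw k w)| + `|Pc (rw n w)| <= Cr * (`|rw n w| + `|rw k w|).
Proof.
have := Pn (rw k w); have := Pcn (rw n w).
have a1 : 0 <= C * `|rw n w| by rewrite mulr_ge0.
have a2 : 0 <= C * `|rw k w| by rewrite mulr_ge0.
have a3 : 0 <= C * C * `|rw n w| by rewrite mulr_ge0.
have a4 : 0 <= C * C * `|rw k w| by rewrite mulr_ge0.
have a5 : 0 <= `|rw n w| by []; have a6 : 0 <= `|rw k w| by []; rewrite /Cr; lra.
Qed.

Let fwd_null x w : rnull (fwd_row x w).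
Proof.
apply: (@rnull_comb w); exists predn => -[//|n] _; split=> //.
by apply: le_trans (ler_normD _ _) (CrP _ _ _).
Qed.

Let bwd_null w : rnull (bwd_row w).
Proof.
apply: (@rnull_comb w); exists succn => n _; split; last by lia.
by apply: le_trans (ler_normD _ _) (CrP _ _ _).
Qed.

Let fwd x w := glue pr (fwd_row x w).
Let bwd w := glue pr (bwd_row w).

Let fwdE x w n : rw n (fwd x w) = fwd_row x w n.
Proof. by rewrite /fwd (row_glue prK piK). Qed.
Let bwdE w n : rw n (bwd w) = bwd_row w n.
Proof. by rewrite /bwd (row_glue prK piK). Qed.

Let bwd_fwd x w : bwd (fwd x w) = w.
Proof.
apply: (row_ext prK piK) => n; rewrite bwdE /bwd_row !fwdE /fwd_row.
rewrite (linmapD Pl) PP PPc addr0 (linmapD Pcl) PcPc.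
have -> : Pc (if n is k.+1 then P (rw k w) else J1 x) = 0 by case: n.
by rewrite add0r /Pc; abel.
Qed.

Let Q1_fwd x w : Q1 (rw 0 (fwd x w)) = x.
Proof. by rewrite fwdE (linmapD Q1l) JQ1 Q1Pc addr0. Qed.

Let fwd_bwd w : fwd (Q1 (rw 0 w)) (bwd w) = w.
Proof.
apply: (row_ext prK piK) => n; rewrite fwdE /fwd_row bwdE /bwd_row.
rewrite (linmapD Pcl) PcP PcPc add0r.
have -> : (if n is k.+1 then P (rw k (bwd w)) else J1 (Q1 (rw 0 w))) = P (rw n w).
  by case: n => // n; rewrite bwdE /bwd_row (linmapD Pl) PP PPc addr0.
by rewrite /Pc; abel.
Qed.

Let fwd_lin (r : R) x x' w w' : fwd (r *: x + x') (r *: w + w') = r *: fwd x w + fwd x' w'.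
Proof.
apply: (row_ext prK piK) => n; rewrite (row_lin piK) !fwdE /fwd_row.
rewrite (row_lin piK) Pcl [in RHS]scalerDr.
case: n => [|n]; first by rewrite J1l; abel.
by rewrite (row_lin piK) Pl; abel.
Qed.

Let bwd_lin : linmap bwd.
Proof.
move=> r w w'; apply: (row_ext prK piK) => n; rewrite (row_lin piK) !bwdE /bwd_row.
by rewrite !(row_lin piK) Pl Pcl [in RHS]scalerDr; abel.
Qed.

(** [x] is sent to the pair of [sp x] and [odds (Q2 x)]: the odd half of its [c0] component is split
    off and the even half fills the freed place. [un] undoes this. *)
Let sp x := x - J2 (Q2 x) + J2 (evens (Q2 x)).
Let un x a := x - J2 (Q2 x) + J2 (merge (Q2 x) a).

Let Q2_sp x : Q2 (sp x) = evens (Q2 x).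
Proof. by rewrite (linmapD Q2l) (linmapB Q2l) !JQ2 subrr add0r. Qed.

Let Q2_un x a : Q2 (un x a) = merge (Q2 x) a.
Proof. by rewrite (linmapD Q2l) (linmapB Q2l) !JQ2 subrr add0r. Qed.

Lemma decomposition : exists (T : X -> c0 R) (S : c0 R -> X) (D : R),
  [/\ linmap T, linmap S, cancel T S, cancel S T &
     (forall x, `|T x| <= D * `|x|) /\ (forall a, `|S a| <= D * `|a|)].
Proof.
pose T x := fwd (sp x) (odds (Q2 x)).
pose S w := un (Q1 (rw 0 w)) (bwd w).
have spn x : `|sp x| <= (1 + C * C + C * C) * `|x|.
  have h1 := le_trans (J2n (Q2 x)) (ler_wpM2l C0 (Q2n x)).
  have h2 := le_trans (J2n _) (ler_wpM2l C0 (le_trans (evens_norm (Q2 x)) (Q2n x))).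
  apply: le_trans (ler_normD _ _) _; apply: le_trans (lerD (ler_normB _ _) (lexx _)) _.
  lra.
have unn x a : `|un x a| <= (1 + C * C + C * C + C) * (`|x| + `|a|).
  have h1 := le_trans (J2n (Q2 x)) (ler_wpM2l C0 (Q2n x)).
  have h2 := le_trans (J2n _) (ler_wpM2l C0 (merge_norm (Q2 x) a)).
  have h3 := ler_wpM2l C0 (Q2n x).
  apply: le_trans (ler_normD _ _) _; apply: le_trans (lerD (ler_normB _ _) (lexx _)) _.
  have a0 : 0 <= `|a| by [].
  have a1 : 0 <= C * `|x| by rewrite mulr_ge0.
  have a2 : 0 <= C * C * `|a| by rewrite mulr_ge0.
  lra.
have Tn x : `|T x| <= Cr * (1 + C * C + C * C + C) * `|x|.
  apply: (glue_norm prK); first exact: fwd_null.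
  move=> n; apply: le_trans (fwd_norm _ _ n) _; rewrite -mulrA ler_wpM2l //.
  by have := le_trans (odds_norm (Q2 x)) (Q2n x); have := spn x; lra.
have bn w : `|bwd w| <= Cr * `|w|.
  by apply: (glue_norm prK) => [|n]; [exact: bwd_null|exact: bwd_norm].
have D1 : 0 <= 1 + C * C + C * C + C by move: C0 CC; lra.
have Sn w : `|S w| <= (1 + C * C + C * C + C) * (C + Cr) * `|w|.
  apply: le_trans (unn _ _) _; rewrite -mulrA ler_wpM2l //.
  have := bn w; have := le_trans (Q1n _) (ler_wpM2l C0 (row_norm piK 0 w)); lra.
exists T, S, (Cr * (1 + C * C + C * C + C) + (1 + C * C + C * C + C) * (C + Cr)); split.
- move=> r x y; rewrite /T -fwd_lin Q2l odds_lin; congr (fwd _ _).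
  by rewrite /sp Q2l evens_lin !J2l scalerDr scalerBr; abel.
- move=> r x y; rewrite /S (row_lin piK) Q1l bwd_lin /un Q2l merge_lin !J2l scalerDr scalerBr.
  by abel.
- move=> x; rewrite /S /T Q1_fwd bwd_fwd /un Q2_sp merge_evens_odds /sp; abel.
- move=> w; rewrite /T /S Q2_un odds_merge -[RHS]fwd_bwd; congr (fwd _ _).
  by rewrite /sp Q2_un evens_merge /un; abel.
- split=> x.
    by apply: le_trans (Tn x) _; rewrite ler_wpM2r // lerDl !mulr_ge0 // addr_ge0.
  by apply: le_trans (Sn x) _; rewrite ler_wpM2r // lerDr !mulr_ge0.
Qed.

End Decomposition.

(** * Translation between constants, Lipschitz maps and continuous linear maps *)

Section LipschitzLinear.
Variables (R : realType) (X Y : normedModType R).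

Lemma lipschitz_const (f : X -> Y) : lipschitz f ->
  exists2 L : R, 0 < L & forall x y, `|f x - f y| <= L * `|x - y|.
Proof.
move=> /pinfty_ex_gt0[L L0 fL]; exists L => // x y.
exact: (fL (x, y) (conj I I)).
Qed.

Lemma lipschitz_of_const (f : X -> Y) (L : R) : 
  (forall x y, `|f x - f y| <= L * `|x - y|) -> lipschitz f.
Proof.
move=> fL; exists L; split; first exact: num_real.
by move=> M /ltW LM [x y] _ /=; apply: le_trans (fL x y) _; rewrite ler_wpM2r.
Qed.

Lemma continuous_linear_lipschitz (f : {linear X -> Y}) : continuous f -> lipschitz f.
Proof.
move=> /linear_bounded_continuous/linear_boundedP/pinfty_ex_gt0[L L0 fL].
by apply: (@lipschitz_of_const _ L) => x y; rewrite -linearB.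
Qed.

Lemma bounded_linmap (f : X -> Y) (D : R) : linmap f -> (forall x, `|f x| <= D * `|x|) ->
  exists2 g : {linear X -> Y}, g =1 f & continuous g.
Proof.
move=> fl fD; pose m := GRing.isLinear.Build R X Y *:%R f fl.
pose g : {linear X -> Y} := HB.pack f m.
exists g => //; apply/linear_bounded_continuous/linear_boundedP.
exists D; split; first exact: num_real.
by move=> r /ltW Dr x; apply: le_trans (fD x) _; rewrite ler_wpM2r.
Qed.
End LipschitzLinear.

Theorem theorem2p2 (R : realType) (X : completeNormedModType R) :
  (exists (T : {linear X -> c0 R}) (S : {linear c0 R -> X}),
      cancel T S /\ cancel S T /\ continuous T /\ continuous S)
  <->
  (exists (U : X -> c0 R) (V : c0 R -> X),
      cancel U V /\ cancel V U /\ lipschitz U /\ lipschitz V).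
Proof.
split=> [[T [S [TS [ST [Tc Sc]]]]]|[U [V [UK [VK [UL VL]]]]]].
  exists T, S; do ![split=> //]; exact: continuous_linear_lipschitz.
have [L1 L10 {}UL] := lipschitz_const UL; have [L2 L20 {}VL] := lipschitz_const VL.
pose L := Num.max L1 L2.
have L0 : 0 < L by rewrite lt_max L10.
have {}UL x y : `|U x - U y| <= L * `|x - y|.
  by apply: le_trans (UL x y) _; rewrite ler_wpM2r // le_max lexx.
have {}VL x y : `|V x - V y| <= L * `|x - y|.
  by apply: le_trans (VL x y) _; rewrite ler_wpM2r // le_max lexx orbT.
have Xc : @seq_complete R X by exact: complete_seq_complete.
have c0c : @seq_complete R (c0 R).
  (* Completeness of [c0] is transported from [X]: [V] carries Cauchy sequences to Cauchy sequences
     and [U] brings the limit back. *)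
  move=> u cu; have [|l hl] := Xc (fun n => V (u n)).
    move=> e e0; have [N hN] := cu _ (divr_gt0 e0 L0); exists N => m n Nm Nn.
    by apply: le_trans (VL _ _) _; rewrite mulrC -ler_pdivlMr //; exact: hN.
  exists (U l) => e e0; have [N hN] := hl _ (divr_gt0 e0 L0); exists N => n Nn.
  by rewrite -(VK (u n)); apply: le_trans (UL _ _) _; rewrite mulrC -ler_pdivlMr //; exact: hN.
have [J [K [K0 Jl JL JK]]] := linear_embedding_c0 UK VK L0 UL VL.
have UJ x y : `|U x - U y| <= L * K * `|J x - J y|.
  apply: le_trans (UL x y) _; rewrite -mulrA ler_wpM2l ?(ltW L0) //.
  by rewrite -(linmapB Jl); exact: JK.
have LK : 0 < L * K by rewrite mulr_gt0.
have [W [WJ WL]] := lipschitz_extension_c0 0 LK UJ.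
have [d d_dense] := separable_of_lipschitz UK L0 VL.
(* The Lipschitz constant of [V o W]: [L] for [V], and [4 * (L * K)] for the extension [W] of [U]
   along [J]. *)
have lam0 : 0 < L * (4 * (L * K)) by rewrite !mulr_gt0.
have Phil : lip (L * (4 * (L * K))) (fun z => V (W z)).
  by move=> z z'; apply: le_trans (VL _ _) _; rewrite -mulrA ler_wpM2l ?(ltW L0).
have PhiJ : cancel J (fun z => V (W z)) by move=> x; rewrite WJ UK.
have [J1 [Q1 [C1 [J1l Q1l J1n Q1n JQ1]]]] :=
  complemented Xc Jl (ltW L0) (ltW K0) JL JK lam0 Phil PhiJ d_dense.
have [J2 [Q2 [C2 [J2l Q2l J2n Q2n JQ2]]]] :=
  contains_complemented_c0 Xc c0c VK L0 UL VL Jl (ltW L0) K0 JL JK.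
have [pr [pi [prK piK]]] := nat_pairing.
pose C := Num.max 0 (Num.max C1 C2).
have C0 : 0 <= C by rewrite le_max lexx.
have C1C : C1 <= C by rewrite !le_max lexx orbT.
have C2C : C2 <= C by rewrite !le_max lexx !orbT.
have [T [S [D [Tl Sl TS ST [Tn Sn]]]]] := decomposition C0 J1l Q1l J2l Q2l
  (fun x => le_trans (J1n x) (ler_wpM2r (normr_ge0 x) C1C))
  (fun a => le_trans (Q1n a) (ler_wpM2r (normr_ge0 a) C1C))
  (fun a => le_trans (J2n a) (ler_wpM2r (normr_ge0 a) C2C))
  (fun x => le_trans (Q2n x) (ler_wpM2r (normr_ge0 x) C2C)) JQ1 JQ2 prK piK.
have [T' TE Tc] := bounded_linmap Tl Tn; have [S' SE Sc] := bounded_linmap Sl Sn.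
exists T', S'; split; first by move=> x; rewrite TE SE TS.
by split=> [a|]; first by rewrite SE TE ST.
Qed.
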